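(* There exist absolute constants $c_1,c_2,c_3>0$ and, for every $d$, a distribution $\mathcal{D}$ over covariance matrices $\Sigma\in\mathbb{R}^{d\times d}$ with $\mathbb{I}\preceq\Sigma\preceq 2\mathbb{I}$ such that the following holds. Let $\alpha\le c_1/\sqrt{d}$, let $\varepsilon,\delta\in[0,1]$ with $\delta\le c_2\min\left\{\frac{1}{n},\frac{d^2}{n\log(n/d^2)}\right\}$, and let $M:\mathbb{R}^{n\times d}\to\mathbb{R}^{d\times d}$ be an $(\varepsilon,\delta)$-differentially private mechanism such that, for $\Sigma\sim\mathcal{D}$ and $X\sim\mathcal{N}(0,\Sigma)^{\otimes n}$, it satisfies $\mathbb{E}_{X,M}\left[\|\Sigma^{-1/2}(M(X)-\Sigma)\Sigma^{-1/2}\|_2^2\right]\le\alpha^2$. Then $n\ge c_3\frac{d^{1.5}}{\alpha\varepsilon}$. (That is, $\alpha=O(1/\sqrt d)$, $\delta\le O(\min\{1/n, d^2/(n\log(n/d^2))\})$, and $n\ge\Omega(d^{1.5}/(\alpha\varepsilon))$.)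
   Context: A randomized algorithm $M:\mathcal{X}^n\to\mathcal{Y}$ is $(\varepsilon,\delta)$-differentially private if for every pair of datasets $X,X'\in\mathcal{X}^n$ differing in exactly one entry and every measurable $Y\subseteq\mathcal{Y}$, $\Pr[M(X)\in Y]\le e^{\varepsilon}\Pr[M(X')\in Y]+\delta$. $\|\cdot\|_2$ denotes the spectral norm of a matrix. $\mathcal{N}(0,\Sigma)^{\otimes n}$ denotes $n$ i.i.d. samples from $\mathcal{N}(0,\Sigma)$; the expectation is over the samples and the internal randomness of $M$. *)

(* Defs.v *)
From HB Require Import structures.
From mathcomp Require Import all_boot all_order all_algebra.
From mathcomp Require Import all_classical all_reals all_analysis.
From mathcomp Require Import measurable_realfun.

Set Implicit Arguments.
Unset Strict Implicit.
Unset Printing Implicit Defensive.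

Import Order.TTheory GRing.Theory Num.Theory.
Import numFieldNormedType.Exports.

Local Open Scope classical_set_scope.
Local Open Scope ring_scope.

Definition measure_matrix_display : measure_display -> measure_display.
Proof. exact. Qed.

(* The product sigma-algebra on matrices: it is generated by the entries, so it
   is the Borel sigma-algebra when the entries are real. *)
Section measurable_matrix.
Context {d} {T : measurableType d}.
Variables m n : nat.

Definition matrix_cylinder : set (set 'M[T]_(m, n)) :=
  [set B | exists (i : 'I_m) (j : 'I_n) (A : set T),
     measurable A /\ B = [set x : 'M[T]_(m, n) | A (x i j)]].

Let matrix_set0 : <<s matrix_cylinder >> set0.
Proof. exact: sigma_algebra0. Qed.

Let matrix_setC A : <<s matrix_cylinder >> A -> <<s matrix_cylinder >> (~` A).
Proof. exact: sigma_algebraC. Qed.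

Let matrix_bigcup (F : (set 'M[T]_(m, n))^nat) :
  (forall i, <<s matrix_cylinder >> (F i)) ->
  <<s matrix_cylinder >> (\bigcup_i F i).
Proof. exact: sigma_algebra_bigcup. Qed.

HB.instance Definition _ := @isMeasurable.Build (measure_matrix_display d)
  'M[T]_(m, n) <<s matrix_cylinder >> matrix_set0 matrix_setC matrix_bigcup.

End measurable_matrix.

Lemma measurable_fun_matrixP d1 d2 (T1 : measurableType d1)
    (T2 : measurableType d2) m n (f : T1 -> 'M[T2]_(m, n)) :
  measurable_fun setT f <->
  forall i j, measurable_fun setT (fun x => f x i j).
Proof.
split=> [mf i j|mf].
  move=> _ A mA; rewrite setTI.
  have mB : measurable [set x : 'M[T2]_(m, n) | A (x i j)].
    by apply: sub_sigma_algebra; exists i, j, A.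
  by have := mf measurableT _ mB; rewrite setTI.
apply: (@measurability _ _ _ _ _ _ (@matrix_cylinder _ T2 m n)) => //.
move=> _ [_ [i [j [A [mA ->]]]] <-].
by have := mf i j measurableT _ mA.
Qed.

(* The law of n independent draws from P. *)
Section iid.
Context {d} {T : measurableType d} {R : realType}.

Definition cons_pair n (x : T * n.-tuple T) : n.+1.-tuple T :=
  [tuple of x.1 :: x.2].

Let measurable_cons_pair n : measurable_fun setT (@cons_pair n).
Proof. by apply: measurable_cons. Qed.

HB.instance Definition _ n :=
  isMeasurableFun.Build _ _ _ _ (@cons_pair n) (@measurable_cons_pair n).

Fixpoint iid (P : probability T R) (n : nat) : probability (n.-tuple T) R :=
  if n is k.+1 then distribution (P \x iid P k)%E (@cons_pair k)
  else dirac [tuple].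

End iid.

Section linear_algebra.
Context {R : realType}.

Definition psd d (A : 'M[R]_d) : Prop :=
  A^T = A /\ forall v : 'cV[R]_d, 0 <= (v^T *m A *m v) 0 0.

Definition loewner_le d (A B : 'M[R]_d) : Prop := psd (B - A).

(* The unique psd square root of S when S is psd, and 0 otherwise. *)
Definition sqrtmx d (S : 'M[R]_d) : 'M[R]_d :=
  xget 0 [set B | psd B /\ B *m B = S].

Definition invsqrtmx d (S : 'M[R]_d) : 'M[R]_d := invmx (sqrtmx S).

Definition l2norm d (v : 'cV[R]_d) : R := Num.sqrt (\sum_i v i 0 ^+ 2).

Definition spectral_norm m n (A : 'M[R]_(m, n)) : R :=
  sup [set l2norm (A *m v) | v in [set v : 'cV[R]_n | l2norm v <= 1]].

End linear_algebra.

(* N(0, S) on row vectors, as the law of g *m S^(1/2) for g a row of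
   independent standard normals. *)
Section multivariate_normal.
Context {R : realType}.

Definition normal_map d (S : 'M[R]_d)
    (g : d.-tuple (measurableTypeR R)) : 'rV[R]_d :=
  (\row_i tnth g i : 'rV[R]_d) *m sqrtmx S.

Let measurable_normal_map d (S : 'M[R]_d) : measurable_fun setT (normal_map S).
Proof.
apply/measurable_fun_matrixP => i j.
under eq_fun do rewrite /normal_map mxE.
apply: measurable_sum => k.
apply: measurable_funM => //.
under eq_fun do rewrite mxE.
exact: measurable_tnth.
Qed.

HB.instance Definition _ d (S : 'M[R]_d) :=
  isMeasurableFun.Build _ _ _ _ (normal_map S) (@measurable_normal_map d S).

Definition mvnormal d (S : 'M[R]_d) :
    probability 'rV[R]_d R :=
  distribution (iid (normal_prob (0 : R) 1) d) (normal_map S).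

End multivariate_normal.

Section differential_privacy.
Context {dX dY} {X : measurableType dX} {Y : measurableType dY} {R : realType}.

Definition neighbors n (x x' : n.-tuple X) : Prop :=
  exists i : 'I_n, tnth x i <> tnth x' i /\
    forall j : 'I_n, j != i -> tnth x j = tnth x' j.

(* A randomized algorithm is a probability kernel: M x is the law of its output
   on the dataset x. *)
Definition diff_private n (eps delta : R) (M : R.-pker (n.-tuple X) ~> Y) :
    Prop :=
  forall x x' : n.-tuple X, neighbors x x' ->
  forall A : set Y, measurable A ->
  (M x A <= (expR eps)%:E * M x' A + delta%:E)%E.

End differential_privacy.

Section covariance_estimation.
Context {R : realType}.

Definition cov_error d (S A : 'M[R]_d) : R :=
  spectral_norm (invsqrtmx S *m (A - S) *m invsqrtmx S) ^+ 2.

(* The n samples in R^d (the rows of the data matrix) are an n-tuple of row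
   vectors. The covariance S is itself drawn from D, so the expectation of the
   error over the experiment averages over S as well; in particular a mechanism
   whose expected error is at most e for D-almost every S satisfies
   expected_cov_error D M <= e. *)
Definition expected_cov_error d n (D : probability 'M[R]_d R)
    (M : R.-pker (n.-tuple 'rV[R]_d) ~> 'M[R]_d) : \bar R :=
  (\int[D]_S \int[iid (mvnormal S) n]_x \int[M x]_A (cov_error S A)%:E)%E.

(* min {1/n, d^2 / (n log (n/d^2))}. When n <= d^2 the logarithm is not
   positive and the second term is read as +oo. *)
Definition delta_max (d n : nat) : R :=
  if (d ^ 2 < n)%N then
    Num.min n%:R^-1 (d%:R ^+ 2 / (n%:R * ln (n%:R / d%:R ^+ 2)))
  else n%:R^-1.

End covariance_estimation.

(* Main.v *)
Require Import Defs.
From HB Require Import structures.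
From mathcomp Require Import all_boot all_order all_algebra.
From mathcomp Require Import all_classical all_reals all_analysis.
From mathcomp Require Import measurable_realfun ring lra zify.

Set Implicit Arguments.
Unset Strict Implicit.
Unset Printing Implicit Defensive.

Import Order.TTheory GRing.Theory Num.Theory.
Import numFieldNormedType.Exports.

Local Open Scope classical_set_scope.
Local Open Scope ring_scope.

(* The covariance is drawn from a family that encodes a random q x p regression
   matrix B with q p of order d^2: for (u, v) with u standard Gaussian and
   v = B u + noise, the cross-covariance of (u, v) is B. The entries of B are
   independent and uniform on [-eta, eta] with eta = 1 / (8 d), so that the
   covariance stays between 1 and 2. For d = 1 the model is u + v instead.

   Fingerprinting: given an estimate of B with error beta^2 = 16 d alpha^2 in
   Frobenius norm, correlate the (windowed) estimation error with the score of
   each sample. Summed over samples, integration by parts in each entry of B shows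
   that the expected correlation is at least of order d^2. Replacing one sample by
   a fresh one makes its correlation centered, so by privacy each sample
   contributes at most O(eps beta + delta eta d^2). Comparing the two bounds gives
   n >= c d^2 / (eps beta), which is the claim.

   The law of a centered Gaussian vector depends on its factor A only through
   A^T A; this identifies the normal law defined by the symmetric square root of
   the covariance with the regression model. *)

(** * Integration against iid laws *)

(** The window [om], equal to 1 - (x / eta)^2 on [-eta, eta], vanishes at both ends, so integration
    by parts against the uniform prior leaves no boundary term. Its mean 2/3 is the gain per entry
    of B; differentiating it costs 1/6 per entry plus 6 / eta^2 times the squared error, whence a
    net gain q p / 2. As eta is of order 1 / d, the last cost is of order d^2 (d alpha^2): this is
    where alpha = O(1 / sqrt d) comes from. The factor sqrt d in beta is the price of passing from
    the spectral to the Frobenius norm.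

    A Gaussian score is unbounded, while approximate privacy controls bounded statistics. The
    comparison is therefore made with the fresh sample y held fixed: the statistic is then bounded
    by an integrable function of y, which takes the place of a truncation of the tails.

    Likelihoods are taken relative to a law free of B, so that one entry of B can vary while the
    data stay fixed. The Loewner condition and the error enter through measurable bounds obtained by
    decoding B from the covariance. *)

Lemma integral_probability_cst d (T : measurableType d) (R : realType)
    (P : probability T R) (c : \bar R) : (\int[P]_x c = c)%E.
Proof.
rewrite [LHS]integral_cst // -[RHS]mule1; congr (_ * _)%E.
exact: probability_setT.
Qed.

Lemma measurable_fun_tnth d1 d2 (T1 : measurableType d1) (T2 : measurableType d2)
    n (f : T1 -> n.-tuple T2) (i : 'I_n) : measurable_fun setT f ->
  measurable_fun setT (fun x => tnth (f x) i).
Proof. by move=> /measurable_fun_tnthP/(_ i). Qed.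

Section iid_integral.
Local Open Scope ereal_scope.
Context {d} {T : measurableType d} {R : realType}.
Variable P : probability T R.

Lemma measurable_fun_cons_pair n : measurable_fun setT (@cons_pair d T n).
Proof. exact: measurable_cons. Qed.

Lemma ge0_integral_iidS n (f : n.+1.-tuple T -> \bar R) :
  measurable_fun setT f -> (forall x, 0 <= f x) ->
  \int[iid P n.+1]_x f x = \int[P]_x \int[iid P n]_t f (cons_pair (x, t)).
Proof.
move=> mf f0; rewrite /= ge0_integral_pushforward //.
rewrite preimage_setT (@fubini_tonelli1 _ _ _ _ _ P (iid P n) (fun z => f (@cons_pair _ _ n z))) //.
exact: measurableT_comp.
Qed.

Lemma ge0_integral_iid0 (f : 0.-tuple T -> \bar R) :
  measurable_fun setT f -> (forall x, 0 <= f x) ->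
  \int[iid P 0]_x f x = f [tuple].
Proof. by move=> mf f0; rewrite /= integral_dirac // diracT mul1e. Qed.

Definition tset n (i : 'I_n) (x : n.-tuple T) (y : T) : n.-tuple T :=
  [tuple if j == i then y else tnth x j | j < n].

Lemma tnth_tset n (i j : 'I_n) x y :
  tnth (tset i x y) j = if j == i then y else tnth x j.
Proof. by rewrite tnth_mktuple. Qed.

Lemma measurable_tset n (i : 'I_n) :
  measurable_fun setT (fun z : n.-tuple T * T => tset i z.1 z.2).
Proof.
apply/measurable_fun_tnthP => j; rewrite /comp.
have [->|ji] := eqVneq j i.
  by under eq_fun do rewrite tnth_tset eqxx; exact: measurable_snd.
under eq_fun do rewrite tnth_tset (negbTE ji).
apply: measurable_fun_tnth; exact: measurable_fst.
Qed.

Lemma measurable_tsetr n (i : 'I_n) x : measurable_fun setT (tset i x).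
Proof.
have -> : tset i x = (fun z : n.-tuple T * T => tset i z.1 z.2) \o pair x by [].
exact: measurableT_comp (measurable_tset i) (measurable_pair1 x).
Qed.

Lemma tset_cons0 n x (t : n.-tuple T) y :
  tset ord0 (cons_pair (x, t)) y = cons_pair (y, t).
Proof.
apply: eq_from_tnth => j; rewrite tnth_tset.
have [k ->|->] := unliftP ord0 j; last by rewrite eqxx.
by rewrite eq_sym (negbTE (neq_lift _ _)) /cons_pair !tnthS.
Qed.

Lemma tset_consS n (i : 'I_n) x (t : n.-tuple T) y :
  tset (lift ord0 i) (cons_pair (x, t)) y = cons_pair (x, tset i t y).
Proof.
apply: eq_from_tnth => j; rewrite tnth_tset.
have [k ->|->] := unliftP ord0 j; last by rewrite (negbTE (neq_lift _ _)).
by rewrite (inj_eq lift_inj) /cons_pair !tnthS tnth_tset.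
Qed.

(** By independence, integrating a coordinate once more changes nothing. A later coordinate is
    handled by induction inside the tail, coordinate 0 by exchanging the two integrals. *)
Lemma ge0_iid_resample n (i : 'I_n) (f : n.-tuple T -> \bar R) :
  measurable_fun setT f -> (forall x, 0 <= f x) ->
  \int[iid P n]_x f x = \int[iid P n]_x \int[P]_y f (tset i x y).
Proof.
elim: n i f => [[]//|n IH] i f mf f0.
rewrite ge0_integral_iidS // [RHS]ge0_integral_iidS; first last.
- by move=> x; exact: integral_ge0.
- apply: (measurable_fun_fubini_tonelli_F (fun z : n.+1.-tuple T * T => f (tset i z.1 z.2))) => //.
  by apply: measurableT_comp => //; exact: measurable_tset.
have mc x : measurable_fun setT (fun t => f (@cons_pair _ T n (x, t))).
  apply: (@measurableT_comp _ _ _ _ _ _ (fun z => f (@cons_pair _ _ n z))).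
    exact: measurableT_comp.
  exact: measurable_pair1.
have [j ->|->] := unliftP ord0 i.
  apply: eq_integral => x _; rewrite (IH j) //.
  by apply: eq_integral => t _; apply: eq_integral => y _; rewrite tset_consS.
transitivity (\int[iid P n]_t \int[P]_y f (cons_pair (y, t))).
  rewrite (@fubini_tonelli _ _ _ _ _ P (iid P n) (fun z => f (@cons_pair _ _ n z))) //.
  exact: measurableT_comp.
rewrite -[LHS](integral_probability_cst P).
by apply: eq_integral => x _; apply: eq_integral => t _; apply: eq_integral => y _; rewrite tset_cons0.
Qed.

(** Serves twice: for one sample in the privacy step, and for one entry of B under the prior. The
    nonnegative case applied to |f| gives the joint integrability behind the iterated integral. *)
Lemma iid_resample n (i : 'I_n) (f : n.-tuple T -> \bar R) :
  (iid P n).-integrable setT f ->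
  \int[iid P n]_x f x = \int[iid P n]_x \int[P]_y f (tset i x y).
Proof.
move=> /[dup] intf /integrableP[mf fi].
pose h (z : n.-tuple T * T) := f (tset i z.1 z.2).
have mh : measurable_fun setT h.
  by apply: measurableT_comp => //; exact: measurable_tset.
have ih : (iid P n \x P).-integrable setT h.
  apply/integrable12ltyP => //; rewrite -(ge0_iid_resample i (f := fun x => `|f x|)) //.
  exact: measurableT_comp.
transitivity (\int[iid P n \x P]_z h z); last first.
  exact/esym/(@integral12_prod_meas1 _ _ _ _ _ (iid P n) P h).
rewrite integralE [RHS]integralE.
congr (_ - _).
  rewrite fubini_tonelli1 //; last exact: measurable_funepos.
  rewrite (ge0_iid_resample i) //; last exact: measurable_funepos.
  by apply: eq_integral => x _; apply: eq_integral => y _; rewrite !funeposE.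
rewrite fubini_tonelli1 //; last exact: measurable_funeneg.
rewrite (ge0_iid_resample i) //; last exact: measurable_funeneg.
by apply: eq_integral => x _; apply: eq_integral => y _; rewrite !funenegE.
Qed.

Lemma ge0_integral_iid_tnth n (i : 'I_n) (f : T -> \bar R) :
  measurable_fun setT f -> (forall x, 0 <= f x) ->
  \int[iid P n]_x f (tnth x i) = \int[P]_y f y.
Proof.
move=> mf f0; rewrite (ge0_iid_resample i) //; last first.
  by apply: measurableT_comp => //; exact: measurable_fun_tnth.
under eq_integral do under eq_integral do rewrite tnth_tset eqxx.
exact: integral_probability_cst.
Qed.

End iid_integral.

Lemma map_cons_pair d1 d2 (T1 : measurableType d1) (T2 : measurableType d2)
    (psi : T2 -> T1) n (z : T2 * n.-tuple T2) :
  map_tuple psi (cons_pair z) = cons_pair (psi z.1, map_tuple psi z.2).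
Proof. exact: val_inj. Qed.

Lemma measurable_map_tuple d1 d2 (T1 : measurableType d1) (T2 : measurableType d2)
    (psi : T2 -> T1) n : measurable_fun setT psi ->
  measurable_fun setT (map_tuple psi : n.-tuple T2 -> n.-tuple T1).
Proof.
move=> mpsi; apply/measurable_fun_tnthP => i; rewrite /comp.
under eq_fun do rewrite tnth_map.
by apply: measurableT_comp => //; exact: measurable_fun_tnth.
Qed.

Section iid_change.
Local Open Scope ereal_scope.
Context d1 d2 (T1 : measurableType d1) (T2 : measurableType d2) (R : realType).
Variables (P : probability T1 R) (Q : probability T2 R).
Variables (psi : T2 -> T1) (l : T2 -> R).
Hypotheses (mpsi : measurable_fun setT psi) (ml : measurable_fun setT l).
Hypothesis PQ : forall f : T1 -> \bar R,
  measurable_fun setT f -> (forall x, 0 <= f x) ->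
  \int[P]_x f x = \int[Q]_y (f (psi y) * (expR (l y))%:E).

(** Densities multiply over independent coordinates, so log-densities add. Used with [psi] the
    identity, to pass from [rho t] to [gY], and with [psi] the observation map, to pass from normal
    samples to pairs (u, v). *)
Lemma ge0_integral_iid_density n (f : n.-tuple T1 -> \bar R) :
  measurable_fun setT f -> (forall x, 0 <= f x) ->
  \int[iid P n]_x f x =
  \int[iid Q n]_y (f (map_tuple psi y) *
                   (expR (\sum_(i < n) l (tnth y i)))%:E).
Proof.
have mW k (F : k.-tuple T1 -> \bar R) : measurable_fun setT F ->
    measurable_fun setT (fun y : k.-tuple T2 => F (map_tuple psi y) *
                   (expR (\sum_(i < k) l (tnth y i)))%:E).
  move=> mF; apply: emeasurable_funM.
    by apply: measurableT_comp => //; exact: measurable_map_tuple.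
  apply/measurable_EFinP; apply: measurableT_comp => //.
  apply: measurable_sum => i; apply: measurableT_comp => //; exact: measurable_fun_tnth.
elim: n f => [|n IH] f mf f0.
  rewrite ge0_integral_iid0 // ge0_integral_iid0 //; last 2 first.
  - exact: mW.
  - by move=> x; rewrite mule_ge0 // lee_fin expR_ge0.
  by rewrite big_ord0 expR0 mule1; congr f; exact: val_inj.
rewrite ge0_integral_iidS // [RHS]ge0_integral_iidS; last 2 first.
- exact: mW.
- by move=> x; rewrite mule_ge0 // lee_fin expR_ge0.
rewrite PQ; last 2 first.
- apply: (measurable_fun_fubini_tonelli_F (fun z => f (@cons_pair _ _ n z))) => //.
  exact: measurableT_comp mf (@measurable_fun_cons_pair _ _ _).
- by move=> x; exact: integral_ge0.
have mc x : measurable_fun setT (fun t => f (@cons_pair _ T1 n (x, t))).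
  apply: (@measurableT_comp _ _ _ _ _ _ (fun z => f (@cons_pair _ _ n z))).
    exact: measurableT_comp mf (@measurable_fun_cons_pair _ _ _).
  exact: measurable_pair1.
apply: eq_integral => y _; rewrite IH // muleC -ge0_integralZl //; last 2 first.
- exact: (mW _ _ (mc (psi y))).
- by move=> x _; rewrite mule_ge0 // lee_fin expR_ge0.
apply: eq_integral => t _; rewrite muleCA map_cons_pair /= -EFinM -expRD.
by congr (_ * (expR _)%:E); rewrite big_ord_recl; congr (_ + _)%R; apply: eq_bigr => i _; rewrite /cons_pair tnthS.
Qed.

End iid_change.

Lemma ge0_integral_iid_cat d (T : measurableType d) (R : realType)
    (P : probability T R) p q (f : (p + q).-tuple T -> \bar R) :
  measurable_fun setT f -> (forall x, (0 <= f x)%E) ->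
  (\int[iid P (p + q)]_x f x =
   \int[iid P p]_x \int[iid P q]_y f (cat_tuple x y))%E.
Proof.
have mcat (k : nat) : measurable_fun setT
    (fun z : k.-tuple T * q.-tuple T => cat_tuple z.1 z.2).
  apply/measurable_fun_tnthP => i; rewrite /comp.
  rewrite (_ : (fun z => _) = fun z : k.-tuple T * q.-tuple T =>
    match fintype.split i with inl j => tnth z.1 j | inr j => tnth z.2 j end); last first.
    apply/funext => z; case: splitP => j ij.
      by rewrite (_ : i = lshift q j) ?tnth_lshift //; exact: val_inj.
    by rewrite (_ : i = rshift k j) ?tnth_rshift //; exact: val_inj.
  by case: (fintype.split i) => j; exact: measurable_fun_tnth.
elim: p f => [|p IH] f mf f0.
  rewrite ge0_integral_iid0; last 2 first.
  - apply: (measurable_fun_fubini_tonelli_F (fun z : 0.-tuple T * q.-tuple T => f (cat_tuple z.1 z.2))) => //.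
    exact: measurableT_comp mf (mcat 0%N).
  - by move=> x; exact: integral_ge0.
  by apply: eq_integral => x _; congr f; exact: val_inj.
rewrite [LHS](@ge0_integral_iidS _ _ _ P (p + q) f) // [RHS]ge0_integral_iidS; last 2 first.
- apply: (measurable_fun_fubini_tonelli_F (fun z : p.+1.-tuple T * q.-tuple T => f (cat_tuple z.1 z.2))) => //.
  exact: measurableT_comp mf (mcat p.+1).
- by move=> x; exact: integral_ge0.
apply: eq_integral => x _; rewrite IH //.
  by apply: eq_integral => y _; apply: eq_integral => z _; congr f; exact: val_inj.
apply: (@measurableT_comp _ _ _ _ _ _ (fun z => f (@cons_pair _ _ (p + q) z))).
  exact: measurableT_comp mf (@measurable_fun_cons_pair _ _ _).
exact: measurable_pair1.
Qed.

(* No measurability: the integral of a nonnegative function is the supremum over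
   the simple functions below it. *)
Lemma ge0_le_integral_sup d (T : measurableType d) (R : realType)
    (mu : {measure set T -> \bar R}) (f g : T -> \bar R) :
  (forall x, (0 <= f x)%E) -> (forall x, (f x <= g x)%E) ->
  (\int[mu]_x f x <= \int[mu]_x g x)%E.
Proof.
move=> f0 fg; have g0 x : (0 <= g x)%E by exact: le_trans (fg x).
rewrite (ge0_integralTE mu f0) (ge0_integralTE mu g0).
apply: ub_ereal_sup => _ [h /= hf <-]; apply: ereal_sup_ubound.
by exists h => // x; exact: le_trans (fg x).
Qed.

(** * Densities and affine changes of variable *)

Section density.
Local Open Scope ereal_scope.
Context d (T : measurableType d) (R : realType).
Variables (mu nu : {measure set T -> \bar R}) (g : T -> R).
Hypotheses (g0 : forall x, (0 <= g x)%R) (mg : measurable_fun setT g).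
Hypothesis nuE : forall A, measurable A -> nu A = \int[mu]_(x in A) (g x)%:E.

Import HBNNSimple.

Let integral_density_nnsfun (h : {nnsfun T >-> R}) :
  \int[nu]_x (h x)%:E = \int[mu]_x ((h x)%:E * (g x)%:E).
Proof.
rewrite integralT_nnsfun sintegralE.
transitivity (\int[mu]_x \sum_(r \in range h)
    (r%:E * ((\1_(h @^-1` [set r]) x)%:E * (g x)%:E))); last first.
  apply: eq_integral => x _; rewrite [in RHS](fimfunE h x) -fsumEFin //.
  rewrite ge0_mule_fsuml; last by move=> r; rewrite EFinM; exact: nnfun_muleindic_ge0.
  by apply: eq_fsbigr => r _; rewrite EFinM muleA.
have mi r : measurable_fun setT (fun x => (\1_(h @^-1` [set r]) x)%:E * (g x)%:E).
  apply: emeasurable_funM; last exact/measurable_EFinP.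
  exact/measurable_EFinP/measurable_indic.
have i0 r x : 0 <= (\1_(h @^-1` [set r]) x)%:E * (g x)%:E.
  by rewrite mule_ge0 // lee_fin.
rewrite ge0_integral_fsum //; last 2 first.
- by move=> r; exact: measurable_funeM.
- move=> r x _; rewrite muleA mule_ge0 ?lee_fin //; exact: nnfun_muleindic_ge0.
apply: eq_fsbigr => r; rewrite inE => -[y _ <-].
rewrite ge0_integralZl ?lee_fin // nuE //; congr (_ * _).
rewrite integral_mkcond; apply: eq_integral => x _.
rewrite patchE indicE; case: ifPn => xin; rewrite ?mul1e ?mul0e //.
Qed.

(** The usual extension: simple functions, then monotone convergence on both sides. *)
Lemma ge0_integral_density (f : T -> \bar R) :
  measurable_fun setT f -> (forall x, 0 <= f x) ->
  \int[nu]_x f x = \int[mu]_x (f x * (g x)%:E).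
Proof.
move=> mf f0; pose f_ := nnsfun_approx measurableT mf.
transitivity (limn (fun n => \int[nu]_x (f_ n x)%:E)).
  rewrite -monotone_convergence //.
  - apply: eq_integral => y _; apply/esym/cvg_lim => //.
    exact: cvg_nnsfun_approx.
  - by move=> n; exact/measurable_EFinP/measurable_funP.
  - by move=> n y _; rewrite lee_fin.
  - by move=> y _ m n mn; rewrite lee_fin; exact/lefP/nd_nnsfun_approx.
under eq_fun do rewrite integral_density_nnsfun.
rewrite -monotone_convergence //.
- apply: eq_integral => y _; apply/cvg_lim => //.
  by apply: cvgeZr => //; exact: cvg_nnsfun_approx.
- move=> n; apply: emeasurable_funM; last exact/measurable_EFinP.
  exact/measurable_EFinP/measurable_funP.
- by move=> n y _; rewrite mule_ge0 // lee_fin.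
- move=> y _ m n mn; apply: lee_wpmul2r; rewrite lee_fin //.
  exact/lefP/nd_nnsfun_approx.
Qed.

End density.

Section lebesgue_affine.
Context (R : realType).
Local Notation leb := (@lebesgue_measure R).

(** The push-forward of Lebesgue measure under x -> a x + b, scaled by a, gives every half-open
    interval its length; uniqueness identifies it with Lebesgue measure. *)
Lemma ge0_integral_lebesgue_affine (a b : R) (f : measurableTypeR R -> \bar R) :
  0 < a -> measurable_fun setT f -> (forall x, (0 <= f x)%E) ->
  (a%:E * \int[leb]_x f (a * x + b)%R = \int[leb]_x f x)%E.
Proof.
move=> a0 mf f0.
pose phi (x : measurableTypeR R) : measurableTypeR R := a * x + b.
have mphi : measurable_fun setT phi.
  by apply: measurable_funD => //; apply: measurable_funM.
pose m' : {measure set (measurableTypeR R) -> \bar R} :=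
  mscale (NngNum (ltW a0)) (pushforward leb phi).
pose m := m' mphi.
have lebE A : measurable A -> leb A = m A.
  apply: lebesgue_measure_unique => _ [[x y] /= xy <-].
  rewrite /mscale /= /pushforward.
  have -> : phi @^-1` `]x, y] = `](x - b) / a, (y - b) / a]%classic.
    apply/seteqP; split=> t; rewrite /phi /= !in_itv /=.
      by rewrite ltr_pdivrMr // ler_pdivlMr // [t * a]mulrC ltrBlDr lerBrDr.
    by rewrite ltr_pdivrMr // ler_pdivlMr // [t * a]mulrC ltrBlDr lerBrDr.
  rewrite !lebesgue_measure_itv /= !lte_fin ltr_pM2r ?invr_gt0 // ltrD2r.
  case: ifPn => _; last by rewrite mule0.
  by rewrite -!EFinD -EFinM; congr (_%:E); field; rewrite gt_eqF.
rewrite [RHS](eq_measure_integral m) => [|A mA _]; last exact: lebE.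
rewrite ge0_integral_mscale //; congr (_ * _)%E.
by rewrite ge0_integral_pushforward.
Qed.

End lebesgue_affine.

(** * Linear changes of variables in Gaussian integrals *)

Section gauss.
Context (R : realType).
Local Notation MR := (measurableTypeR R).
Local Notation gam := (normal_prob (0 : R) 1).

(* [J1] and [J] are the Lebesgue integrals up to a constant factor: the Gaussian
   density is cancelled. *)
Definition J1 (f : MR -> \bar R) : \bar R :=
  (\int[gam]_t (f t * (expR (t ^+ 2 / 2))%:E))%E.

Lemma measurable_expR_sqr : measurable_fun setT (fun t : MR => (expR (t ^+ 2 / 2))%:E).
Proof.
apply/measurable_EFinP; apply: measurableT_comp => //.
by apply: measurable_funM => //; exact: measurable_funX.
Qed.

Lemma J1_lebesgue (f : MR -> \bar R) : measurable_fun setT f -> (forall x, (0 <= f x)%E) ->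
  (J1 f = (normal_peak (1 : R))%:E * \int[lebesgue_measure]_x f x)%E.
Proof.
move=> mf f0; rewrite /J1.
rewrite (@ge0_integral_density _ _ _ lebesgue_measure gam (normal_pdf 0 1)); first last.
- by move=> x; rewrite mule_ge0 // lee_fin expR_ge0.
- by apply: emeasurable_funM => //; exact: measurable_expR_sqr.
- by [].
- exact: measurable_normal_pdf.
- by move=> x; exact: normal_pdf_ge0.
rewrite -ge0_integralZl //; last by rewrite lee_fin normal_peak_ge0.
apply: eq_integral => x _; rewrite -muleA muleC; congr (_ * _)%E.
rewrite -EFinM normal_pdfE // mulrCA -expRD.
rewrite subr0 expr1n (_ : _ + _ = 0) ?expR0 ?mulr1 //.
by rewrite mulNr addrN.
Qed.

Lemma J1_affine (a b : R) (f : MR -> \bar R) : 0 < a ->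
  measurable_fun setT f -> (forall x, (0 <= f x)%E) ->
  (a%:E * J1 (fun t => f (a * t + b)%R) = J1 f)%E.
Proof.
move=> a0 mf f0; rewrite !J1_lebesgue //.
  by rewrite muleCA ge0_integral_lebesgue_affine.
by apply: measurableT_comp mf _; apply: measurable_funD => //; apply: measurable_funM.
Qed.

Lemma gam_J1 (f : MR -> \bar R) :
  (\int[gam]_t f t = J1 (fun t => f t * (expR (- (t ^+ 2 / 2)))%:E))%E.
Proof.
by apply: eq_integral => t _; rewrite -muleA -EFinM -expRD addNr expR0 mule1.
Qed.

Definition rowt d (g : d.-tuple MR) : 'rV[R]_d := \row_i tnth g i.

Definition sqn d (x : 'rV[R]_d) : R := \sum_i x 0 i ^+ 2.

Lemma measurable_rowt d : measurable_fun setT (@rowt d).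
Proof.
apply/measurable_fun_matrixP => i j; under eq_fun do rewrite mxE.
exact: measurable_tnth.
Qed.

Lemma measurable_coord m n (i : 'I_m) (j : 'I_n) :
  measurable_fun setT (fun x : 'M[MR]_(m, n) => x i j).
Proof. by move: i j; apply/measurable_fun_matrixP. Qed.

Lemma measurable_sqn d : measurable_fun setT (@sqn d : 'rV[MR]_d -> MR).
Proof.
apply: measurable_sum => i; apply: measurable_funX; exact: measurable_coord.
Qed.

Definition J d (f : 'rV[MR]_d -> \bar R) : \bar R :=
  (\int[iid gam d]_g (f (rowt g) * (expR (sqn (rowt g) / 2))%:E))%E.

Lemma rowt_cons d (z : MR * d.-tuple MR) :
  rowt (cons_pair z) = row_mx (z.1)%:M (rowt z.2) :> 'rV[R]_(1 + d).
Proof.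
apply/rowP => i; rewrite !mxE; case: splitP => j ij; rewrite !mxE.
  by rewrite !ord1 eqxx (_ : i = ord0) //; apply: val_inj; rewrite /= ij ord1.
by rewrite (_ : i = lift ord0 j) ?tnthS //; apply: val_inj; rewrite /= ij.
Qed.

Lemma sqn_row d (t : R) (x : 'rV[R]_d) : sqn (row_mx t%:M x) = t ^+ 2 + sqn x.
Proof.
rewrite /sqn big_split_ord /= big_ord1; congr (_ + _).
  by rewrite row_mxEl mxE eqxx.
by apply: eq_bigr => i _; rewrite row_mxEr.
Qed.

Lemma measurable_row_cons dT (T : measurableType dT) d (h : T -> MR) (k : T -> 'rV[MR]_d) :
  measurable_fun setT h -> measurable_fun setT k ->
  measurable_fun setT (fun z => (row_mx (h z)%:M (k z) : 'rV[MR]_(1 + d))).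
Proof.
move=> mh mk; apply/measurable_fun_matrixP => i j; rewrite ord1.
rewrite (_ : (fun z => _) = fun z =>
  match fintype.split j with inl _ => h z | inr l => k z 0 l end); last first.
  apply/funext => z; rewrite mxE; case: splitP => l _ //.
  by rewrite mxE !ord1 eqxx.
case: (fintype.split j) => l //.
exact: (measurableT_comp (measurable_coord _ _)).
Qed.

Section nonneg.
Variables (d : nat) (f : 'rV[MR]_(1 + d) -> \bar R).
Hypotheses (mf : measurable_fun setT f) (f0 : forall x, (0 <= f x)%E).

Let F (z : MR * d.-tuple MR) := (f (row_mx (z.1)%:M (rowt z.2)) *
   (expR (z.1 ^+ 2 / 2))%:E * (expR (sqn (rowt z.2) / 2))%:E)%E.

Let mF : measurable_fun setT F.
Proof.
apply: emeasurable_funM; first apply: emeasurable_funM.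
- apply: (measurableT_comp mf).
  apply: measurable_row_cons; first exact: measurable_fst.
  exact: (measurableT_comp (@measurable_rowt d)).
- by apply: (measurableT_comp measurable_expR_sqr).
- apply/measurable_EFinP; apply: measurableT_comp => //.
  apply: measurable_funM => //.
  apply: (measurableT_comp (@measurable_sqn d)).
  by apply: (measurableT_comp (@measurable_rowt d)).
Qed.

Let F0 z : (0 <= F z)%E.
Proof. by rewrite !mule_ge0 // lee_fin expR_ge0. Qed.

Lemma measurable_J_row :
  measurable_fun setT (fun t : MR => J (fun x : 'rV[MR]_d => f (row_mx t%:M x))).
Proof.
rewrite /J.
pose G (z : MR * d.-tuple MR) := (f (row_mx (z.1)%:M (rowt z.2)) *
   (expR (sqn (rowt z.2) / 2))%:E)%E.
apply: (measurable_fun_fubini_tonelli_F G); last first.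
  by move=> z; rewrite /G mule_ge0 // lee_fin expR_ge0.
apply: emeasurable_funM.
  apply: (measurableT_comp mf); apply: measurable_row_cons; first exact: measurable_fst.
  exact: (measurableT_comp (@measurable_rowt d)).
apply/measurable_EFinP; apply: measurableT_comp => //.
apply: measurable_funM => //.
apply: (measurableT_comp (@measurable_sqn d)).
exact: (measurableT_comp (@measurable_rowt d)).
Qed.

Let mfJ : measurable_fun setT (fun x : d.+1.-tuple MR =>
   (f (rowt x) * (expR (sqn (rowt x) / 2))%:E)%E).
Proof.
apply: emeasurable_funM.
  exact: (measurableT_comp mf (@measurable_rowt d.+1)).
apply/measurable_EFinP; apply: measurableT_comp => //.
apply: measurable_funM => //.
exact: (measurableT_comp (@measurable_sqn d.+1) (@measurable_rowt d.+1)).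
Qed.

Let JF : J (d := d.+1) f = (\int[gam]_t \int[iid gam d]_g F (t, g))%E.
Proof.
have f'0 x : (0 <= f (rowt x) * (expR (sqn (rowt x) / 2))%:E)%E.
  by rewrite mule_ge0 // lee_fin expR_ge0.
apply: (etrans (ge0_integral_iidS gam mfJ f'0)).
apply: eq_integral => t _; apply: eq_integral => g _.
rewrite /F /= -muleA -EFinM -expRD -mulrDl -sqn_row.
by rewrite rowt_cons.
Qed.

(** Tonelli with the first coordinate outermost; [J_row2] has it innermost. Elimination uses both
    orders, since it shifts the first coordinate by the others and the others by the first. *)
Lemma J_row1 : J (d := d.+1) f = J1 (fun t => J (fun x : 'rV[MR]_d => f (row_mx t%:M x))).
Proof.
rewrite JF; apply: eq_integral => t _; rewrite muleC /J -ge0_integralZl //; first last.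
- by move=> x _; rewrite mule_ge0 // lee_fin expR_ge0.
- apply: emeasurable_funM.
    apply: (measurableT_comp mf); apply: measurable_row_cons => //; exact: measurable_rowt.
  apply/measurable_EFinP; apply: measurableT_comp => //.
  apply: measurable_funM => //.
  exact: (measurableT_comp (@measurable_sqn d) (@measurable_rowt d)).
by apply: eq_integral => g _; rewrite /F /= -muleA muleCA.
Qed.

Lemma J_row2 : J (d := d.+1) f = J (fun x : 'rV[MR]_d => J1 (fun t => f (row_mx t%:M x))).
Proof.
rewrite JF (fubini_tonelli F) //; apply: eq_integral => g _; rewrite muleC -ge0_integralZl //; first last.
- by move=> x _; rewrite mule_ge0 // lee_fin expR_ge0.
- apply: emeasurable_funM; last exact: measurable_expR_sqr.
  by apply: (measurableT_comp mf); apply: measurable_row_cons.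
by apply: eq_integral => t _; rewrite /F /= muleC.
Qed.

End nonneg.

Lemma J_ge0 d (f : 'rV[MR]_d -> \bar R) : (forall x, (0 <= f x)%E) -> (0 <= J f)%E.
Proof. by move=> f0; apply: integral_ge0 => x _; rewrite mule_ge0 // lee_fin expR_ge0. Qed.

Lemma measurable_mulmxr dT (T : measurableType dT) m n p (k : T -> 'M[MR]_(m, n)) (A : 'M[R]_(n, p)) :
  measurable_fun setT k -> measurable_fun setT (fun z => (k z *m A : 'M[MR]_(m, p))).
Proof.
move=> mk; apply/measurable_fun_matrixP => i j; under eq_fun do rewrite mxE.
apply: measurable_sum => l; apply: measurable_funM => //.
exact: (measurableT_comp (measurable_coord _ _)).
Qed.

Lemma measurable_addmx dT (T : measurableType dT) m n (k l : T -> 'M[MR]_(m, n)) :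
  measurable_fun setT k -> measurable_fun setT l ->
  measurable_fun setT (fun z => (k z + l z : 'M[MR]_(m, n))).
Proof.
move=> mk ml; apply/measurable_fun_matrixP => i j; under eq_fun do rewrite mxE.
by apply: measurable_funD; apply: (measurableT_comp (measurable_coord _ _)).
Qed.

Lemma measurable_scalemx dT (T : measurableType dT) m n (h : T -> MR) (k : T -> 'M[MR]_(m, n)) :
  measurable_fun setT h -> measurable_fun setT k ->
  measurable_fun setT (fun z => (h z *: k z : 'M[MR]_(m, n))).
Proof.
move=> mk ml; apply/measurable_fun_matrixP => i j; under eq_fun do rewrite mxE.
by apply: measurable_funM => //; apply: (measurableT_comp (measurable_coord _ _)).
Qed.

Lemma J_translate d (f : 'rV[MR]_d -> \bar R) (r : 'rV[R]_d) :
  measurable_fun setT f -> (forall x, (0 <= f x)%E) ->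
  J (fun x => f (x + r)) = J f.
Proof.
elim: d f r => [|d IH] f r mf f0.
  by congr J; apply/funext => x; rewrite [x + r]thinmx0 [x]thinmx0.
have mfr : measurable_fun setT (fun x : 'rV[MR]_(1 + d) => f (x + r)).
  by apply: (measurableT_comp mf); apply: measurable_addmx.
apply: (etrans (@J_row1 d _ mfr (fun x => f0 (x + r)))); apply: esym.
apply: (etrans (@J_row1 d f mf f0)).
pose b := lsubmx (r : 'rV_(1 + d)) 0 0.
pose h t := J (fun x : 'rV[MR]_d => f (row_mx t%:M x)).
have mh : measurable_fun setT h by exact: (@measurable_J_row d).
have h0 t : (0 <= h t)%E by exact: J_ge0.
apply: (etrans (esym (@J1_affine 1 b h ltr01 mh h0))).
rewrite mul1e; congr J1; apply/funext => t; rewrite /h.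
have mrow : measurable_fun setT (fun x : 'rV[MR]_d => f (row_mx (1 * t + b)%:M x)).
  by apply: (measurableT_comp mf); apply: measurable_row_cons.
apply: (etrans (esym (IH _ (rsubmx (r : 'rV_(1 + d))) mrow (fun x => f0 _)))).
congr J; apply/funext => x; congr f.
rewrite mul1r -[in RHS](hsubmxK (r : 'rV_(1 + d))) add_row_mx.
have -> : (t + b)%:M = t%:M + lsubmx (r : 'rV_(1 + d)) :> 'M[R]_1.
  by rewrite [lsubmx _]mx11_scalar -raddfD.
by [].
Qed.

(** Meant for matrices that may be non-symmetric, such as the triangular and rotation factors of the
    covariance models. The property passes to Schur complements, so elimination never meets a zero
    pivot. *)
Definition posform d (A : 'M[R]_d) := forall v : 'rV[R]_d, v != 0 -> 0 < (v *m A *m v^T) 0 0.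

(** On (t, v), with t chosen so that the first coordinate of (t, v) A vanishes, the form of A equals
    that of the Schur complement on v. *)
Lemma posform_schur d (A : 'M[R]_(1 + d)) : posform A ->
  let a := ulsubmx A 0 0 in
  0 < a /\ posform (drsubmx A - a^-1 *: (dlsubmx A *m ursubmx A)).
Proof.
move=> pA a.
have a0 : 0 < a.
  have := pA (row_mx 1%:M 0); rewrite -[A]submxK mul_row_block tr_row_mx mul_row_col.
  rewrite !mul1mx !mul0mx trmx0 mulmx0 !addr0 trmx1 mulmx1; apply.
  by apply/eqP => /rowP /(_ 0); rewrite mxE (_ : fintype.split _ = inl 0) ?mxE /=; [move/eqP; rewrite oner_eq0|case: splitP => // j _; rewrite ord1].
split => // v v0.
pose t := - (a^-1 *: (v *m dlsubmx A)).
have := pA (row_mx t v); rewrite -{1}[A]submxK mul_row_block tr_row_mx mul_row_col.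
have -> : t *m ulsubmx A + v *m dlsubmx A = 0.
  rewrite [ulsubmx A]mx11_scalar -/a mul_mx_scalar /t scalerN scalerA divff ?gt_eqF //.
  by rewrite scale1r addNr.
rewrite mul0mx add0r.
have -> : t *m ursubmx A + v *m drsubmx A = v *m (drsubmx A - a^-1 *: (dlsubmx A *m ursubmx A)).
  by rewrite mulmxBr addrC /t mulNmx -scalemxAl -scalemxAr mulmxA.
apply; apply: contra_neq v0 => tv0.
by rewrite -[v](row_mxKr t) tv0 linear0.
Qed.

(** Gaussian elimination: A is a lower factor [1 0; c/a 1] times an upper factor [a r; 0 S], with S
    the Schur complement. The lower factor translates the first coordinate; the upper one scales it
    by a and acts by S on the rest. All pivots are positive, hence so is the determinant. *)
Lemma J_linear d (A : 'M[R]_d) : posform A ->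
  0 < \det A /\ forall f : 'rV[MR]_d -> \bar R,
    measurable_fun setT f -> (forall x, (0 <= f x)%E) ->
    ((\det A)%:E * J (fun x => f (x *m A)) = J f)%E.
Proof.
elim: d A => [|d IH] A pA.
  rewrite det_mx00; split=> // f mf f0; rewrite mul1e; congr J.
  by apply/funext => x; rewrite [x *m A]thinmx0 [x]thinmx0.
have [a0 pS] := @posform_schur d A pA.
set a := ulsubmx (A : 'M[R]_(1 + d)) 0 0 in a0 pS.
set S := drsubmx _ - _ in pS.
set r := ursubmx (A : 'M[R]_(1 + d)); set c := dlsubmx (A : 'M[R]_(1 + d)).
have AE : A = block_mx a%:M r c (drsubmx (A : 'M[R]_(1 + d))).
  by rewrite -[LHS](@submxK _ 1 d 1 d) [ulsubmx _]mx11_scalar.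
have rowA (t : R) (x : 'rV[R]_d) : row_mx (t%:M : 'M[R]_1) x *m A =
    row_mx ((t * a)%:M + x *m c) (t *: r + x *m drsubmx (A : 'M[R]_(1 + d))).
  rewrite [X in _ *m X = _]AE (@mul_row_block _ 1 1 d 1 d) !mul_scalar_mx.
  by rewrite scale_scalar_mx.
have [S0 JS] := IH S pS.
have detA : \det A = a * \det S.
  have -> : A = block_mx (1%:M : 'M[R]_1) 0 (a^-1 *: c) 1%:M *m block_mx (a%:M : 'M[R]_1) r 0 S.
    rewrite [LHS]AE mulmx_block ?mul1mx ?mul0mx ?mulmx0 ?addr0 mul_mx_scalar scalerA.
    rewrite divff ?gt_eqF // scale1r -scalemxAl /S -/c -/r.
    by rewrite addrC subrK.
  by rewrite det_mulmx (@det_lblock _ 1 d) (@det_ublock _ 1 d) !det1 !mul1r det_scalar expr1.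
split=> [|f mf f0]; first by rewrite detA mulr_gt0.
have mfA : measurable_fun setT (fun x : 'rV[MR]_(1 + d) => f (x *m A)).
  by apply: (measurableT_comp mf); apply: measurable_mulmxr.
(* [phi] is f composed with the upper factor alone. *)
pose phi (z : 'rV[MR]_(1 + d)) := f (row_mx (a *: lsubmx z) (lsubmx z *m r + rsubmx z *m S)).
have phiE s x : phi (row_mx s%:M x) = f (row_mx (a * s)%:M (s *: r + x *m S)).
  by rewrite /phi row_mxKl row_mxKr scale_scalar_mx mul_scalar_mx.
have mphi : measurable_fun setT phi.
  apply: (measurableT_comp mf).
  rewrite (_ : (fun x => _) = fun x : 'rV[MR]_(1 + d) =>
    row_mx (a * lsubmx x 0 0)%:M (lsubmx x 0 0 *: r + rsubmx x *m S)); last first.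
    apply/funext => x; rewrite {1 2}[lsubmx x]mx11_scalar.
    by rewrite scale_scalar_mx mul_scalar_mx.
  have ml : measurable_fun setT (fun x : 'rV[MR]_(1 + d) => lsubmx x 0 0 : MR).
    by under eq_fun do rewrite mxE; exact: measurable_coord.
  apply: measurable_row_cons; first exact: measurable_funM.
  apply: measurable_addmx; first exact: measurable_scalemx.
  apply: measurable_mulmxr; apply/measurable_fun_matrixP => i j.
  by under eq_fun do rewrite mxE; exact: measurable_coord.
(* With the other coordinates [x] fixed, the lower factor shifts the first coordinate by [b], a
   constant. *)
transitivity ((\det A)%:E * J (d := d.+1) phi)%E.
  congr (_ * _)%E; apply: (etrans (@J_row2 d _ mfA (fun x => f0 _))).
  apply: esym; apply: (etrans (@J_row2 d _ mphi (fun x => f0 _))).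
  congr J; apply/funext => x.
  pose b := (a^-1 *: (x *m c)) 0 0.
  have mphix : measurable_fun setT (fun t : MR => phi (row_mx t%:M x)).
    by apply: (measurableT_comp mphi); apply: measurable_row_cons.
  apply: (etrans (esym (@J1_affine 1 b _ ltr01 mphix (fun t => f0 _)))).
  rewrite mul1e; congr J1; apply/funext => t; rewrite phiE mul1r; congr f.
  rewrite rowA.
  have -> : (a * (t + b))%:M = (t * a)%:M + x *m c :> 'M[R]_1.
    rewrite mulrDr raddfD /= /b; congr (_ + _); first by rewrite mulrC.
    by rewrite [RHS]mx11_scalar mxE mulrA divff ?gt_eqF // mul1r.
  have -> // : (t + b) *: r + x *m S = t *: r + x *m drsubmx (A : 'M[R]_(1 + d)).
  rewrite scalerDl -addrA; congr (_ + _).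
  have -> : b *: r = a^-1 *: (x *m c *m r).
    by rewrite [in RHS](mx11_scalar (x *m c)) mul_scalar_mx scalerA /b mxE.
  by rewrite /S mulmxBr -/c -/r -scalemxAr mulmxA addrC subrK.
(* The first coordinate is now outermost: it is scaled by [a], and for each [t] the induction
   hypothesis for [S] follows a translation by [t *: r]. *)
apply: (etrans (congr1 _ (@J_row1 d phi mphi (fun x => f0 _)))).
apply: esym; apply: (etrans (@J_row1 d f mf f0)).
pose h t := J (fun x : 'rV[MR]_d => f (row_mx t%:M x)).
have mh : measurable_fun setT h by exact: (@measurable_J_row d).
have h0 t : (0 <= h t)%E by exact: J_ge0.
apply: (etrans (esym (@J1_affine a 0 h a0 mh h0))).
rewrite detA EFinM -muleA; congr (_ * _)%E; apply: esym.
rewrite /J1 -ge0_integralZl //; first last.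
- by rewrite lee_fin ltW.
- by move=> x _; rewrite mule_ge0 ?lee_fin ?expR_ge0 //; apply: J_ge0 => y; exact: f0.
- apply: emeasurable_funM; last exact: measurable_expR_sqr.
  exact: (@measurable_J_row d phi mphi (fun x => f0 _)).
apply: eq_integral => t _; rewrite muleA; congr (_ * _)%E.
rewrite addr0 /h.
pose k (y : 'rV[MR]_d) := f (row_mx (a * t)%:M (y + t *: r)).
have mrow : measurable_fun setT (fun x : 'rV[MR]_d => f (row_mx (a * t)%:M x)).
  by apply: (measurableT_comp mf); apply: measurable_row_cons.
have mk : measurable_fun setT k.
  by apply: (measurableT_comp mrow); apply: measurable_addmx.
rewrite -(J_translate (t *: r) mrow (fun x => f0 _)) -(JS k mk (fun x => f0 _)).
by congr (_ * J _)%E; apply/funext => x; rewrite phiE /k addrC.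
Qed.

End gauss.

(** * Laws and second moments of Gaussian vectors *)

Section gauss_law.
Context (R : realType).
Local Notation MR := (measurableTypeR R).
Local Notation gam := (normal_prob (0 : R) 1).

Lemma gauss_J d (f : 'rV[MR]_d -> \bar R) :
  (\int[iid gam d]_g f (rowt g) =
   J (fun x => f x * (expR (- (sqn x / 2)))%:E))%E.
Proof.
by apply: eq_integral => g _; rewrite -muleA -EFinM -expRD addNr expR0 mule1.
Qed.

Lemma measurable_expR_sqn d (A : 'M[R]_d) :
  measurable_fun setT (fun x : 'rV[MR]_d => (expR (- (sqn (x *m A) / 2)))%:E).
Proof.
apply/measurable_EFinP; apply: measurableT_comp => //.
apply: measurableT_comp => //; apply: measurable_funM => //.
by apply: (measurableT_comp (@measurable_sqn _ d)); apply: measurable_mulmxr.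
Qed.

Lemma sqnE d (x : 'rV[R]_d) : sqn x = (x *m x^T) 0 0.
Proof. by rewrite mxE; apply: eq_bigr => i _; rewrite mxE expr2. Qed.

Lemma sqn_invmx d (A : 'M[R]_d) (x : 'rV[R]_d) : A \in unitmx ->
  sqn (x *m invmx A) = (x *m invmx (A^T *m A) *m x^T) 0 0.
Proof.
move=> uA; rewrite sqnE trmx_mul trmx_inv !mulmxA; congr ((_ *m _) 0 0).
rewrite -mulmxA; congr (_ *m _).
have uT : A^T \in unitmx by rewrite unitmx_tr.
have uB : A^T *m A \in unitmx by rewrite unitmx_mul uT.
apply: (can_inj (mulmxK uB)).
by rewrite mulVmx // mulmxA mulmxKV // mulVmx.
Qed.

Lemma gauss_linear d (A : 'M[R]_d) (f : 'rV[MR]_d -> \bar R) : posform A ->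
  measurable_fun setT f -> (forall x, (0 <= f x)%E) ->
  ((\det A)%:E * \int[iid gam d]_g f (rowt g *m A) =
   J (fun x => f x * (expR (- ((x *m invmx (A^T *m A) *m x^T) 0 0 / 2)))%:E))%E.
Proof.
move=> pA mf f0; have [dA JA] := J_linear pA.
have uA : A \in unitmx by rewrite unitmxE unitfE gt_eqF.
rewrite (gauss_J (fun x => f (x *m A))).
under [in RHS]eq_fun do rewrite -sqn_invmx //.
apply: esym; apply: (etrans (esym (JA _ _ _))).
- by apply: emeasurable_funM => //; exact: measurable_expR_sqn.
- by move=> x; rewrite mule_ge0 // lee_fin expR_ge0.
by congr (_ * J _)%E; apply/funext => x; rewrite mulmxK.
Qed.

(** By [gauss_linear], the integral times det A depends on A^T A only. The two determinants are
    positive with equal squares, hence equal. *)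
Lemma gauss_law d (A B : 'M[R]_d) (f : 'rV[MR]_d -> \bar R) :
  posform A -> posform B -> A^T *m A = B^T *m B ->
  measurable_fun setT f -> (forall x, (0 <= f x)%E) ->
  (\int[iid gam d]_g f (rowt g *m A) = \int[iid gam d]_g f (rowt g *m B))%E.
Proof.
move=> pA pB AB mf f0; have [dA _] := J_linear pA; have [dB _] := J_linear pB.
have dAB : \det A = \det B.
  apply/eqP; rewrite -(eqrXn2 (n := 2)) ?ltW // !expr2.
  by rewrite -{1}(det_tr A) -{1}(det_tr B) -!det_mulmx AB.
have := gauss_linear pB mf f0; rewrite -AB -gauss_linear // dAB.
have d0 : ((\det B)^-1%:E * (\det B)%:E = 1 :> \bar R)%E.
  by rewrite -EFinM mulVf ?gt_eqF.
by move=> /(congr1 (fun z => (\det B)^-1%:E * z)%E); rewrite !muleA d0 !mul1e.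
Qed.

Definition taddr q (v : q.-tuple MR) (r : 'I_q -> R) : q.-tuple MR :=
  [tuple (tnth v a + r a : MR) | a < q].

(** The Cameron-Martin formula: [J] is translation invariant, and the density compares the two
    Gaussian exponents. [trow] undoes [rowt], to move between tuples and row vectors. *)
Lemma gauss_translate q (f : q.-tuple MR -> \bar R) (r : 'I_q -> R) :
  measurable_fun setT f -> (forall x, (0 <= f x)%E) ->
  (\int[iid gam q]_v f (taddr v r) =
   \int[iid gam q]_v (f v * (expR (\sum_a (tnth v a * r a - r a ^+ 2 / 2)))%:E))%E.
Proof.
move=> mf f0.
pose trow (x : 'rV[MR]_q) : q.-tuple MR := [tuple x 0 i | i < q].
have rowK v : trow (rowt v) = v.
  by apply: eq_from_tnth => i; rewrite tnth_mktuple mxE.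
pose rr : 'rV[R]_q := \row_a r a.
have mtrow : measurable_fun setT trow.
  apply/measurable_fun_tnthP => i; rewrite /comp.
  by under eq_fun do rewrite tnth_mktuple; exact: measurable_coord.
pose h (x : 'rV[MR]_q) := (f (trow x) * (expR (- (sqn (x - rr) / 2)))%:E)%E.
have mh : measurable_fun setT h.
  apply: emeasurable_funM; first exact: measurableT_comp.
  apply/measurable_EFinP; apply: measurableT_comp => //.
  apply: measurableT_comp => //; apply: measurable_funM => //.
  by apply: (measurableT_comp (@measurable_sqn _ q)); apply: measurable_addmx.
have h0 x : (0 <= h x)%E by rewrite mule_ge0 // lee_fin expR_ge0.
transitivity (J (fun x : 'rV[MR]_q => h (x + rr))).
  rewrite -[LHS](eq_integral _ (fun v => f (trow (rowt v + rr)))); last first.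
    move=> v _; congr f; apply: eq_from_tnth => i.
    by rewrite !tnth_mktuple !mxE.
  rewrite (gauss_J (fun x => f (trow (x + rr)))); congr J; apply/funext => x.
  by rewrite /h addrK.
rewrite J_translate //; apply: eq_integral => v _; rewrite /h rowK -muleA.
congr (_ * _)%E; rewrite -EFinM -expRD; congr (expR _)%:E.
rewrite addrC -mulrBl /sqn -sumrB mulr_suml; apply: eq_bigr => a _.
by rewrite !mxE; field.
Qed.

Lemma ge0_integral_lebesgueN (f : MR -> \bar R) :
  measurable_fun setT f -> (forall x, (0 <= f x)%E) ->
  (\int[lebesgue_measure]_x f (- x)%R = \int[lebesgue_measure]_x f x)%E.
Proof.
move=> mf f0.
have mN : measurable_fun setT (-%R : MR -> MR) by exact: oppr_measurable.
have := ge0_integral_pushforward mN lebesgue_measure measurableT mf (fun x _ => f0 x).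
rewrite preimage_setT => <-.
by apply: eq_measure_integral => A mA _; exact: lebesgue_measureN.
Qed.

Lemma ge0_integral_gamN (f : MR -> \bar R) :
  measurable_fun setT f -> (forall x, (0 <= f x)%E) ->
  (\int[gam]_x f (- x)%R = \int[gam]_x f x)%E.
Proof.
move=> mf f0.
have mh : measurable_fun setT (fun t : MR => (f t * (expR (- (t ^+ 2 / 2)))%:E)%E).
  apply: emeasurable_funM => //.
  apply/measurable_EFinP; apply: measurableT_comp => //.
  apply: measurableT_comp => //; apply: measurable_funM => //; exact: measurable_funX.
have h0 t : (0 <= f t * (expR (- (t ^+ 2 / 2)))%:E)%E by rewrite mule_ge0 // lee_fin expR_ge0.
have mN : measurable_fun setT (-%R : MR -> MR) by exact: oppr_measurable.
rewrite !gam_J1 J1_lebesgue; last 2 first.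
- have := measurableT_comp mh mN; rewrite /comp; apply: eq_measurable_fun => x _.
  by rewrite /= sqrrN.
- by move=> x; rewrite mule_ge0 // lee_fin expR_ge0.
rewrite J1_lebesgue //; congr (_ * _)%E.
apply: esym; apply: (etrans (esym (ge0_integral_lebesgueN mh h0))).
by apply: eq_integral => x _; rewrite sqrrN.
Qed.

(** From 3 t^2 / 8 <= exp(3 t^2 / 8). Under the normal law the exponential integrates to 2, since
    the remaining exponent -t^2 / 8 is a Gaussian of scale 2; this gives 16/3. *)
Lemma gam_sqr_le6 : (\int[gam]_t (t ^+ 2)%:E <= 6%:E)%E.
Proof.
have mX : measurable_fun setT (fun t : MR => t ^+ 2 : MR) by exact: measurable_funX.
have mexp (c : R) : measurable_fun setT (fun t : MR => (expR (t ^+ 2 * c))%:E).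
  by apply/measurable_EFinP; apply: measurableT_comp => //; apply: measurable_funM.
have E2 : (\int[gam]_t (expR (t ^+ 2 * (3 / 8)))%:E = 2%:E)%E.
  rewrite gam_J1.
  pose h (t : MR) := (expR (t ^+ 2 * (- 2^-1)))%:E : \bar R.
  have := @J1_affine R (1 / 2) 0 h ltac:(lra) (mexp _) (fun x => ltac:(by rewrite lee_fin expR_ge0)).
  have -> : J1 h = 1%E.
    rewrite -(probability_setT gam) -[RHS]mul1e -(integral_cst _ measurableT) gam_J1.
    by congr J1; apply/funext => t; rewrite mul1e /h; congr (expR _)%:E; lra.
  have -> : J1 (fun t => h (1 / 2 * t + 0)%R) = J1 (fun t : MR => ((expR (t ^+ 2 * (3 / 8)))%:E * (expR (- (t ^+ 2 / 2)))%:E)%E).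
    by congr J1; apply/funext => t; rewrite /h -EFinM -expRD; congr (expR _)%:E; field.
  move=> /(congr1 (fun z => 2%:E * z)%E); rewrite muleA -EFinM mule1 (_ : 2 * (1 / 2) = 1) ?mul1e //.
  by field.
apply: (@le_trans _ _ (\int[gam]_t ((8 / 3)%:E * (expR (t ^+ 2 * (3 / 8)))%:E))%E).
  apply: ge0_le_integral => //.
  - by move=> t _; rewrite lee_fin sqr_ge0.
  - exact/measurable_EFinP.
  - exact: measurable_funeM.
  move=> t _; rewrite -EFinM lee_fin.
  have := expR_ge1Dx (t ^+ 2 * (3 / 8)); lra.
rewrite ge0_integralZl; [|exact: measurableT|exact: mexp|by move=> t _; rewrite lee_fin expR_ge0|by rewrite lee_fin; lra].
rewrite E2 -EFinM lee_fin; lra.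
Qed.

Lemma integrable_gam_sqr : gam.-integrable setT (fun t : MR => (t ^+ 2)%:E).
Proof.
apply/integrableP; split; first by apply/measurable_EFinP; exact: measurable_funX.
under eq_integral do rewrite gee0_abs ?lee_fin ?sqr_ge0 //.
exact: le_lt_trans gam_sqr_le6 (ltry _).
Qed.

Lemma integrable_gam_id : gam.-integrable setT (fun t : MR => t%:E).
Proof.
apply: (@le_integrable _ _ _ _ _ measurableT _ (fun t : MR => (1 + t ^+ 2)%:E)).
- exact/measurable_EFinP.
- move=> t _; rewrite lee_fin (ger0_norm (_ : 0 <= 1 + _)).
    have := sqr_ge0 (`|t| - 1); rewrite -(real_normK (num_real t)); nra.
  by rewrite addr_ge0 // sqr_ge0.
rewrite (_ : (fun t => _) = ((fun t => 1%:E) \+ (fun t : MR => (t ^+ 2)%:E))%E) //.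
apply: integrableD => //; last exact: integrable_gam_sqr.
exact: finite_measure_integrable_cst.
Qed.

Lemma gam_mean0 : (\int[gam]_t t%:E = 0)%E.
Proof.
rewrite integralE.
have -> : (\int[gam]_x (fun t : MR => t%:E)^\- x = \int[gam]_x (fun t : MR => t%:E)^\+ x)%E.
  rewrite -[RHS]ge0_integral_gamN //; last first.
    by apply: measurable_funepos; exact/measurable_EFinP.
  by apply: eq_integral => x _; rewrite funeposE funenegE EFinN.
rewrite subee //; apply: (integrable_pos_fin_num measurableT).
exact: integrable_gam_id.
Qed.

(** Kept as an unevaluated number; the later estimates go through its bounds 0 and 6. *)
Definition gam_var : R := fine (\int[gam]_t (t ^+ 2)%:E).

Lemma gam_varE : (\int[gam]_t (t ^+ 2)%:E = gam_var%:E)%E.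
Proof. by rewrite fineK // (integrable_fin_num measurableT) //; exact: integrable_gam_sqr. Qed.

Lemma gam_var_ge0 : 0 <= gam_var.
Proof. by apply/fine_ge0/integral_ge0 => x _; rewrite lee_fin sqr_ge0. Qed.

Lemma gam_var_le6 : gam_var <= 6.
Proof. by rewrite -lee_fin -gam_varE gam_sqr_le6. Qed.

Lemma gam_affine_sqr (e m : R) :
  (\int[gam]_t ((e * t + m) ^+ 2)%:E = (gam_var * e ^+ 2 + m ^+ 2)%:E)%E.
Proof.
transitivity (\int[gam]_t ((e ^+ 2)%:E * (t ^+ 2)%:E + ((2 * e * m)%:E * t%:E + (m ^+ 2)%:E)))%E.
  by apply: eq_integral => t _; rewrite -!EFinM -!EFinD; congr (_%:E); ring.
have i1 := integrableZl measurableT (e ^+ 2) integrable_gam_sqr.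
have i2 := integrableZl measurableT (2 * e * m) integrable_gam_id.
have i3 : gam.-integrable setT (fun t : MR => (m ^+ 2)%:E).
  exact: finite_measure_integrable_cst.
rewrite integralD //; last exact: integrableD.
rewrite integralD // !integralZl //; last exact: integrable_gam_sqr.
  rewrite gam_varE gam_mean0 mule0 add0e integral_probability_cst.
  by rewrite -EFinM -EFinD mulrC.
exact: integrable_gam_id.
Qed.

(** Induction: once the first coordinate is fixed, its term joins the constant [m]. The cross terms
    vanish because the coordinates are centered. *)
Lemma gauss_affine_sqr q (e : 'I_q -> R) (m : R) :
  (\int[iid gam q]_v ((\sum_a e a * tnth v a + m) ^+ 2)%:E =
   (gam_var * (\sum_a e a ^+ 2) + m ^+ 2)%:E)%E.
Proof.
have mS k (c : 'I_k -> R) (m' : R) : measurable_fun setT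
    (fun v : k.-tuple MR => ((\sum_a c a * tnth v a + m') ^+ 2)%:E).
  apply/measurable_EFinP/measurable_funX/measurable_funD => //.
  apply: measurable_sum => a; apply: measurable_funM => //; exact: measurable_tnth.
elim: q e m => [|q IH] e m.
  rewrite ge0_integral_iid0 //; last by move=> x; rewrite lee_fin sqr_ge0.
  by rewrite !big_ord0 mulr0 !add0r.
rewrite ge0_integral_iidS //; last by move=> x; rewrite lee_fin sqr_ge0.
transitivity (\int[gam]_t ((gam_var * \sum_a e (lift ord0 a) ^+ 2)%:E + ((e ord0 * t + m) ^+ 2)%:E))%E.
  apply: eq_integral => t _; rewrite -EFinD -IH; apply: eq_integral => v _.
  rewrite big_ord_recl; congr ((_ ^+ 2)%:E).
  under eq_bigr do rewrite /cons_pair tnthS.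
  rewrite {1}/tnth /=; ring.
rewrite ge0_integralD //; first last.
- apply/measurable_EFinP/measurable_funX/measurable_funD => //; exact: measurable_funM.
- by move=> x _; rewrite lee_fin sqr_ge0.
- by move=> x _; rewrite lee_fin mulr_ge0 ?gam_var_ge0 // sumr_ge0 // => a _; rewrite sqr_ge0.
rewrite integral_probability_cst gam_affine_sqr -EFinD; congr (_%:E).
by rewrite big_ord_recl; ring.
Qed.

End gauss_law.

(** * Square roots and spectral norms *)

Section linear_algebra_facts.
Context (R : realType).

Definition sqc d (v : 'cV[R]_d) : R := \sum_i v i 0 ^+ 2.

Lemma sqc_ge0 d (v : 'cV[R]_d) : 0 <= sqc v.
Proof. by apply: sumr_ge0 => i _; exact: sqr_ge0. Qed.

Lemma sqcE d (v : 'cV[R]_d) : sqc v = (v^T *m v) 0 0.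
Proof. by rewrite mxE; apply: eq_bigr => i _; rewrite mxE expr2. Qed.

Lemma sqc_eq0 d (v : 'cV[R]_d) : sqc v = 0 -> v = 0.
Proof.
move=> /eqP; rewrite psumr_eq0; last by move=> i _; exact: sqr_ge0.
move=> /allP v0; apply/colP => i; rewrite mxE; apply/eqP.
by have := v0 i (mem_index_enum i); rewrite /= sqrf_eq0.
Qed.

Lemma sqcZ d c (v : 'cV[R]_d) : sqc (c *: v) = c ^+ 2 * sqc v.
Proof. by rewrite /sqc mulr_sumr; apply: eq_bigr => i _; rewrite mxE exprMn. Qed.

Lemma quadE d (A : 'M[R]_d) (v : 'cV[R]_d) :
  (v^T *m A *m v) 0 0 = \sum_i \sum_j v i 0 * A i j * v j 0.
Proof.
rewrite mxE exchange_big /=; apply: eq_bigr => j _; rewrite mxE mulr_suml.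
by apply: eq_bigr => i _; rewrite mxE.
Qed.

(* |v_i v_j| <= (v_i^2 + v_j^2) / 2 *)
Lemma quad_entry_bound d (A : 'M[R]_d) (c : R) (v : 'cV[R]_d) : 0 <= c ->
  (forall i j, `|A i j| <= c / d%:R) -> `|(v^T *m A *m v) 0 0| <= c * sqc v.
Proof.
case: d A v => [|d] A v c0 Ac.
  by rewrite quadE /sqc !big_ord0 normr0 mulr0.
rewrite quadE; apply: le_trans (ler_norm_sum _ _ _) _.
apply: (@le_trans _ _ (\sum_i \sum_j (c / d.+1%:R) * ((v i 0 ^+ 2 + v j 0 ^+ 2) / 2))).
  apply: ler_sum => i _; apply: le_trans (ler_norm_sum _ _ _) _.
  apply: ler_sum => j _; rewrite mulrAC mulrC normrM; apply: ler_pM => //.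
  rewrite normrM -(real_normK (num_real (v i 0))) -(real_normK (num_real (v j 0))).
  have := sqr_ge0 (`|v i 0| - `|v j 0|); nra.
apply: (@le_trans _ _ (c * sqc v)); last by [].
under eq_bigr do under eq_bigr do rewrite mulrDl mulrDr.
under eq_bigr do rewrite big_split /= sumr_const card_ord -mulr_sumr -mulr_suml.
rewrite big_split /= sumr_const card_ord sumrMnl -mulr_sumr -mulr_suml -/(sqc v).
rewrite -mulr_natr; have : d.+1%:R != 0 :> R by rewrite pnatr_eq0.
by move=> dn0; rewrite le_eqVlt; apply/orP; left; apply/eqP; field.
Qed.

(** The form is nonnegative along v + t B v, where it equals 2 t |B v|^2 + t^2 c; a negative t close
    to 0 then forces B v = 0. *)
Lemma psd_quad0 d (B : 'M[R]_d) (v : 'cV[R]_d) : psd B ->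
  (v^T *m B *m v) 0 0 = 0 -> B *m v = 0.
Proof.
move=> [sB pB] v0; apply: sqc_eq0; apply/eqP; rewrite eq_le sqc_ge0 andbT.
pose w := B *m v; pose c := (w^T *m B *m w) 0 0.
have key t : 0 <= 2 * t * sqc w + t ^+ 2 * c.
  have := pB (v + t *: w).
  have -> : ((v + t *: w)^T *m B *m (v + t *: w)) = v^T *m B *m v + (2 * t) *: (w^T *m w) + t ^+ 2 *: (w^T *m B *m w).
    have e1 : v^T *m B *m w = w^T *m w by rewrite /w trmx_mul sB.
    have e2 : w^T *m B *m v = w^T *m w by rewrite -mulmxA.
    rewrite (_ : (v + t *: w)^T = v^T + t *: w^T); last by rewrite linearD linearZ.
    rewrite mulmxDl mulmxDr [in X in _ + X]mulmxDl -!scalemxAl.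
    rewrite mulmxDl -!scalemxAl -!scalemxAr e1 e2 scalerA -expr2.
    rewrite -!addrA; congr (_ + _); rewrite addrA -scalerDl.
    by congr (_ *: _ + _); ring.
  by rewrite mxE [X in X + _]mxE [X in _ + X + _]mxE [X in _ + _ + X]mxE v0 add0r -sqcE.
have c0 : 0 <= c by exact: pB.
rewrite -/w leNgt; apply/negP => w0.
(* Dividing by c + 1 instead of c keeps the denominator positive when c = 0. *)
have := key (- (sqc w / (c + 1))).
have c1 : 0 < c + 1 by rewrite ltr_wpDl.
have -> : 2 * - (sqc w / (c + 1)) * sqc w + (- (sqc w / (c + 1))) ^+ 2 * c =
   - ((sqc w / (c + 1)) ^+ 2 * (c + 2)).
  by field; rewrite gt_eqF.
rewrite oppr_ge0 leNgt mulr_gt0 // ?ltr_wpDl // exprn_gt0 // divr_gt0 //.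
Qed.

End linear_algebra_facts.

(** For the Banach fixed point theorem, applied below to the equation of a square root. *)
HB.instance Definition _ (R : realType) m n := Complete.on 'M[R]_(m, n).

Section sqrt_exists.
Context (R : realType).

Lemma mulmx_entry_bound d (X Y : 'M[R]_d) (a b : R) :
  (forall i j, `|X i j| <= a) -> (forall i j, `|Y i j| <= b) ->
  forall i j, `|(X *m Y) i j| <= d%:R * (a * b).
Proof.
move=> Xa Yb i j; rewrite mxE; apply: le_trans (ler_norm_sum _ _ _) _.
apply: (@le_trans _ _ (\sum_(k < d) a * b)); last first.
  by rewrite sumr_const card_ord -[X in X <= _]mulr_natl.
by apply: ler_sum => k _; rewrite normrM; apply: ler_pM.
Qed.

Lemma mx_norm_entry m n (x : 'M[R]_(m, n)) (i : 'I_m) (j : 'I_n) : `|x i j| <= `|x|.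
Proof.
rewrite [leRHS]mx_normrE; exact: (@le_bigmax_cond _ _ _ _ (i, j) xpredT (fun ij => `|x ij.1 ij.2|)).
Qed.

Lemma mx_norm_le m n (x : 'M[R]_(m, n)) (c : R) : 0 <= c ->
  (forall i j, `|x i j| <= c) -> `|x| <= c.
Proof. by move=> c0 xc; rewrite [leLHS]mx_normrE; apply: bigmax_le => // -[i j] _. Qed.

(* The fixed point Y = (E + Y^2) / 2 gives (1 - Y)^2 = 1 - E. *)
Lemma sqrt_fixpoint d (E : 'M[R]_d.+1) :
  (forall i j, `|E i j| <= 1 / 4 / d.+1%:R) ->
  exists Y : 'M[R]_d.+1, (forall i j, `|Y i j| <= 1 / 2 / d.+1%:R) /\ Y = 2^-1 *: (E + Y *m Y).
Proof.
move=> Eb.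
have d0 : 0 < d.+1%:R :> R by rewrite ltr0n.
(* The radius with d r = 1/2: a product of two matrices of the ball has entries at most r / 2, so
   the map preserves the ball and contracts by 1/2. *)
pose r : R := 1 / 2 / d.+1%:R.
have r0 : 0 <= r by rewrite divr_ge0 ?ltW //; lra.
have dr : d.+1%:R * r = 1 / 2 by rewrite /r mulrC divfK ?gt_eqF.
pose U : set 'M[R]_d.+1 := [set Y | `|Y| <= r].
pose f (Y : 'M[R]_d.+1) : 'M[R]_d.+1 := 2^-1 *: (E + Y *m Y).
have fU : {homo f : x / U x >-> U x}.
  move=> Y YU; apply: mx_norm_le => // i j; rewrite mxE normrM ger0_norm // mxE.
  have Yr k l : `|Y k l| <= r by exact: le_trans (mx_norm_entry _ _ _) YU.
  have h1 := mulmx_entry_bound Yr Yr i j; have h2 := Eb i j.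
  have h3 := ler_normD (E i j) ((Y *m Y) i j).
  have h4 : 1 / 4 / d.+1%:R = r / 2 by rewrite /r; field; rewrite gt_eqF.
  rewrite mulrA dr in h1; rewrite h4 in h2; lra.
have lipf (x y : 'M[R]_d.+1) : U x -> U y -> `|f x - f y| <= 1 / 2 * `|x - y|.
  move=> xU yU; apply: mx_norm_le; first by rewrite mulr_ge0 //; lra.
  move=> i j.
  have xr k l : `|x k l| <= r by exact: le_trans (mx_norm_entry _ _ _) xU.
  have yr k l : `|y k l| <= r by exact: le_trans (mx_norm_entry _ _ _) yU.
  have -> : f x - f y = 2^-1 *: (x *m (x - y) + (x - y) *m y).
    rewrite /f -scalerBr mulmxBr mulmxBl; congr (_ *: _).
    by rewrite addrA subrK opprD addrACA subrr add0r.
  rewrite mxE normrM ger0_norm // mxE.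
  have h1 := mulmx_entry_bound xr (mx_norm_entry (x - y)) i j.
  have h2 := mulmx_entry_bound (mx_norm_entry (x - y)) yr i j.
  have h3 := ler_normD ((x *m (x - y)) i j) (((x - y) *m y) i j).
  rewrite mulrA dr in h1; rewrite mulrCA dr in h2; lra.
have cU : closed U.
  by rewrite /U; apply: closed_comp (@closed_le R r) => x _; exact: norm_continuous.
pose F : {fun U >-> U} := mkfun fU.
have ctr : is_contraction F.
  exists (2^-1)%:nng; split; first by rewrite /=; lra.
  by move=> [x y] [/= xU yU]; have := lipf x y xU yU; rewrite mul1r.
have U0 : U !=set0 by exists 0; rewrite /U /= normr0.
have [Y YU Yf] := banach_fixed_point ctr cU U0.
exists Y; split=> [i j|]; first exact: le_trans (mx_norm_entry _ _ _) YU.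
exact: Yf.
Qed.

(** The root is sqrt c (1 - Y) with Y the fixed point. The entry bound on Y gives v^T Y v <= |v|^2 /
    2, so 1 - Y is psd. *)
Lemma psd_sqrt_exists d (E : 'M[R]_d) (c : R) : 0 <= c -> E^T = E ->
  (forall i j, `|E i j| <= 1 / 4 / d%:R) ->
  exists B : 'M[R]_d, psd B /\ B *m B = c *: (1%:M - E).
Proof.
case: d E => [|d] E c0 sE Eb.
  exists 0; split; last by rewrite [LHS]thinmx0 [RHS]thinmx0.
  by split=> [|v]; [rewrite trmx0|rewrite mulmx0 mul0mx mxE].
have [Y [Yb YE]] := sqrt_fixpoint Eb.
have d0 : 0 < d.+1%:R :> R by rewrite ltr0n.
(* Subtracting the fixed point equation from its transpose bounds N = Y^T - Y by half its own norm,
   so N = 0. *)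
have sY : Y^T = Y.
  apply/eqP; rewrite -subr_eq0 -normr_eq0; set N := Y^T - Y.
  have NE : N = 2^-1 *: (Y^T *m N + N *m Y).
    have YT : Y^T = 2^-1 *: (E + Y^T *m Y^T).
      by rewrite {1}YE linearZ linearD /= trmx_mul sE.
    transitivity (2^-1 *: (E + Y^T *m Y^T) - 2^-1 *: (E + Y *m Y)).
      by rewrite -YT -YE.
    rewrite -scalerBr; congr (_ *: _).
    by rewrite /N mulmxBr mulmxBl addrA subrK opprD addrACA subrr add0r.
  have YTb i j : `|Y^T i j| <= 1 / 2 / d.+1%:R by rewrite mxE.
  have : `|N| <= 1 / 2 * `|N|.
    apply: mx_norm_le; first by rewrite mulr_ge0 //; lra.
    move=> i j; rewrite {1}NE mxE normrM ger0_norm // mxE.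
    have h1 := mulmx_entry_bound YTb (mx_norm_entry N) i j.
    have h2 := mulmx_entry_bound (mx_norm_entry N) Yb i j.
    have h3 := ler_normD ((Y^T *m N) i j) ((N *m Y) i j).
    have dr : d.+1%:R * (1 / 2 / d.+1%:R) = 1 / 2 :> R by rewrite mulrC divfK ?gt_eqF.
    rewrite mulrA dr in h1; rewrite mulrCA dr in h2; lra.
  have := normr_ge0 N => N0 N1; apply/eqP; lra.
exists (Num.sqrt c *: (1%:M - Y)); split; last first.
  rewrite -scalemxAl -scalemxAr scalerA -expr2 sqr_sqrtr //; congr (_ *: _).
  rewrite mulmxBl mul1mx mulmxBr mulmx1 opprB.
  have -> : Y *m Y = 2 *: Y - E.
    by rewrite {3}YE scalerA divff // scale1r addrAC subrr add0r.
  by apply/matrixP => i j; rewrite !mxE; ring.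
split; first by rewrite linearZ /= linearB /= trmx1 sY.
move=> v; rewrite -scalemxAr -scalemxAl mxE mulr_ge0 ?sqrtr_ge0 //.
rewrite mulmxBr mulmxBl mulmx1 mxE -sqcE [X in _ + X]mxE.
have h0 : (0 : R) <= 1 / 2 by lra.
have := quad_entry_bound v h0 Yb; have := sqc_ge0 v.
by move=> h1; have := ler_norm ((v^T *m Y *m v) 0 0) => h2 h3; lra.
Qed.

End sqrt_exists.

Section near_identity.
Context (R : realType).
Variables (d : nat) (E : 'M[R]_d) (c : R).
Hypotheses (sE : E^T = E) (Eb : forall i j, `|E i j| <= 1 / 4 / d%:R).
Hypotheses (c_ge : 4 / 3 <= c) (c_le : c <= 8 / 5).
Let S := c *: (1%:M - E).

(** The entry bound gives |v^T E v| <= |v|^2 / 4, so the form lies between 3c/4 and 5c/4 times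
    |v|^2. The interval [4/3, 8/5] for c is the one that turns these into 1 and 2. *)
Lemma near_quad (v : 'cV[R]_d) :
  sqc v <= (v^T *m S *m v) 0 0 /\ (v^T *m S *m v) 0 0 <= 2 * sqc v.
Proof.
rewrite /S -scalemxAr -scalemxAl mxE mulmxBr mulmxBl mulmx1 mxE -sqcE [X in _ + X]mxE.
have h0 : (0 : R) <= 1 / 4 by lra.
have h1 := quad_entry_bound v h0 Eb; have h2 := sqc_ge0 v.
have h3 := ler_norm ((v^T *m E *m v) 0 0).
have h4 := ler_norm (- (v^T *m E *m v) 0 0); rewrite normrN in h4.
set q := (v^T *m E *m v) 0 0 in h1 h3 h4 *; set n := sqc v in h1 h2 *.
have c0 : 0 <= c by have := c_ge; lra.
have p1 : 0 <= c * (n / 4 - q) by apply: mulr_ge0 => //; lra.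
have p2 : 0 <= c * (n / 4 + q) by apply: mulr_ge0 => //; lra.
have p3 : 0 <= (c - 4 / 3) * n by apply: mulr_ge0 => //; have := c_ge; lra.
have p4 : 0 <= (8 / 5 - c) * n by apply: mulr_ge0 => //; have := c_le; lra.
split; nra.
Qed.

Lemma near_loewner : loewner_le 1%:M S /\ loewner_le S 2%:M.
Proof.
have sS : S^T = S by rewrite /S linearZ /= linearB /= trmx1 sE.
split; split.
- by rewrite linearB /= sS trmx1.
- move=> v; have [h _] := near_quad v.
  by rewrite mulmxBr mulmxBl mulmx1 mxE [X in _ + X]mxE -sqcE subr_ge0.
- by rewrite linearB /= sS tr_scalar_mx.
- move=> v; have [_ h] := near_quad v.
  rewrite mulmxBr mulmxBl mul_mx_scalar -scalemxAl mxE [X in _ + X]mxE [X in X - _]mxE -sqcE.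
  by rewrite subr_ge0.
Qed.

(** Existence of a root rules out the default value 0 of [sqrtmx]. If its form vanishes at v, then
    it kills v, hence so does the form of S, which is at least |v|^2. *)
Lemma near_sqrtmx : [/\ psd (sqrtmx S), sqrtmx S *m sqrtmx S = S & posform (sqrtmx S)].
Proof.
have c0 : 0 <= c by have := c_ge; lra.
have [B BP] := psd_sqrt_exists c0 sE Eb.
have [pB BB] : psd (sqrtmx S) /\ sqrtmx S *m sqrtmx S = S.
  exact: (@xgetPex _ 0 [set B | psd B /\ B *m B = S] (ex_intro _ B BP)).
split=> // v v0; have := pB.2 v^T; rewrite trmxK le_eqVlt => /orP[/eqP vB|//].
have := psd_quad0 pB (_ : (v^T^T *m sqrtmx S *m v^T) 0 0 = 0); rewrite trmxK -vB => /(_ erefl) Bv0.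
have [h _] := near_quad v^T; rewrite -BB !mulmxA -mulmxA Bv0 mulmx0 mxE in h.
have v1 : sqc v^T = 0 by apply/eqP; rewrite eq_le h sqc_ge0.
by move: v0; rewrite -[v]trmxK (sqc_eq0 v1) trmx0 eqxx.
Qed.

End near_identity.

Section spectral.
Context (R : realType).

Lemma spectral_norm_bound m n (K : 'M[R]_(m, n)) (v : 'cV[R]_n) :
  sqc (K *m v) <= spectral_norm K ^+ 2 * sqc v.
Proof.
have l2E k (w : 'cV[R]_k) : l2norm w ^+ 2 = sqc w by rewrite sqr_sqrtr ?sqc_ge0.
have l20 k (w : 'cV[R]_k) : 0 <= l2norm w by exact: sqrtr_ge0.
have l2Z k c (w : 'cV[R]_k) : 0 <= c -> l2norm (c *: w) = c * l2norm w.
  move=> c0; rewrite /l2norm -/(sqc _) sqcZ sqrtrM ?sqr_ge0 // sqrtr_sqr ger0_norm //.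
have [v0|v0] := eqVneq (sqc v) 0.
  by rewrite (sqc_eq0 v0) mulmx0 /sqc big1 ?big1 ?mulr0 // => i _; rewrite mxE expr0n.
have lv : 0 < l2norm v by rewrite sqrtr_gt0 lt_neqAle eq_sym v0 sqc_ge0.
(* [sup] is a least upper bound for bounded sets only. Coordinates of a vector of the unit ball are
   at most 1, so the row sums of |K| give a bound. *)
have ubK : has_ubound [set l2norm (K *m v) | v in [set v : 'cV[R]_n | l2norm v <= 1]].
  exists (Num.sqrt (\sum_i (\sum_j `|K i j|) ^+ 2)) => _ [w /= w1 <-].
  rewrite ler_sqrt; last by apply: sumr_ge0 => i _; exact: sqr_ge0.
  apply: ler_sum => i _; rewrite -real_normK ?num_real //.
  apply: lerXn2r; rewrite ?nnegrE //; first by apply: sumr_ge0.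
  rewrite mxE; apply: le_trans (ler_norm_sum _ _ _) _; apply: ler_sum => j _.
  rewrite normrM ler_piMr //; apply: le_trans w1; rewrite -sqrtr_sqr ler_sqrt ?sqc_ge0 //.
  by rewrite (bigD1 j) //= lerDl; apply: sumr_ge0 => i' _; exact: sqr_ge0.
have key : l2norm (K *m v) / l2norm v <= spectral_norm K.
  apply: ub_le_sup => //; exists ((l2norm v)^-1 *: v).
    by rewrite /= l2Z ?invr_ge0 // mulVf ?gt_eqF.
  by rewrite -scalemxAr l2Z ?invr_ge0 // mulrC.
rewrite ler_pdivrMr // in key.
rewrite -!l2E -exprMn; apply: lerXn2r; rewrite ?nnegrE //.
exact: le_trans key.
Qed.

(** A - S = B K B with B the root of S and K the normalised error. Since |B w|^2 <= 2 |w|^2, each of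
    the d columns of A - S has squared norm at most 4 times the squared spectral norm of K. *)
Lemma cov_error_frobenius d (S A : 'M[R]_d) :
  psd (sqrtmx S) -> sqrtmx S *m sqrtmx S = S -> posform (sqrtmx S) ->
  (forall v : 'cV[R]_d, (v^T *m S *m v) 0 0 <= 2 * sqc v) ->
  \sum_i \sum_j (A i j - S i j) ^+ 2 <= 4 * d%:R * cov_error S A.
Proof.
set B := sqrtmx S => -[sB _] BB pB S2.
have [dB _] := J_linear pB.
have uB : B \in unitmx by rewrite unitmxE unitfE gt_eqF.
rewrite /cov_error /invsqrtmx -/B; set K := _ *m _ *m _.
have AE : A - S = B *m (K *m B).
  by rewrite /K mulmxKV // mulKVmx.
have sqB (w : 'cV[R]_d) : sqc (B *m w) <= 2 * sqc w.
  by rewrite sqcE trmx_mul sB -mulmxA (mulmxA B) BB mulmxA.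
have colb j : \sum_i (A i j - S i j) ^+ 2 <= 4 * spectral_norm K ^+ 2.
  have -> : \sum_i (A i j - S i j) ^+ 2 = sqc (B *m (K *m (B *m delta_mx j 0))).
    have -> : B *m (K *m (B *m delta_mx j 0)) = col j (A - S).
      by rewrite (mulmxA K) (mulmxA B) -AE -colE.
    by apply: eq_bigr => i _; rewrite !mxE.
  have h1 := sqB (K *m (B *m delta_mx j 0)).
  have h2 := spectral_norm_bound K (B *m delta_mx j 0).
  have h3 := sqB (delta_mx j 0).
  have h4 : sqc (delta_mx j 0 : 'cV[R]_d) = 1.
    rewrite /sqc (bigD1 j) //= big1 ?mxE ?eqxx ?expr1n ?addr0 // => i ij.
    by rewrite mxE (negbTE ij) expr0n.
  have := sqr_ge0 (spectral_norm K); rewrite h4 in h3; nra.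
rewrite exchange_big /=; apply: le_trans (ler_sum _ (fun j _ => colb j)) _.
by rewrite sumr_const card_ord -[X in X <= _]mulr_natl mulrCA mulrA.
Qed.

End spectral.

(** * Private mechanisms and bounded statistics *)

Section dp_fun.
Local Open Scope ereal_scope.
Context dZ (Z : measurableType dZ) (R : realType).
Variables (N N' : probability Z R) (e delta : R).
Hypotheses (e_ge0 : (0 <= e)%R) (delta_ge0 : (0 <= delta)%R).
Hypothesis dp : forall A, measurable A -> N' A <= e%:E * N A + delta%:E.
Local Notation MR := (measurableTypeR R).

(* f = \int_0^1 1_{t <= f} dt reduces the claim to the superlevel sets of f. *)
Lemma dp_fun (f : Z -> R) : measurable_fun setT f -> (forall z, (0 <= f z <= 1)%R) ->
  \int[N']_z (f z)%:E <= e%:E * \int[N]_z (f z)%:E + delta%:E.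
Proof.
move=> mf f01; pose U := uniform_prob (@ltr01 R).
pose S (z : Z * MR) : R := \1_[set w : Z * MR | (w.2 <= f w.1)%R] z.
have mS : measurable [set w : Z * MR | (w.2 <= f w.1)%R].
  rewrite -[X in measurable X]setTI.
  apply: (@measurable_fun_le _ _ _ setT (fun w : Z * MR => w.2) (fun w : Z * MR => f w.1)) => //.
    exact: measurable_snd.
  exact: (measurableT_comp mf measurable_fst).
have mSE : measurable_fun setT (fun z => (S z)%:E).
  exact/measurable_EFinP/measurable_indic.
have S0 z : 0 <= (S z)%:E by rewrite lee_fin.
have fE z : (f z)%:E = \int[U]_t (S (z, t))%:E.
  have mSz : measurable [set t : MR | (t <= f z)%R].
    have -> : [set t : MR | (t <= f z)%R] = `]-oo, f z]%classic.
      by apply/seteqP; split=> t /=; rewrite in_itv.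
    exact: measurable_itv.
  rewrite (_ : (fun t => _) = (fun t => (\1_[set t : MR | (t <= f z)%R] t)%:E)); last first.
    by apply/funext => t; rewrite /S !indicE; congr ((_ _)%:E); rewrite -!topredE /= !asboolE.
  have [f0 f1] := andP (f01 z).
  rewrite integral_uniform //; last first.
    exact/measurable_EFinP/measurable_indic.
  rewrite subr0 invr1 mul1e integral_indic //.
  have -> : [set t : MR | (t <= f z)%R] `&` `[0%R, 1%R] = `[0%R, f z]%classic.
    apply/seteqP; split=> t /=; rewrite !in_itv /=; first by move=> [-> /andP[-> _]].
    by move=> /andP[t0 tf]; split=> //; rewrite t0 (le_trans tf).
  transitivity (lebesgue_measure `[0%R, f z]%classic); last by [].
  by rewrite lebesgue_measure_itv /= lte_fin; case: ltgtP f0 => //= [_ _|<- _]; rewrite ?oppr0 ?adde0 ?sube0.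
have layer (Q : probability Z R) : \int[Q]_z (f z)%:E = \int[U]_t \int[Q]_z (S (z, t))%:E.
  under eq_integral do rewrite fE.
  exact: (@fubini_tonelli _ _ _ _ _ Q U (fun z => (S z)%:E)).
have mQ (Q : probability Z R) : measurable_fun setT (fun t => \int[Q]_z (S (z, t))%:E).
  exact: (measurable_fun_fubini_tonelli_G (fun z => (S z)%:E)).
have Q0 (Q : probability Z R) t : 0 <= \int[Q]_z (S (z, t))%:E by exact: integral_ge0.
rewrite !layer; apply: (@le_trans _ _ (\int[U]_t (e%:E * \int[N]_z (S (z, t))%:E + delta%:E))).
  apply: ge0_le_integral => //.
  - apply: emeasurable_funD; last exact: measurable_cst.
    exact: measurable_funeM.
  move=> t _.
  have mt : measurable [set z | (t <= f z)%R].
    by rewrite -[X in measurable X]setTI; apply: measurable_fun_le.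
  have SE (Q : probability Z R) : \int[Q]_z (S (z, t))%:E = Q [set z | (t <= f z)%R].
    by rewrite -[in RHS](setIT [set z | _]) -integral_indic.
  by rewrite !SE; exact: dp.
rewrite ge0_integralD //; last 2 first.
- by move=> t _; rewrite mule_ge0 // lee_fin.
- exact: measurable_funeM.
by rewrite ge0_integralZl ?lee_fin // integral_probability_cst.
Qed.

End dp_fun.

Section dp_signed.
Context dZ (Z : measurableType dZ) (R : realType).
Variables (N N' : probability Z R).

Lemma bounded_integrable (Q : probability Z R) (L : Z -> R) (b : R) :
  measurable_fun setT L -> (forall z, `|L z| <= b) -> Q.-integrable setT (EFin \o L).
Proof.
move=> mL Lb; apply: (@le_integrable _ _ _ _ _ measurableT _ (cst b%:E)) => //.
- exact/measurable_EFinP.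
- by move=> z _; rewrite /= lee_fin (le_trans (Lb z)) // ler_norm.
- exact: finite_measure_integrable_cst.
Qed.

(** Positive and negative parts use the two opposite privacy inequalities. The loss is expressed by
    the mean of |L| under [N]: in the application [N] is the output law on data independent of the
    fresh sample, where second moments can be computed. *)
Lemma dp_signed (e delta b : R) (L : Z -> R) : 1 <= e -> 0 <= delta ->
  (forall A, measurable A -> (N' A <= e%:E * N A + delta%:E)%E) ->
  (forall A, measurable A -> (N A <= e%:E * N' A + delta%:E)%E) ->
  measurable_fun setT L -> (forall z, `|L z| <= b) ->
  (\int[N']_z L z <= \int[N]_z L z + (e - 1) * (\int[N]_z `|L z|) + 2 * delta * b)%R.
Proof.
move=> e1 d0 dp dp' mL Lb.
have b0 : 0 <= b by exact: le_trans (Lb point).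
pose Lp z := Num.max (L z) 0; pose Lm z := Num.max (- L z) 0.
have mLp : measurable_fun setT Lp by apply: measurable_maxr => //; exact: measurable_cst.
have mLm : measurable_fun setT Lm.
  by apply: measurable_maxr; [exact: measurableT_comp|exact: measurable_cst].
have Lpb z : 0 <= Lp z <= b.
  by rewrite /Lp le_max lexx orbT /= ge_max b0 andbT (le_trans (ler_norm _)).
have Lmb z : 0 <= Lm z <= b.
  by rewrite /Lm le_max lexx orbT /= ge_max b0 andbT (le_trans (ler_norm _)) // normrN.
have ib (Q : probability Z R) (h : Z -> R) : measurable_fun setT h -> (forall z, 0 <= h z <= b) ->
    Q.-integrable setT (EFin \o h).
  move=> mh hb; apply: (@bounded_integrable Q h b) => // z.
  by have /andP[h0 h1] := hb z; rewrite ger0_norm.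
have step (Q Q' : probability Z R) (h : Z -> R) :
    (forall A, measurable A -> (Q' A <= e%:E * Q A + delta%:E)%E) ->
    measurable_fun setT h -> (forall z, 0 <= h z <= b) ->
    \int[Q']_z h z <= e * (\int[Q]_z h z) + b * delta.
  move=> dpQ mh hb.
  have [b00|bn0] := eqVneq b 0.
    have h0 z : h z = 0 by have := hb z; rewrite b00 -eq_le => /eqP.
    rewrite (eq_Rintegral _ (g := cst 0)) => [|z _]; last by rewrite h0.
    rewrite [in leRHS](eq_Rintegral _ (g := cst 0)) => [|z _]; last by rewrite h0.
    by rewrite !Rintegral_cst // !mul0r mulr0 b00 mul0r addr0.
  have b_gt0 : 0 < b by rewrite lt_neqAle eq_sym bn0.
  have e0 : 0 <= e by lra.
  have RE (P : probability Z R) (g : Z -> R) : P.-integrable setT (EFin \o g) ->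
      (\int[P]_z (g z)%:E)%E = (\int[P]_z g z)%:E.
    by move=> ig; rewrite /Rintegral fineK //; exact: (integrable_fin_num measurableT ig).
  have mg : measurable_fun setT (fun z => b^-1 * h z) by exact: measurable_funM.
  have gb z : 0 <= b^-1 * h z <= 1.
    have /andP[h0 h1] := hb z; rewrite mulr_ge0 ?invr_ge0 //=.
    by rewrite mulrC ler_pdivrMr // mul1r.
  have ig (P : probability Z R) : P.-integrable setT (EFin \o (fun z => b^-1 * h z)).
    by apply: (@bounded_integrable P _ 1) => // z; have /andP[h0 h1] := gb z; rewrite ger0_norm.
  have := dp_fun e0 d0 dpQ mg gb; rewrite !RE // -EFinM -EFinD lee_fin.
  rewrite !RintegralZl //; [|exact: ib..].
  have bK x : b * (b^-1 * x) = x by rewrite mulrA divff // mul1r.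
  by rewrite -(ler_pM2l b_gt0) bK mulrDr mulrCA bK.
have h1 := step _ _ _ dp mLp Lpb.
have h2 := step _ _ _ dp' mLm Lmb.
have LE (Q : probability Z R) : \int[Q]_z L z = \int[Q]_z Lp z - \int[Q]_z Lm z.
  rewrite -RintegralB //; [|exact: ib..]; apply: eq_Rintegral => z _.
  rewrite /Lp /Lm; case: (lerP 0 (L z)) => z0.
    by rewrite max_r ?subr0 // oppr_le0.
  by rewrite max_l ?sub0r ?opprK // oppr_ge0 ltW.
have AE : \int[N]_z `|L z| = \int[N]_z Lp z + \int[N]_z Lm z.
  rewrite -RintegralD //; [|exact: ib..]; apply: eq_Rintegral => z _.
  rewrite /Lp /Lm; case: (lerP 0 (L z)) => z0.
    by rewrite ger0_norm // max_r ?addr0 // oppr_le0.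
  by rewrite ltr0_norm // max_l ?add0r // oppr_ge0 ltW.
have p0 : 0 <= \int[N]_z Lp z by apply: Rintegral_ge0 => z _; have /andP[] := Lpb z.
have m0 : 0 <= \int[N]_z Lm z by apply: Rintegral_ge0 => z _; have /andP[] := Lmb z.
have m0' : 0 <= \int[N']_z Lm z by apply: Rintegral_ge0 => z _; have /andP[] := Lmb z.
rewrite !LE AE.
move: h1 h2 p0 m0 m0'; set P' := (\int[N']_z Lp z)%R; set M' := (\int[N']_z Lm z)%R.
set P0 := (\int[N]_z Lp z)%R; set M0 := (\int[N]_z Lm z)%R => h1 h2 p0 m0 m0'.
have bd : 0 <= b * delta by exact: mulr_ge0.
(* e M' >= M0 - b delta, and 1 >= e (2 - e) *)
have key : (2 - e) * M0 - b * delta <= M'.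
  have e_gt0 : 0 < e by lra.
  rewrite -(ler_pM2l e_gt0).
  have k1 : 0 <= (e - 1) ^+ 2 * M0 by rewrite mulr_ge0 // sqr_ge0.
  have k2 : 0 <= (e - 1) * (b * delta) by rewrite mulr_ge0 //; lra.
  nra.
nra.
Qed.

End dp_signed.

(** * Integration by parts on the window *)

Section ibp.
Context (R : realType).
Local Notation leb := (@lebesgue_measure R).
Variables (eta m l0 s0 u : R).
Hypothesis eta0 : 0 < eta.

(** Window times [m - t] times the likelihood as a function of a single entry t of B: [l0] and [s0]
    are the log-likelihood and the score at t = 0, [u] is the sum of squared covariates, [m] the
    mean estimate given the data. [f] is the derivative of [F]. *)
Let F (t : R) : R := (1 - (t / eta) ^+ 2) * (m - t) * expR (l0 + s0 * t - u * t ^+ 2 / 2).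
Let f (t : R) : R := ((1 - (t / eta) ^+ 2) * (m - t) * (s0 - u * t) - (1 - (t / eta) ^+ 2)
  + (- (2 * t / eta ^+ 2)) * (m - t)) * expR (l0 + s0 * t - u * t ^+ 2 / 2).

Let is_derive_cont (g : R -> R) (t v : R) : is_derive t 1 g v -> {for t, continuous g}.
Proof.
by move=> [dg _]; apply: differentiable_continuous; exact/derivable1_diffP.
Qed.

(** One derivative rule for all the polynomial factors: [q1] to [q5] rewrite them in this shape. *)
Let dquad (c0 c1 c2 t : R) :
  is_derive t 1 (fun x : R => c0 + c1 * x + c2 * x ^+ 2) (c1 + 2 * c2 * t).
Proof.
have d2 := is_deriveM (is_derive_id t (1 : R)) (is_derive_id t (1 : R)).
have d3 := is_deriveD (is_deriveD (is_derive_cst c0 t (1 : R)) (is_deriveZ c1 (is_derive_id t (1 : R)))) (is_deriveZ c2 d2).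
have sE (a b : R) : a *: b = a * b by [].
apply: (@is_derive_eq _ _ _ _ _ _ _ _ d3); rewrite !sE /=; ring.
Qed.

Let q1 : (fun x : R => 1 - (x / eta) ^+ 2) = (fun x : R => 1 + 0 * x + (- eta ^- 2) * x ^+ 2).
Proof. by apply/funext => x; field; exact: lt0r_neq0. Qed.

Let q2 : (fun x : R => m - x) = (fun x : R => m + (- 1) * x + 0 * x ^+ 2).
Proof. by apply/funext => x; ring. Qed.

Let q3 : (fun x : R => l0 + s0 * x - u * x ^+ 2 / 2) =
  (fun x : R => l0 + s0 * x + (- (u / 2)) * x ^+ 2).
Proof. by apply/funext => x; field. Qed.

Let q4 : (fun x : R => s0 - u * x) = (fun x : R => s0 + (- u) * x + 0 * x ^+ 2).
Proof. by apply/funext => x; ring. Qed.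

Let q5 : (fun x : R => - (2 * x / eta ^+ 2)) = (fun x : R => 0 + (- (2 / eta ^+ 2)) * x + 0 * x ^+ 2).
Proof. by apply/funext => x; field; exact: lt0r_neq0. Qed.

Let dF (t : R) : is_derive t 1 F (f t).
Proof.
have d1 : is_derive t 1 (fun x : R => 1 - (x / eta) ^+ 2) (- (2 * t / eta ^+ 2)).
  rewrite q1; apply: (@is_derive_eq _ _ _ _ _ _ _ _ (dquad _ _ _ t)).
  by field; exact: lt0r_neq0.
have d2 : is_derive t 1 (fun x : R => m - x) (- 1).
  by rewrite q2; apply: (@is_derive_eq _ _ _ _ _ _ _ _ (dquad _ _ _ t)); ring.
have d3 : is_derive t 1 (fun x : R => l0 + s0 * x - u * x ^+ 2 / 2) (s0 - u * t).
  by rewrite q3; apply: (@is_derive_eq _ _ _ _ _ _ _ _ (dquad _ _ _ t)); field.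
have d4 := @is_derive1_comp _ expR (fun x : R => l0 + s0 * x - u * x ^+ 2 / 2) t _ _ (is_derive_expR _) d3.
have d5 := is_deriveM (is_deriveM d1 d2) d4.
rewrite (_ : F = (fun x : R => 1 - (x / eta) ^+ 2) * (fun x : R => m - x) *
   (expR \o (fun x : R => l0 + s0 * x - u * x ^+ 2 / 2))) //.
have sE (a b : R) : a *: b = a * b by [].
apply: (@is_derive_eq _ _ _ _ _ _ _ _ d5).
rewrite /f !sE !fctE /=.
ring.
Qed.

Let cf : continuous f.
Proof.
move=> t.
have c1 : {for t, continuous (fun x : R => 1 - (x / eta) ^+ 2)}.
  by rewrite q1; exact: is_derive_cont (dquad _ _ _ t).
have c2 : {for t, continuous (fun x : R => m - x)}.
  by rewrite q2; exact: is_derive_cont (dquad _ _ _ t).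
have c3 : {for t, continuous (fun x : R => s0 - u * x)}.
  by rewrite q4; exact: is_derive_cont (dquad _ _ _ t).
have c4 : {for t, continuous (fun x : R => - (2 * x / eta ^+ 2))}.
  by rewrite q5; exact: is_derive_cont (dquad _ _ _ t).
have c5 : {for t, continuous (fun x : R => l0 + s0 * x - u * x ^+ 2 / 2)}.
  by rewrite q3; exact: is_derive_cont (dquad _ _ _ t).
have c6 : {for t, continuous (fun x : R => expR (l0 + s0 * x - u * x ^+ 2 / 2))}.
  by apply: (continuous_comp c5); exact: continuous_expR.
exact: (continuousM (continuousD (continuousB (continuousM (continuousM c1 c2) c3) c1) (continuousM c4 c2)) c6).
Qed.

Lemma ibp_integrable : leb.-integrable `[- eta, eta] (fun t => (f t)%:E).
Proof.
apply: continuous_compact_integrable; first exact: segment_compact.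
exact: continuous_subspaceT.
Qed.

Lemma ibp_zero : (\int[leb]_(t in `[(- eta)%R, eta]) (f t)%:E = 0)%E.
Proof.
rewrite (@continuous_FTC2 _ f F) //.
- have -> : F eta = 0 by rewrite /F divff ?gt_eqF // expr1n subrr !mul0r.
  have -> : F (- eta) = 0 by rewrite /F mulNr divff ?gt_eqF // sqrrN expr1n subrr !mul0r.
  by rewrite subee.
- by rewrite gtrN.
- exact: continuous_subspaceT.
- have cF : continuous F.
    by move=> t; exact: is_derive_cont (dF t).
  split.
  + by move=> t _; have [] := dF t.
  + exact/cvg_at_right_filter/cF.
  + exact/cvg_at_left_filter/cF.
- by move=> t _; rewrite derive1E; have := dF t => /@derive_val ->.
Qed.

End ibp.

(** * The regression model *)

Ltac meas := repeat first
  [ assumption | exact: measurable_cst | exact: measurable_id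
  | exact: measurable_fst | exact: measurable_snd
  | apply: measurable_sum => ? | apply: measurable_funD | apply: measurable_funB
  | apply: measurable_funM | apply: measurable_funX
  | apply: measurable_fun_tnth
  | apply: (measurableT_comp measurable_fst) | apply: (measurableT_comp measurable_snd) ].

Section model.
Context (R : realType) (p q : nat).
Local Notation MR := (measurableTypeR R).
Local Notation gam := (normal_prob (0 : R) 1).
Local Notation Y := (p.-tuple MR * q.-tuple MR)%type.
Local Notation Th := ((q * p)%N.-tuple MR).

(* The parameter [t] is a vectorised q x p matrix B. Under [rho t] below, an
   observation (u, v) has u standard and v = B u + standard noise; [ell t] is its
   log-density relative to [gY], and [score t] is the gradient of [ell] in B. *)
Definition gY : probability Y R := (iid gam p \x iid gam q)%E.

Definition th (t : Th) (a : 'I_q) (b : 'I_p) : R := tnth t (mxvec_index a b).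

Definition reg (t : Th) (u : p.-tuple MR) (a : 'I_q) : R := \sum_b th t a b * tnth u b.

Definition score (t : Th) (y : Y) (a : 'I_q) (b : 'I_p) : R :=
  (tnth y.2 a - reg t y.1 a) * tnth y.1 b.

Definition ell (t : Th) (y : Y) : R :=
  \sum_a (tnth y.2 a * reg t y.1 a - reg t y.1 a ^+ 2 / 2).

Definition shear (t : Th) (y : Y) : Y := (y.1, taddr y.2 (reg t y.1)).

Section measurability.
Context dT (T : measurableType dT) (ft : T -> Th) (fy : T -> Y).
Hypotheses (mt : measurable_fun setT ft) (my : measurable_fun setT fy).

Lemma measurable_reg a : measurable_fun setT (fun x => reg (ft x) (fy x).1 a : MR).
Proof. by rewrite /reg /th; meas. Qed.

Lemma measurable_score a b : measurable_fun setT (fun x => score (ft x) (fy x) a b : MR).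
Proof.
have mr := measurable_reg a; rewrite /score; apply: measurable_funM; last by meas.
by apply: measurable_funB => //; meas.
Qed.

Lemma measurable_ell : measurable_fun setT (fun x => ell (ft x) (fy x) : MR).
Proof.
apply: measurable_sum => a; have mr := measurable_reg a.
apply: measurable_funB; first by apply: measurable_funM => //; meas.
by apply: measurable_funM => //; apply: measurable_funX.
Qed.

Lemma measurable_shear2 : measurable_fun setT (fun x => shear (ft x) (fy x)).
Proof.
apply/measurable_fun_pairP; split; first by rewrite /comp /=; meas.
apply/measurable_fun_tnthP => a; rewrite /comp /=.
under eq_fun do rewrite tnth_mktuple.
by apply: measurable_funD; [meas|exact: measurable_reg].
Qed.

End measurability.

Lemma measurable_shear t : measurable_fun setT (shear t).
Proof. exact: (@measurable_shear2 _ _ (cst t) id). Qed.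

HB.instance Definition _ t := isMeasurableFun.Build _ _ _ _ (shear t) (@measurable_shear t).

Definition rho (t : Th) : probability Y R := distribution gY (shear t).

Lemma ge0_integral_gY (f : Y -> \bar R) : measurable_fun setT f -> (forall y, (0 <= f y)%E) ->
  (\int[gY]_y f y = \int[iid gam p]_u \int[iid gam q]_v f (u, v))%E.
Proof. by move=> mf f0; exact: (@fubini_tonelli1 _ _ _ _ _ (iid gam p) (iid gam q) f mf f0). Qed.

Lemma ge0_integral_rho t (f : Y -> \bar R) : measurable_fun setT f -> (forall y, (0 <= f y)%E) ->
  (\int[rho t]_y f y = \int[gY]_y f (shear t y))%E.
Proof.
move=> mf f0; have := ge0_integral_pushforward (@measurable_shear t) gY measurableT mf (fun y _ => f0 y).
by rewrite preimage_setT.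
Qed.

(** For each fixed u, the shear is a translation of v by B u, and [gauss_translate] gives the
    density. *)
Lemma rho_density t (f : Y -> \bar R) : measurable_fun setT f -> (forall y, (0 <= f y)%E) ->
  (\int[rho t]_y f y = \int[gY]_y (f y * (expR (ell t y))%:E))%E.
Proof.
move=> mf f0; rewrite ge0_integral_rho // !ge0_integral_gY //; first last.
- exact: (measurableT_comp mf (@measurable_shear t)).
- by move=> y; rewrite mule_ge0 // lee_fin expR_ge0.
- apply: emeasurable_funM => //; apply/measurable_EFinP; apply: measurableT_comp => //.
  exact: (@measurable_ell _ _ (cst t) id).
apply: eq_integral => u _.
have mfu : measurable_fun setT (fun v => f (u, v)).
  exact: (measurableT_comp mf (measurable_pair1 u)).
exact: (gauss_translate (reg t u) mfu (fun v => f0 (u, v))).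
Qed.

(** In noise coordinates the residual is the noise itself: the score becomes a product of two
    independent normals whatever [t]. All moments of the score are computed through this. *)
Lemma score_shear t y a b : score t (shear t y) a b = tnth y.2 a * tnth y.1 b.
Proof. by rewrite /score /= tnth_mktuple addrK. Qed.

Lemma rho_abs_score t a b : (\int[rho t]_y (`|score t y a b|)%:E <= 6%:E)%E.
Proof.
have ms : measurable_fun setT (fun y => score t y a b : MR).
  exact: (@measurable_score _ _ (cst t) id).
rewrite ge0_integral_rho //; first last.
- by apply/measurable_EFinP; apply: measurableT_comp.
under eq_integral do rewrite score_shear.
pose h1 (y : Y) : R := tnth y.2 a ^+ 2 / 2; pose h2 (y : Y) : R := tnth y.1 b ^+ 2 / 2.
have mh1 : measurable_fun setT h1 by rewrite /h1; meas.
have mh2 : measurable_fun setT h2 by rewrite /h2; meas.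
have h10 y : (0 <= (h1 y)%:E)%E by rewrite lee_fin divr_ge0 // sqr_ge0.
have h20 y : (0 <= (h2 y)%:E)%E by rewrite lee_fin divr_ge0 // sqr_ge0.
apply: (@le_trans _ _ (\int[gY]_y ((h1 y)%:E + (h2 y)%:E))%E).
  apply: ge0_le_integral => //.
  - by apply/measurable_EFinP; apply: measurableT_comp => //; meas.
  - by apply: emeasurable_funD; exact/measurable_EFinP.
  move=> y _; rewrite -EFinD lee_fin normrM /h1 /h2.
  rewrite -(real_normK (num_real (tnth y.2 a))) -(real_normK (num_real (tnth y.1 b))).
  have := sqr_ge0 (`|tnth y.2 a| - `|tnth y.1 b|); nra.
have sq2 : (\int[gam]_t (t ^+ 2 / 2)%:E <= 3%:E)%E.
  under eq_integral do rewrite mulrC EFinM.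
  rewrite ge0_integralZl; [|exact: measurableT|by apply/measurable_EFinP; exact: measurable_funX|by move=> x _; rewrite lee_fin sqr_ge0|by rewrite lee_fin].
  rewrite gam_varE -EFinM lee_fin; have := gam_var_le6 R; lra.
have msq : measurable_fun setT (fun x : MR => (x ^+ 2 / 2)%:E) by apply/measurable_EFinP; meas.
have sq0 (x : MR) : (0 <= (x ^+ 2 / 2)%:E)%E by rewrite lee_fin divr_ge0 // sqr_ge0.
rewrite ge0_integralD //; [|exact/measurable_EFinP..].
have -> : 6%:E = (3%:E + 3%:E)%E :> \bar R by rewrite -EFinD; congr (_%:E); lra.
apply: leeD; rewrite ge0_integral_gY //; [|exact/measurable_EFinP| |exact/measurable_EFinP]; rewrite /h1 /h2 /=.
  rewrite integral_probability_cst.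
  by rewrite (ge0_integral_iid_tnth gam a (f := fun x => (x ^+ 2 / 2)%:E)).
under eq_integral do rewrite integral_probability_cst.
by rewrite (ge0_integral_iid_tnth gam b (f := fun x => (x ^+ 2 / 2)%:E)).
Qed.

Lemma rho_integrable_score t a b : (rho t).-integrable setT (fun y => (score t y a b)%:E).
Proof.
apply/integrableP; split.
  by apply/measurable_EFinP; exact: (@measurable_score _ _ (cst t) id).
exact: le_lt_trans (rho_abs_score t a b) (ltry _).
Qed.

(** The entries of the score are uncorrelated. For fixed u the sum is linear in the noise, with
    coefficients linear in u, so the variance formula for linear forms applies twice. *)
Lemma rho_score_sqr t (c : 'I_q -> 'I_p -> R) :
  (\int[rho t]_y ((\sum_a \sum_b c a b * score t y a b) ^+ 2)%:E =
   (gam_var R ^+ 2 * \sum_a \sum_b c a b ^+ 2)%:E)%E.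
Proof.
have ms a b : measurable_fun setT (fun y => score t y a b : MR).
  exact: (@measurable_score _ _ (cst t) id).
have m1 : measurable_fun setT (fun y : Y => ((\sum_a \sum_b c a b * score t y a b) ^+ 2)%:E).
  apply/measurable_EFinP; apply: measurable_funX; apply: measurable_sum => a.
  by apply: measurable_sum => b; apply: measurable_funM => //; exact: ms.
rewrite ge0_integral_rho //; last by move=> y; rewrite lee_fin sqr_ge0.
rewrite ge0_integral_gY; first last.
- by move=> y; rewrite lee_fin sqr_ge0.
- exact: (measurableT_comp m1 (@measurable_shear t)).
transitivity (\int[iid gam p]_u ((gam_var R)%:E * \sum_a ((\sum_b c a b * tnth u b + 0) ^+ 2)%:E))%E.
  apply: eq_integral => u _.
  rewrite sumEFin -EFinM.
  have := gauss_affine_sqr (fun a => \sum_b c a b * tnth u b) 0.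
  rewrite expr0n /= addr0 => E; under [in RHS]eq_bigr do rewrite addr0.
  rewrite -E; apply: eq_integral => v _; rewrite addr0; congr ((_ ^+ 2)%:E).
  apply: eq_bigr => a _; rewrite mulr_suml; apply: eq_bigr => b _.
  by rewrite score_shear /= mulrAC -mulrA.
have mq a : measurable_fun setT (fun u : p.-tuple MR => ((\sum_b c a b * tnth u b + 0) ^+ 2)%:E).
  by apply/measurable_EFinP; meas.
rewrite ge0_integralZl; first last.
- by rewrite lee_fin gam_var_ge0.
- by move=> u _; apply: sume_ge0 => a _; rewrite lee_fin sqr_ge0.
- exact: emeasurable_sum.
- exact: measurableT.
rewrite ge0_integral_sum //; last by move=> a u _; rewrite lee_fin sqr_ge0.
under eq_bigr do rewrite gauss_affine_sqr expr0n /= addr0.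
by rewrite sumEFin -EFinM; congr (_%:E); rewrite -mulr_sumr mulrA expr2.
Qed.

Lemma gauss_coord_mean0 k (a : 'I_k) : (\int[iid gam k]_v (tnth v a)%:E = 0)%E /\
  (iid gam k).-integrable setT (fun v => (tnth v a)%:E).
Proof.
have i : (iid gam k).-integrable setT (fun v => (tnth v a)%:E).
  apply/integrableP; split; first by apply/measurable_EFinP; meas.
  rewrite (ge0_integral_iid_tnth gam a (f := fun x : MR => `|x%:E|%E)) //; last first.
    by apply: measurableT_comp => //; exact/measurable_EFinP.
  by have /integrableP[] := @integrable_gam_id R.
split=> //; rewrite (iid_resample a i).
under eq_integral do under eq_integral do rewrite tnth_tset eqxx.
by under eq_integral do rewrite gam_mean0; rewrite integral_probability_cst.
Qed.

Lemma rho_score_mean0 t a b : (\int[rho t]_y (score t y a b)%:E = 0)%E.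
Proof.
have ms : measurable_fun setT (fun y => (score t y a b)%:E).
  by apply/measurable_EFinP; exact: (@measurable_score _ _ (cst t) id).
have ii : gY.-integrable setT (fun y => (tnth y.2 a * tnth y.1 b)%:E).
  apply/integrableP; split; first by apply/measurable_EFinP; meas.
  have /integrableP[_] := rho_integrable_score t a b.
  rewrite ge0_integral_rho //; last exact: measurableT_comp.
  by under eq_integral do rewrite score_shear.
have : (\int[rho t]_y (score t y a b)%:E = \int[gY]_y (tnth y.2 a * tnth y.1 b)%:E)%E.
  have := @integral_pushforward _ _ _ _ _ _ (@measurable_shear t) gY setT _ ms.
  rewrite preimage_setT => /(_ _ measurableT) ->.
    by apply: eq_integral => y _; rewrite /= score_shear.
  apply: (eq_integrable measurableT (fun y : Y => (tnth y.2 a * tnth y.1 b)%:E)) => // y _.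
  by rewrite /= score_shear.
move=> ->; have <- := @integral12_prod_meas1 _ _ _ _ _ (iid gam p) (iid gam q) _ ii.
rewrite /fubini_F; under eq_integral => u _.
  under eq_integral do rewrite /= mulrC EFinM.
  rewrite (integralZl measurableT (gauss_coord_mean0 a).2) (gauss_coord_mean0 a).1 mule0.
  over.
by rewrite integral_probability_cst.
Qed.

End model.

(** * The fingerprinting inequality *)

Lemma integral_Rintegral d (T : measurableType d) (R : realType) (Q : {measure set T -> \bar R})
    (f : T -> R) : Q.-integrable setT (fun x => (f x)%:E) ->
  (\int[Q]_x (f x)%:E)%E = (\int[Q]_x f x)%:E.
Proof. by move=> ig; rewrite /Rintegral fineK //; exact: (integrable_fin_num measurableT ig). Qed.

Lemma integrable_cst_probability d (T : measurableType d) (R : realType) (Q : probability T R)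
    (c : R) : Q.-integrable setT (fun=> c%:E).
Proof. exact: finite_measure_integrable_cst. Qed.

Section window.
Context (R : realType) (eta : R).
Hypothesis eta0 : 0 < eta.

(** Up to scaling, the Epanechnikov kernel; [dom] is its derivative inside the window, of size at
    most 2 / eta. *)
Definition om (x : R) : R := \1_`[- eta, eta] x * (1 - (x / eta) ^+ 2).
Definition dom (x : R) : R := \1_`[- eta, eta] x * - (2 * x / eta ^+ 2).

Lemma measurable_om : measurable_fun setT (om : measurableTypeR R -> measurableTypeR R).
Proof.
apply: measurable_funM; first exact: measurable_indic.
by apply: measurable_funB => //; apply: measurable_funX; apply: measurable_funM.
Qed.

Lemma measurable_dom : measurable_fun setT (dom : measurableTypeR R -> measurableTypeR R).
Proof.
apply: measurable_funM; first exact: measurable_indic.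
apply: measurableT_comp => //.
by apply: measurable_funM => //; apply: measurable_funM.
Qed.

Lemma indic_itvE (x : R) : \1_`[- eta, eta] x = (if `|x| <= eta then 1 else 0) :> R.
Proof.
rewrite indicE ler_norml; have -> : (x \in `[- eta, eta]%classic) = (- eta <= x <= eta).
  by apply/idP/idP; rewrite inE /= in_itv.
by case: ifP.
Qed.

Lemma window_bound (x : R) : `|x| <= eta -> (x / eta) ^+ 2 <= 1.
Proof.
move=> xe; rewrite -(real_normK (num_real (x / eta))) normrM (gtr0_norm (_ : 0 < eta^-1)) ?invr_gt0 //.
have x0 : 0 <= `|x| / eta by rewrite divr_ge0 // ltW.
by apply: exprn_ile1 => //; rewrite ler_pdivrMr // mul1r.
Qed.

Lemma om_bounds (x : R) : 0 <= om x <= 1.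
Proof.
rewrite /om indic_itvE; case: ifP => xe; last by rewrite mul0r lexx ler01.
have := window_bound xe; have := sqr_ge0 (x / eta); rewrite mul1r; lra.
Qed.

Lemma om_mul_bound (m x : R) : `|m| <= eta -> `|om x * (m - x)| <= 2 * eta.
Proof.
move=> me; have e0 := eta0.
have [xe|xe] := lerP `|x| eta; last first.
  rewrite /om indic_itvE (lt_geF xe) !mul0r normr0; lra.
have /andP[w0 w1] := om_bounds x.
rewrite normrM (ger0_norm w0); apply: (@le_trans _ _ (1 * `|m - x|)).
  exact: ler_wpM2r.
have := ler_normB m x; lra.
Qed.

Lemma dom_mul_bound (m x : R) : `|m| <= eta -> `|dom x * (m - x)| <= 4.
Proof.
move=> me; have e0 := eta0.
have [xe|xe] := lerP `|x| eta; last first.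
  by rewrite /dom indic_itvE (lt_geF xe) !mul0r normr0.
rewrite /dom indic_itvE xe mul1r mulNr normrN !normrM (ger0_norm (_ : 0 <= 2)) //.
rewrite (gtr0_norm (_ : 0 < (eta ^+ 2)^-1)) ?invr_gt0 ?exprn_gt0 //.
have h : `|m - x| <= 2 * eta by have := ler_normB m x; lra.
rewrite mulrAC ler_pdivrMr ?exprn_gt0 //.
have : `|x| * `|m - x| <= eta * (2 * eta) by apply: ler_pM.
rewrite -mulrA; nra.
Qed.

(* AM-GM: (2 / eta) |m - x| <= 1/6 + 6 (m - x)^2 / eta^2 *)
Lemma dom_amgm (m x : R) : dom x * (m - x) <= 1 / 6 + 6 / eta ^+ 2 * (m - x) ^+ 2.
Proof.
have e0 := eta0.
have rhs0 : 0 <= 6 / eta ^+ 2 * (m - x) ^+ 2.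
  by rewrite mulr_ge0 ?sqr_ge0 // divr_ge0 // sqr_ge0.
have [xe|xe] := lerP `|x| eta; last first.
  by rewrite /dom indic_itvE (lt_geF xe) !mul0r; lra.
rewrite /dom indic_itvE xe (mul1r (- _)).
set s := x / eta; set w := (m - x) / eta.
have -> : - (2 * x / eta ^+ 2) * (m - x) = - (2 * s * w) by rewrite /s /w; field; rewrite gt_eqF.
have -> : 6 / eta ^+ 2 * (m - x) ^+ 2 = 6 * w ^+ 2 by rewrite /w; field; rewrite gt_eqF.
have := window_bound xe; rewrite -/s => s1.
(* Expanding gives -2 s w <= s^2 / 6 + 6 w^2, and s^2 <= 1 on the window. *)
have := sqr_ge0 (s + 6 * w); nra.
Qed.

End window.

Section mechanism.
Context (R : realType) (p q n : nat) dZ (Z : measurableType dZ).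
Local Notation MR := (measurableTypeR R).
Local Notation gam := (normal_prob (0 : R) 1).
Local Notation Y := (p.-tuple MR * q.-tuple MR)%type.
Local Notation Th := ((q * p)%N.-tuple MR).
Variables (k : n.-tuple Y -> probability Z R) (est : Z -> 'I_q -> 'I_p -> R).
Variables (eta e delta : R).
Hypothesis eta0 : 0 < eta.
Hypothesis mk : forall g : Z -> \bar R, measurable_fun setT g -> (forall z, (0 <= g z)%E) ->
  measurable_fun setT (fun ys => \int[k ys]_z g z)%E.
Hypothesis mest : forall a b, measurable_fun setT (fun z => est z a b : MR).
Hypothesis estb : forall z a b, `|est z a b| <= eta.

Definition mu a b ys : R := (\int[k ys]_z est z a b)%R.
Definition m2 a b ys : R := (\int[k ys]_z (est z a b ^+ 2))%R.

Let iest a b ys : (k ys).-integrable setT (fun z => (est z a b)%:E).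
Proof. exact: (bounded_integrable (k ys) (mest a b) (fun z => estb z a b)). Qed.

Let iest2 a b ys : (k ys).-integrable setT (fun z => (est z a b ^+ 2)%:E).
Proof.
apply: (@bounded_integrable _ _ _ _ _ (eta ^+ 2)); first by apply: measurable_funX; exact: mest.
by move=> z; rewrite normrX; apply: lerXn2r; rewrite ?nnegrE // ltW.
Qed.

Lemma measurable_mu a b : measurable_fun setT (mu a b : _ -> MR).
Proof.
(* [mk] speaks of nonnegative integrands; adding eta makes the estimate nonnegative. *)
have -> : mu a b = fun ys => fine (\int[k ys]_z (est z a b + eta)%:E)%E - eta.
  apply/funext => ys; under [in RHS]eq_integral do rewrite EFinD.
  rewrite (integralD measurableT (iest a b ys) (integrable_cst_probability _ _)).
  rewrite (integral_Rintegral (iest a b ys)) integral_probability_cst -EFinD /=.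
  by rewrite addrK.
apply: measurable_funB => //; apply: measurableT_comp => //; apply: mk.
  by apply/measurable_EFinP; apply: measurable_funD => //; exact: mest.
move=> z; rewrite lee_fin; have := estb z a b; rewrite ler_norml; lra.
Qed.

Lemma measurable_m2 a b : measurable_fun setT (m2 a b : _ -> MR).
Proof.
rewrite /m2 /Rintegral; apply: measurableT_comp => //; apply: mk.
  by apply/measurable_EFinP; apply: measurable_funX; exact: mest.
by move=> z; rewrite lee_fin sqr_ge0.
Qed.

Lemma mu_bound a b ys : `|mu a b ys| <= eta.
Proof.
rewrite -lee_fin; apply: (@le_trans _ _ (\int[k ys]_z `|(est z a b)%:E|)%E).
  rewrite /mu -abse_EFin -(integral_Rintegral (iest a b ys)); apply: le_abse_integral => //.
  exact/measurable_EFinP/mest.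
rewrite -[leRHS](integral_probability_cst (k ys)); apply: ge0_le_integral => //.
- by apply: measurableT_comp => //; exact/measurable_EFinP/mest.
- by move=> z _; rewrite lee_fin.
Qed.

Lemma est_sqr a b ys (c : R) :
  (\int[k ys]_z ((est z a b - c) ^+ 2)%:E)%E = (m2 a b ys - 2 * c * mu a b ys + c ^+ 2)%:E.
Proof.
transitivity (\int[k ys]_z ((est z a b ^+ 2)%:E + ((- (2 * c))%:E * (est z a b)%:E + (c ^+ 2)%:E)))%E.
  by apply: eq_integral => z _; rewrite -EFinM -!EFinD; congr (_%:E); ring.
have i2 := integrableZl measurableT (- (2 * c)) (iest a b ys).
have i3 := integrable_cst_probability (k ys) (c ^+ 2).
rewrite (integralD measurableT (iest2 a b ys) (integrableD measurableT i2 i3)).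
rewrite (integralD measurableT i2 i3) (integralZl measurableT (iest a b ys)).
rewrite (integral_Rintegral (iest a b ys)) (integral_Rintegral (iest2 a b ys)) integral_probability_cst.
by rewrite -EFinM -!EFinD -/(mu a b ys) -/(m2 a b ys); congr (_%:E); ring.
Qed.

(** The conditional variance of the estimate given the data is nonnegative. *)
Lemma mu_jensen a b ys c : (mu a b ys - c) ^+ 2 <= m2 a b ys - 2 * c * mu a b ys + c ^+ 2.
Proof.
have : (0 <= \int[k ys]_z ((est z a b - mu a b ys) ^+ 2)%:E)%E.
  by apply: integral_ge0 => z _; rewrite lee_fin sqr_ge0.
rewrite est_sqr lee_fin; set x := mu a b ys; set y := m2 a b ys; nra.
Qed.

(* The conditional mean square error given the data. *)
Definition rerr (t : Th) ys : R :=
  \sum_a \sum_b (m2 a b ys - 2 * th t a b * mu a b ys + th t a b ^+ 2).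

Lemma rerrE t ys :
  (\int[k ys]_z (\sum_a \sum_b (est z a b - th t a b) ^+ 2)%:E)%E = (rerr t ys)%:E.
Proof.
have ms a b : measurable_fun setT (fun z => ((est z a b - th t a b) ^+ 2)%:E).
  by apply/measurable_EFinP; apply: measurable_funX; apply: measurable_funB => //; exact: mest.
under eq_integral do rewrite -sumEFin.
rewrite ge0_integral_sum //; last 2 first.
- move=> a; under eq_fun do rewrite -sumEFin; exact: emeasurable_sum.
- by move=> a z _; rewrite lee_fin sumr_ge0 // => b _; exact: sqr_ge0.
rewrite -sumEFin; apply: eq_bigr => a _; under eq_integral do rewrite -sumEFin.
rewrite ge0_integral_sum //; last by move=> b z _; rewrite lee_fin sqr_ge0.
by rewrite -sumEFin; apply: eq_bigr => b _; rewrite est_sqr.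
Qed.

Lemma rerr_ge0 t ys : 0 <= rerr t ys.
Proof.
rewrite -lee_fin -rerrE; apply: integral_ge0 => z _; rewrite lee_fin.
by apply: sumr_ge0 => a _; apply: sumr_ge0 => b _; exact: sqr_ge0.
Qed.

Lemma rerr_bound t : exists C : R, forall ys, rerr t ys <= C.
Proof.
exists (\sum_a \sum_b (eta + `|th t a b|) ^+ 2) => ys.
rewrite -lee_fin -rerrE -[leRHS](integral_probability_cst (k ys)).
apply: ge0_le_integral => //.
- move=> z _; rewrite lee_fin.
  by apply: sumr_ge0 => a _; apply: sumr_ge0 => b _; exact: sqr_ge0.
- apply/measurable_EFinP; apply: measurable_sum => a; apply: measurable_sum => b.
  by apply: measurable_funX; apply: measurable_funB => //; exact: mest.
move=> z _; rewrite lee_fin; apply: ler_sum => a _; apply: ler_sum => b _.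
rewrite -(real_normK (num_real (_ - _))); apply: lerXn2r; rewrite ?nnegrE //.
  by rewrite addr_ge0 // ltW.
by rewrite (le_trans (ler_normB _ _)) // lerD2r.
Qed.

(* The fingerprinting statistic, its version before averaging over the output of
   the mechanism, and their common bound. *)
Definition Tstat (t : Th) ys (y : Y) : R :=
  \sum_a \sum_b om eta (th t a b) * (mu a b ys - th t a b) * score t y a b.
Definition Lstat (t : Th) (y : Y) z : R :=
  \sum_a \sum_b om eta (th t a b) * (est z a b - th t a b) * score t y a b.
Definition bstat (t : Th) (y : Y) : R := \sum_a \sum_b 2 * eta * `|score t y a b|.

Let mscore t a b : measurable_fun setT (fun y : Y => score t y a b : MR).
Proof. exact: (@measurable_score _ _ _ _ _ (cst t) id). Qed.

Lemma sum_score_bound t y (c : 'I_q -> 'I_p -> R) : (forall a b, `|c a b| <= 2 * eta) ->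
  `|\sum_a \sum_b c a b * score t y a b| <= bstat t y.
Proof.
move=> cb; apply: le_trans (ler_norm_sum _ _ _) _; apply: ler_sum => a _.
apply: le_trans (ler_norm_sum _ _ _) _; apply: ler_sum => b _.
by rewrite normrM; apply: ler_wpM2r.
Qed.

Lemma Tstat_bound t ys y : `|Tstat t ys y| <= bstat t y.
Proof. by apply: sum_score_bound => a b; apply: om_mul_bound => //; exact: mu_bound. Qed.

Lemma Lstat_bound t y z : `|Lstat t y z| <= bstat t y.
Proof. by apply: sum_score_bound => a b; apply: om_mul_bound. Qed.

Lemma measurable_bstat t : measurable_fun setT (bstat t : _ -> MR).
Proof.
apply: measurable_sum => a; apply: measurable_sum => b; apply: measurable_funM => //.
by apply: measurableT_comp => //; exact: mscore.
Qed.

Lemma integral_bstat t : (\int[rho t]_y (bstat t y)%:E <= (12 * eta * (q * p)%:R)%:E)%E.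
Proof.
have e0 := eta0.
have ms a b : measurable_fun setT (fun y => (2 * eta * `|score t y a b|)%:E).
  apply/measurable_EFinP; apply: measurable_funM => //.
  by apply: measurableT_comp => //; exact: mscore.
have s0 a b y : (0 <= (2 * eta * `|score t y a b|)%:E)%E.
  by rewrite lee_fin mulr_ge0 // mulr_ge0 // ltW.
rewrite /bstat; under eq_integral do rewrite -sumEFin.
rewrite ge0_integral_sum //; last 2 first.
- move=> a; under eq_fun do rewrite -sumEFin; exact: emeasurable_sum.
- by move=> a y _; rewrite -sumEFin; apply: sume_ge0.
apply: (@le_trans _ _ (\sum_(a < q) \sum_(b < p) (12 * eta)%:E)%E).
  apply: lee_sum => a _; under eq_integral do rewrite -sumEFin.
  rewrite ge0_integral_sum //; apply: lee_sum => b _.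
  under eq_integral do rewrite EFinM.
  rewrite ge0_integralZl; first last.
  - by rewrite lee_fin mulr_ge0 // ltW.
  - by [].
  - by apply/measurable_EFinP; apply: measurableT_comp => //; exact: mscore.
  - exact: measurableT.
  have -> : (12 * eta)%:E = ((2 * eta)%:E * 6%:E)%E :> \bar R by rewrite -EFinM; congr (_%:E); lra.
  by apply: lee_wpmul2l; [rewrite lee_fin mulr_ge0 // ltW|exact: rho_abs_score].
under eq_bigr do rewrite sumEFin; rewrite sumEFin lee_fin.
under eq_bigr do rewrite sumr_const card_ord.
by rewrite sumr_const card_ord -mulrnA -[X in X <= _]mulr_natr mulnC.
Qed.

Lemma integrable_bstat t : (rho t).-integrable setT (fun y => (bstat t y)%:E).
Proof.
apply/integrableP; split; first by apply/measurable_EFinP; exact: measurable_bstat.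
apply: le_lt_trans (ltry (12 * eta * (q * p)%:R)); apply: le_trans (integral_bstat t).
rewrite le_eqVlt; apply/orP; left; apply/eqP; apply: eq_integral => y _.
rewrite gee0_abs // lee_fin; exact: le_trans (Lstat_bound t y point).
Qed.

Lemma Lstat_mean t ys y : (\int[k ys]_z (Lstat t y z)%:E = (Tstat t ys y)%:E)%E.
Proof.
pose c a b := om eta (th t a b) * score t y a b.
have LE z : (Lstat t y z)%:E = (\sum_a \sum_b ((c a b)%:E * (est z a b)%:E + (- (c a b * th t a b))%:E))%E.
  rewrite /Lstat -sumEFin; apply: eq_bigr => a _; rewrite -sumEFin; apply: eq_bigr => b _.
  by rewrite -EFinM -EFinD; congr (_%:E); rewrite /c; ring.
under eq_integral do rewrite LE.
have i1 a b : (k ys).-integrable setT (fun z => ((c a b)%:E * (est z a b)%:E + (- (c a b * th t a b))%:E))%E.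
  apply: integrableD => //; last exact: integrable_cst_probability.
  exact: (integrableZl measurableT _ (iest a b ys)).
rewrite integral_sum //; last by move=> a; exact: integrable_sum.
rewrite -sumEFin; apply: eq_bigr => a _; rewrite integral_sum // -sumEFin; apply: eq_bigr => b _.
rewrite integralD //; last 2 first.
- exact: (integrableZl measurableT _ (iest a b ys)).
- exact: integrable_cst_probability.
rewrite (integralZl measurableT (iest a b ys)) (integral_Rintegral (iest a b ys)) integral_probability_cst -EFinM -EFinD; congr (_%:E).
by rewrite -/(mu a b ys) /c; ring.
Qed.

(** The data [ys] do not involve [y], so the coefficients are constants and the score is
    centered. *)
Lemma Tstat_mean0 t ys : (\int[rho t]_y (Tstat t ys y)%:E = 0)%E.
Proof.
rewrite /Tstat; under eq_integral do rewrite -sumEFin.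
have i1 a b : (rho t).-integrable setT
    (fun y => (om eta (th t a b) * (mu a b ys - th t a b) * score t y a b)%:E).
  under eq_fun do rewrite EFinM; apply: integrableZl => //; exact: rho_integrable_score.
rewrite integral_sum //; last first.
  by move=> a; under eq_fun do rewrite -sumEFin; exact: integrable_sum.
rewrite big1 // => a _; under eq_integral do rewrite -sumEFin.
rewrite integral_sum // big1 // => b _; under eq_integral do rewrite EFinM.
by rewrite integralZl ?rho_score_mean0 ?mule0 //; exact: rho_integrable_score.
Qed.

Lemma measurable_Tstat dT (T : measurableType dT) (ft : T -> Th) (fx : T -> n.-tuple Y) (fy : T -> Y) :
  measurable_fun setT ft -> measurable_fun setT fx -> measurable_fun setT fy ->
  measurable_fun setT (fun x => Tstat (ft x) (fx x) (fy x) : MR).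
Proof.
move=> mt mx my; apply: measurable_sum => a; apply: measurable_sum => b.
have mth : measurable_fun setT (fun x => th (ft x) a b : MR) by exact: measurable_fun_tnth.
apply: measurable_funM; last exact: measurable_score.
apply: measurable_funM; first exact: (measurableT_comp (measurable_om eta) mth).
by apply: measurable_funB => //; exact: (measurableT_comp (measurable_mu a b) mx).
Qed.

End mechanism.

(** * Privacy bounds the correlation with each sample *)

Section upper.
Context (R : realType) (p q n : nat) dZ (Z : measurableType dZ).
Local Notation MR := (measurableTypeR R).
Local Notation gam := (normal_prob (0 : R) 1).
Local Notation Y := (p.-tuple MR * q.-tuple MR)%type.
Local Notation Th := ((q * p)%N.-tuple MR).
Variables (k : n.-tuple Y -> probability Z R) (est : Z -> 'I_q -> 'I_p -> R).
Variables (eta e delta : R).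
Hypothesis eta0 : 0 < eta.
Hypothesis mk : forall g : Z -> \bar R, measurable_fun setT g -> (forall z, (0 <= g z)%E) ->
  measurable_fun setT (fun ys => \int[k ys]_z g z)%E.
Hypothesis mest : forall a b, measurable_fun setT (fun z => est z a b : MR).
Hypothesis estb : forall z a b, `|est z a b| <= eta.
Hypotheses (e1 : 1 <= e) (delta0 : 0 <= delta).
Hypothesis dp : forall ys i y A, measurable A ->
  (k (tset i ys y) A <= e%:E * k ys A + delta%:E)%E /\
  (k ys A <= e%:E * k (tset i ys y) A + delta%:E)%E.

Local Notation Lst := (Lstat est eta).
Local Notation Tst := (Tstat k est eta).
Local Notation bst := (@bstat R p q eta).
Local Notation rer := (rerr k est).

Let mL2 t : measurable_fun setT (fun w : Y * Z => Lst t w.1 w.2 : MR).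
Proof.
apply: measurable_sum => a; apply: measurable_sum => b.
apply: measurable_funM; last exact: (@measurable_score _ _ _ _ _ (cst t) fst).
apply: measurable_funM => //; apply: measurable_funB => //.
exact: (measurableT_comp (mest a b) measurable_snd).
Qed.

Let mLz t y : measurable_fun setT (Lst t y : Z -> MR).
Proof. exact: (measurableT_comp (mL2 t) (measurable_pair1 y)). Qed.

Let L_bound t y z : `|Lst t y z| <= bst t y. Proof. exact: Lstat_bound. Qed.

Let bst_ge0 t y : 0 <= bst t y. Proof. exact: le_trans (L_bound t y point). Qed.

Let habs (t : Th) ys y : R := (\int[k ys]_z `|Lst t y z|)%R.

Let mabs t : measurable_fun setT (fun w : Y * Z => `|Lst t w.1 w.2|%:E).
Proof. by apply/measurable_EFinP; apply: measurableT_comp => //; exact: mL2. Qed.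

Let iabs t ys y : (k ys).-integrable setT (fun z => `|Lst t y z|%:E).
Proof.
apply: (@bounded_integrable _ _ _ (k ys) (fun z => `|Lst t y z|) (bst t y)).
  by apply: measurableT_comp => //; exact: mLz.
by move=> z; rewrite normr_id.
Qed.

Let habsE t ys y : (\int[k ys]_z `|Lst t y z|%:E)%E = (habs t ys y)%:E.
Proof. exact: (integral_Rintegral (iabs t ys y)). Qed.

Let mhabs t ys : measurable_fun setT (habs t ys : Y -> MR).
Proof.
apply/measurable_EFinP.
have : measurable_fun setT (fubini_F (k ys) (fun w : Y * Z => `|Lst t w.1 w.2|%:E)).
  by apply: measurable_fun_fubini_tonelli_F; [exact: mabs|move=> w; rewrite lee_fin].
by apply: eq_measurable_fun => y _; rewrite /fubini_F /= habsE.
Qed.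

Let habs_bound t ys y : 0 <= habs t ys y <= bst t y.
Proof.
apply/andP; split; first by apply: Rintegral_ge0.
rewrite -lee_fin -habsE -[leRHS](integral_probability_cst (k ys)).
apply: ge0_le_integral => //; first exact: (measurableT_comp (mabs t) (measurable_pair1 y)).
by move=> z _; rewrite lee_fin.
Qed.

(* |L| <= L^2 / (12 beta) + 3 beta *)
Let integral_habs t ys beta : 0 < beta ->
  (\int[rho t]_y (habs t ys y)%:E <= (3 / beta * rer t ys + 3 * beta)%:E)%E.
Proof.
move=> beta0.
have mL2' : measurable_fun setT (fun w : Y * Z => (1 / (12 * beta) * Lst t w.1 w.2 ^+ 2 + 3 * beta)%:E).
  apply/measurable_EFinP; apply: measurable_funD => //; apply: measurable_funM => //.
  by apply: measurable_funX; exact: mL2.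
have c0 : 0 <= 1 / (12 * beta) by rewrite divr_ge0 // mulr_ge0 // ltW.
have p0 (w : Y * Z) : (0 <= (1 / (12 * beta) * Lst t w.1 w.2 ^+ 2 + 3 * beta)%:E)%E.
  by rewrite lee_fin; apply: addr_ge0; [exact: mulr_ge0 c0 (sqr_ge0 _)|exact: mulr_ge0 _ (ltW beta0)].
under eq_integral do rewrite -habsE.
apply: (@le_trans _ _ (\int[rho t]_y \int[k ys]_z (1 / (12 * beta) * Lst t y z ^+ 2 + 3 * beta)%:E)%E).
  apply: ge0_le_integral => //.
  - by move=> y _; apply: integral_ge0 => z _; rewrite lee_fin.
  - apply: (measurable_fun_fubini_tonelli_F (fun w : Y * Z => `|Lst t w.1 w.2|%:E)); first exact: mabs.
    by move=> w; rewrite lee_fin.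
  - exact: (measurable_fun_fubini_tonelli_F _ mL2' p0).
  move=> y _; apply: ge0_le_integral => //.
  - exact: (measurableT_comp (mabs t) (measurable_pair1 y)).
  - exact: (measurableT_comp mL2' (measurable_pair1 y)).
  move=> z _; rewrite lee_fin -(real_normK (num_real (Lst t y z))).
  set x := `|_|; rewrite -subr_ge0.
  have -> : 1 / (12 * beta) * x ^+ 2 + 3 * beta - x = 1 / (12 * beta) * (x - 6 * beta) ^+ 2.
    by field; rewrite gt_eqF.
  exact: mulr_ge0 c0 (sqr_ge0 _).
rewrite (@fubini_tonelli _ _ _ _ _ (rho t) (k ys) _ mL2' p0) /=.
pose S z : R := \sum_a \sum_b (est z a b - th t a b) ^+ 2.
have mS : measurable_fun setT (S : Z -> MR).
  apply: measurable_sum => a; apply: measurable_sum => b; apply: measurable_funX.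
  by apply: measurable_funB => //; exact: mest.
have S0 z : 0 <= S z by apply: sumr_ge0 => a _; apply: sumr_ge0 => b _; exact: sqr_ge0.
have b3 : 0 <= 3 / beta by rewrite divr_ge0 // ltW.
apply: (@le_trans _ _ (\int[k ys]_z ((3 / beta)%:E * (S z)%:E + (3 * beta)%:E))%E); last first.
  rewrite ge0_integralD //; first last.
  - by move=> z _; rewrite lee_fin mulr_ge0 // ltW.
  - by apply: measurable_funeM; exact/measurable_EFinP.
  - by move=> z _; rewrite -EFinM lee_fin mulr_ge0.
  rewrite ge0_integralZl //; first last.
  - by move=> z _; rewrite lee_fin.
  - exact/measurable_EFinP.
  by rewrite (rerrE k eta0 mest estb) integral_probability_cst -EFinM -EFinD.
apply: ge0_le_integral => //.
- by move=> z _; apply: integral_ge0 => y _; exact: (p0 (y, z)).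
- exact: (measurable_fun_fubini_tonelli_G _ mL2' p0).
- apply: emeasurable_funD => //; apply: measurable_funeM; exact/measurable_EFinP.
move=> z _.
have mLy : measurable_fun setT (fun y => (Lst t y z ^+ 2)%:E).
  apply/measurable_EFinP; apply: measurable_funX.
  exact: (measurableT_comp (mL2 t) (measurable_pair2 z)).
under eq_integral do rewrite EFinD EFinM.
rewrite ge0_integralD //; first last.
- by move=> y _; rewrite lee_fin mulr_ge0 // ltW.
- exact: measurable_funeM.
- by move=> y _; rewrite -EFinM lee_fin mulr_ge0 // sqr_ge0.
rewrite ge0_integralZl //; last by move=> y _; rewrite lee_fin sqr_ge0.
(* For a fixed output [z], the second moment over the fresh sample is gam_var^2 times the windowed
   squared error, hence at most 36 S z; 36 / (12 beta) is the 3 / beta of the claim. *)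
rewrite integral_probability_cst /Lstat (rho_score_sqr t (fun a b => om eta (th t a b) * (est z a b - th t a b))).
rewrite -!EFinM -!EFinD lee_fin lerD2r.
have omS : \sum_a \sum_b (om eta (th t a b) * (est z a b - th t a b)) ^+ 2 <= S z.
  apply: ler_sum => a _; apply: ler_sum => b _; rewrite exprMn ler_piMl ?sqr_ge0 //.
  by have /andP[w0 w1] := om_bounds eta0 (th t a b); apply: exprn_ile1.
set W := \sum_a \sum_b _ in omS *.
have W0 : 0 <= W by apply: sumr_ge0 => a _; apply: sumr_ge0 => b _; exact: sqr_ge0.
have v0 := gam_var_ge0 R; have v6 := gam_var_le6 R.
have vW : gam_var R ^+ 2 * W <= 36 * S z.
  apply: ler_pM => //; first exact: sqr_ge0.
  by rewrite (_ : 36 = 6 ^+ 2); [apply: lerXn2r; rewrite ?nnegrE|lra].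
apply: (@le_trans _ _ (1 / (12 * beta) * (36 * S z))); first exact: ler_wpM2l.
by rewrite le_eqVlt; apply/orP; left; apply/eqP; field; rewrite gt_eqF.
Qed.

Let iT t ys : (rho t).-integrable setT (fun y => (Tst t ys y)%:E).
Proof.
apply: (@le_integrable _ _ _ _ _ measurableT _ (fun y => (bst t y)%:E)).
- apply/measurable_EFinP.
  by apply: (@measurable_Tstat R p q n dZ Z k est eta mk mest estb _ _ (cst t) (cst ys) id).
- by move=> y _; rewrite lee_fin (ger0_norm (bst_ge0 t y)); exact: (Tstat_bound k eta0 mest estb).
- exact: (integrable_bstat eta0 estb t).
Qed.

Let mTset t i : measurable_fun setT (fun w : n.-tuple Y * Y => Tst t (tset i w.1 w.2) w.2 : MR).
Proof.
apply: (@measurable_Tstat R p q n dZ Z k est eta mk mest estb _ _ (cst t) (fun w : n.-tuple Y * Y => tset i w.1 w.2) snd) => //.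
exact: measurable_tset.
Qed.

Let iTset t i ys : (rho t).-integrable setT (fun y => (Tst t (tset i ys y) y)%:E).
Proof.
apply: (@le_integrable _ _ _ _ _ measurableT _ (fun y => (bst t y)%:E)).
- by apply/measurable_EFinP; exact: (measurableT_comp (mTset t i) (measurable_pair1 ys)).
- by move=> y _; rewrite lee_fin (ger0_norm (bst_ge0 t y)); exact: (Tstat_bound k eta0 mest estb).
- exact: (integrable_bstat eta0 estb t).
Qed.

(** With [y] fixed, the output law on the data containing [y] is compared with that on [ys], for
    which the mean over [y] is 0 by [Tstat_mean0]. The loss is e - 1 times the mean of |L| on [ys],
    plus 2 delta times [bstat], whose mean is at most 12 eta q p. *)
Lemma resampled_step t ys i beta : 0 < beta ->
  (\int[rho t]_y (Tst t (tset i ys y) y)%:E <=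
   ((e - 1) * (3 / beta * rer t ys + 3 * beta) + 24 * delta * eta * (q * p)%:R)%:E)%E.
Proof.
move=> beta0.
have ih : (rho t).-integrable setT (fun y => (habs t ys y)%:E).
  apply: (@le_integrable _ _ _ _ _ measurableT _ (fun y => (bst t y)%:E)).
  - by apply/measurable_EFinP; exact: mhabs.
  - move=> y _; have /andP[h0 h1] := habs_bound t ys y.
    by rewrite lee_fin (ger0_norm (bst_ge0 t y)) ger0_norm.
  - exact: (integrable_bstat eta0 estb t).
have ib := integrable_bstat eta0 estb t.
have i2 := integrableZl measurableT (e - 1) ih.
have i3 := integrableZl measurableT (2 * delta) ib.
have RL ys' y : (\int[k ys']_z Lst t y z)%R = Tst t ys' y.
  by rewrite /Rintegral (Lstat_mean k mest estb).
have ptw y : ((Tst t (tset i ys y) y)%:E <= (Tst t ys y)%:E + ((e - 1)%:E * (habs t ys y)%:E + (2 * delta)%:E * (bst t y)%:E))%E.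
  rewrite -!EFinM -!EFinD lee_fin -!RL addrA.
  apply: dp_signed => //.
  - by move=> A mA; have [] := dp ys i y mA.
  - by move=> A mA; have [] := dp ys i y mA.
  - exact: mLz.
apply: le_trans (le_integral measurableT (iTset t i ys) (integrableD measurableT (iT t ys) (integrableD measurableT i2 i3)) (fun y _ => ptw y)) _.
rewrite (integralD measurableT (iT t ys) (integrableD measurableT i2 i3)).
rewrite (integralD measurableT i2 i3) (integralZl measurableT ih) (integralZl measurableT ib).
rewrite (Tstat_mean0 k est eta t ys) add0e [in leRHS]EFinD; apply: leeD.
  rewrite EFinM; apply: lee_wpmul2l; last exact: integral_habs.
  by rewrite lee_fin subr_ge0.
have -> : 24 * delta * eta * (q * p)%:R = 2 * delta * (12 * eta * (q * p)%:R) by ring.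
rewrite [in leRHS]EFinM; apply: lee_wpmul2l; last exact: integral_bstat.
by rewrite lee_fin mulr_ge0.
Qed.

Lemma integrable_rerr t (Q : probability (n.-tuple Y) R) : Q.-integrable setT (fun ys => (rer t ys)%:E).
Proof.
have [C CP] := rerr_bound k eta0 mest estb t.
apply: (@bounded_integrable _ _ _ Q (rer t) C).
  apply: measurable_sum => a; apply: measurable_sum => b.
  apply: measurable_funD => //; apply: measurable_funB; first exact: (measurable_m2 mk mest).
  by apply: measurable_funM => //; exact: (measurable_mu mk mest estb).
by move=> ys; rewrite ger0_norm //; exact: (rerr_ge0 k eta0 mest estb).
Qed.

Let mTi t (i : 'I_n) : measurable_fun setT (fun ys => Tst t ys (tnth ys i) : MR).
Proof.
apply: (@measurable_Tstat R p q n dZ Z k est eta mk mest estb _ _ (cst t) id (fun ys => tnth ys i)) => //.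
exact: measurable_fun_tnth.
Qed.

Lemma integrable_Tstat t i : (iid (rho t) n).-integrable setT (fun ys => (Tst t ys (tnth ys i))%:E).
Proof.
apply/integrableP; split; first by apply/measurable_EFinP; exact: mTi.
apply: (@le_lt_trans _ _ (\int[iid (rho t) n]_ys (bst t (tnth ys i))%:E)%E).
  apply: ge0_le_integral => //.
  - by apply: measurableT_comp => //; apply/measurable_EFinP; exact: mTi.
  - apply/measurable_EFinP; apply: measurableT_comp; first exact: measurable_bstat.
    exact: measurable_fun_tnth.
  by move=> ys _; rewrite lee_fin; exact: (Tstat_bound k eta0 mest estb).
rewrite (ge0_integral_iid_tnth (rho t) i (f := fun y => (bst t y)%:E)); first last.
- by move=> y; rewrite lee_fin.
- by apply/measurable_EFinP; exact: measurable_bstat.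
by apply: integrable_lty => //; exact: (integrable_bstat eta0 estb t).
Qed.

(** The i-th sample is redrawn as [y]; for each remaining tuple [ys] the bound of [resampled_step]
    applies. *)
Lemma Tstat_upper t i beta : 0 < beta ->
  (\int[iid (rho t) n]_ys (Tst t ys (tnth ys i))%:E <=
   \int[iid (rho t) n]_ys
     ((e - 1) * (3 / beta * rer t ys + 3 * beta) + 24 * delta * eta * (q * p)%:R)%:E)%E.
Proof.
move=> beta0; rewrite (iid_resample i (integrable_Tstat t i)).
under eq_integral do under eq_integral do rewrite tnth_tset eqxx.
pose h (w : n.-tuple Y * Y) := (Tst t (tset i w.1 w.2) w.2)%:E : \bar R.
have ih : (iid (rho t) n \x rho t)%E.-integrable setT h.
  apply/integrable12ltyP; first by apply/measurable_EFinP; exact: mTset.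
  have ibl : (\int[rho t]_y (bst t y)%:E < +oo)%E.
    by apply: integrable_lty => //; exact: (integrable_bstat eta0 estb t).
  apply: le_lt_trans ibl; rewrite -[leRHS](integral_probability_cst (iid (rho t) n)).
  apply: ge0_le_integral => //.
  - by move=> ys _; exact: integral_ge0.
  - apply: (measurable_fun_fubini_tonelli_F (fun w => `|h w|%E)) => //.
    by apply: measurableT_comp => //; apply/measurable_EFinP; exact: mTset.
  move=> ys _; apply: ge0_le_integral => //.
  - apply: measurableT_comp => //; apply/measurable_EFinP.
    exact: (measurableT_comp (mTset t i) (measurable_pair1 ys)).
  - by apply/measurable_EFinP; exact: measurable_bstat.
  - by move=> y _; rewrite lee_fin; exact: (Tstat_bound k eta0 mest estb).
apply: (le_integral measurableT); first exact: (integrable_fubini_F ih).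
  have ir := integrable_rerr t (iid (rho t) n).
  apply: (eq_integrable measurableT (fun ys => ((e - 1) * (3 / beta))%:E * (rer t ys)%:E +
      ((e - 1) * (3 * beta) + 24 * delta * eta * (q * p)%:R)%:E)%E).
    by move=> ys _; rewrite -EFinM -EFinD; congr (_%:E); ring.
  by apply: integrableD => //; [exact: integrableZl|exact: integrable_cst_probability].
by move=> ys _; exact: resampled_step.
Qed.

End upper.

(** * The score identity under the uniform prior *)

Section uniform_zero.
Context (R : realType) (eta : R).
Hypothesis eta0 : 0 < eta.
Local Notation MR := (measurableTypeR R).

Lemma itv_gt : - eta < eta. Proof. by rewrite gtrN. Qed.

Lemma integral_uniform_zero (g h : MR -> R) : measurable_fun setT g ->
  (forall x, `|x| <= eta -> g x = h x) ->
  lebesgue_measure.-integrable `[- eta, eta] (fun x => (h x)%:E) ->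
  (\int[lebesgue_measure]_(x in `[(- eta)%R, eta]) (h x)%:E = 0)%E ->
  (\int[uniform_prob itv_gt]_x (g x)%:E = 0)%E.
Proof.
move=> mg gh ih h0.
have xeta x : `[- eta, eta]%classic x -> `|x| <= eta by rewrite /= in_itv /= ler_norml.
have ig : lebesgue_measure.-integrable `[- eta, eta] (fun x : MR => (g x)%:E).
  apply: (eq_integrable _ (fun x => (h x)%:E)) => // x; rewrite inE => /xeta xe.
  by rewrite gh.
have g0 : (\int[lebesgue_measure]_(x in `[(- eta)%R, eta]) (g x)%:E = 0)%E.
  by rewrite -h0; apply: eq_integral => x; rewrite inE => /xeta xe; rewrite gh.
have mgE : measurable_fun setT (fun x : MR => (g x)%:E) by exact/measurable_EFinP.
rewrite integralE in g0; rewrite integralE.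
rewrite (@integral_uniform _ _ _ itv_gt (fun x : MR => (g x)%:E)^\+%E) //; last exact: measurable_funepos.
rewrite (@integral_uniform _ _ _ itv_gt (fun x : MR => (g x)%:E)^\-%E) //; last exact: measurable_funeneg.
have mI : measurable (`[- eta, eta]%classic : set MR) by exact: measurable_itv.
have fp := integrable_pos_fin_num mI ig.
have fn := integrable_neg_fin_num mI ig.
move: g0; rewrite -(fineK fp) -(fineK fn) -!EFinM -!EFinB => -[g0].
by congr (_%:E); rewrite -mulrBr g0 mulr0.
Qed.

(** With m = l0 = s0 = u = 0 the integrand of the integration by parts reduces to 2 - 3 om, so its
    vanishing integral gives the mean of the window. *)
Lemma integral_uniform_om : (\int[uniform_prob itv_gt]_x (om eta x)%:E = (2 / 3)%:E)%E.
Proof.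
have mom := measurable_om eta.
have z : (\int[uniform_prob itv_gt]_x (2 - 3 * om eta x)%:E = 0)%E.
  apply: (integral_uniform_zero _ _ (@ibp_integrable R eta 0 0 0 0 eta0) (@ibp_zero R eta 0 0 0 0 eta0)).
    by apply: measurable_funB => //; apply: measurable_funM.
  move=> x xe; rewrite /om indic_itvE xe !(mul0r, mulr0, addr0, sub0r, oppr0) expR0; field.
  by rewrite gt_eqF.
have iom : (uniform_prob itv_gt).-integrable setT (fun x : MR => (om eta x)%:E).
  apply: (@bounded_integrable _ _ _ _ (om eta : MR -> R) 1) => // x.
  by have /andP[w0 w1] := om_bounds eta0 x; rewrite ger0_norm.
have i3 := integrableZl measurableT (- 3) iom.
have : (\int[uniform_prob itv_gt]_x (2%:E + (- 3)%:E * (om eta x)%:E) = 0)%E.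
  by rewrite -[RHS]z; apply: eq_integral => x _; rewrite -EFinM -EFinD; congr (_%:E); ring.
rewrite (integralD measurableT (integrable_cst_probability _ 2) i3) integral_probability_cst.
rewrite (integralZl measurableT iom) integral_Rintegral // -EFinM -EFinD => -[h].
by congr (_%:E); lra.
Qed.

End uniform_zero.

Section lower.
Context (R : realType) (p q n : nat) dZ (Z : measurableType dZ).
Local Notation MR := (measurableTypeR R).
Local Notation Y := (p.-tuple MR * q.-tuple MR)%type.
Local Notation Th := ((q * p)%N.-tuple MR).
Variables (k : n.-tuple Y -> probability Z R) (est : Z -> 'I_q -> 'I_p -> R).
Variables (eta : R).
Hypothesis eta0 : 0 < eta.
Hypothesis mk : forall g : Z -> \bar R, measurable_fun setT g -> (forall z, (0 <= g z)%E) ->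
  measurable_fun setT (fun ys => \int[k ys]_z g z)%E.
Hypothesis mest : forall a b, measurable_fun setT (fun z => est z a b : MR).
Hypothesis estb : forall z a b, `|est z a b| <= eta.

Definition Lam (t : Th) (ys : n.-tuple Y) : R := \sum_(i < n) ell t (tnth ys i).

Lemma measurable_Lam dT (T : measurableType dT) (ft : T -> Th) (fy : T -> n.-tuple Y) :
  measurable_fun setT ft -> measurable_fun setT fy ->
  measurable_fun setT (fun x => Lam (ft x) (fy x) : MR).
Proof.
move=> mt my; apply: measurable_sum => i; apply: measurable_ell => //.
exact: measurable_fun_tnth.
Qed.

Lemma ge0_integral_iid_rho t (F : n.-tuple Y -> \bar R) :
  measurable_fun setT F -> (forall ys, (0 <= F ys)%E) ->
  (\int[iid (rho t) n]_ys F ys = \int[iid (@gY R p q) n]_ys (F ys * (expR (Lam t ys))%:E))%E.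
Proof.
move=> mF F0.
have ml : measurable_fun setT (ell t : Y -> R) by exact: (@measurable_ell _ _ _ _ _ (cst t) id).
apply: (etrans (@ge0_integral_iid_density _ _ _ _ _ (rho t) (@gY R p q) id (ell t)
  (@measurable_id _ _ setT) ml (fun f mf f0 => rho_density t mf f0) n F mF F0)).
by apply: eq_integral => ys _; congr (F _ * _)%E; apply: val_inj; exact: map_id.
Qed.

Lemma integral_iid_rho t (G : n.-tuple Y -> R) : measurable_fun setT G ->
  (\int[iid (rho t) n]_ys (G ys)%:E = \int[iid (@gY R p q) n]_ys (G ys * expR (Lam t ys))%:E)%E.
Proof.
move=> mG; have mGE : measurable_fun setT (fun ys => (G ys)%:E) by exact/measurable_EFinP.
rewrite integralE [RHS]integralE; congr (_ - _)%E.
  rewrite ge0_integral_iid_rho //; last exact: measurable_funepos.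
  apply: eq_integral => ys _; rewrite !funeposE EFinM.
  by rewrite -!EFinM -!EFin_max -EFinM maxr_pMl ?expR_ge0 // mul0r.
rewrite ge0_integral_iid_rho //; last exact: measurable_funeneg.
apply: eq_integral => ys _; rewrite !funenegE EFinM.
by rewrite -!EFinM -!EFinN -!EFin_max -EFinM maxr_pMl ?expR_ge0 // mul0r mulNr.
Qed.

(** A logarithmic derivative in the entry (a, b): the three terms come from the likelihood, from
    [mu - th], and from the window. [mu] depends on the data only and counts as a constant. *)
Definition Delta a b (t : Th) ys : R :=
  om eta (th t a b) * (mu k est a b ys - th t a b) * (\sum_(i < n) score t (tnth ys i) a b)
  - om eta (th t a b) + dom eta (th t a b) * (mu k est a b ys - th t a b).

Lemma measurable_Delta a b dT (T : measurableType dT) (ft : T -> Th) (fx : T -> n.-tuple Y) :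
  measurable_fun setT ft -> measurable_fun setT fx ->
  measurable_fun setT (fun x => Delta a b (ft x) (fx x) : MR).
Proof.
move=> mt mx.
have mth : measurable_fun setT (fun x => th (ft x) a b : MR) by exact: measurable_fun_tnth.
have mo : measurable_fun setT (fun x => om eta (th (ft x) a b) : MR).
  exact: (measurableT_comp (measurable_om eta) mth).
have md : measurable_fun setT (fun x => dom eta (th (ft x) a b) : MR).
  exact: (measurableT_comp (measurable_dom eta) mth).
have mm : measurable_fun setT (fun x => mu k est a b (fx x) - th (ft x) a b : MR).
  by apply: measurable_funB => //; exact: (measurableT_comp (measurable_mu mk mest estb a b) mx).
apply: measurable_funD; last exact: measurable_funM.
apply: measurable_funB => //; apply: measurable_funM; first exact: measurable_funM.
apply: measurable_sum => i; apply: measurable_score => //; exact: measurable_fun_tnth.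
Qed.

Lemma Delta_abs_bound a b t :
  (\int[iid (@gY R p q) n]_ys `|(Delta a b t ys * expR (Lam t ys))%:E| <= (12 * eta * n%:R + 5)%:E)%E.
Proof.
have e0 := eta0.
have mD : measurable_fun setT (fun ys => Delta a b t ys : MR) by exact: (@measurable_Delta a b _ _ (cst t) id).
have mA : measurable_fun setT (fun ys => `|Delta a b t ys|%:E) by apply/measurable_EFinP; exact: measurableT_comp.
have -> : (\int[iid (@gY R p q) n]_ys `|(Delta a b t ys * expR (Lam t ys))%:E| =
   \int[iid (rho t) n]_ys `|Delta a b t ys|%:E)%E.
  rewrite ge0_integral_iid_rho //.
  by apply: eq_integral => ys _; rewrite -EFinM abse_EFin normrM (ger0_norm (expR_ge0 _)).
have msi i : measurable_fun setT (fun ys : n.-tuple Y => `|score t (tnth ys i) a b|%:E).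
  apply/measurable_EFinP; apply: measurableT_comp => //.
  by apply: (@measurable_score _ _ _ _ _ (cst t) (fun ys => tnth ys i)) => //; exact: measurable_fun_tnth.
have s0 i (ys : n.-tuple Y) : (0 <= `|score t (tnth ys i) a b|%:E)%E by rewrite lee_fin.
(* The factor in front of the scores is at most 2 eta, and each score has mean absolute value at
   most 6. The 5 is 1 for [om] plus 4 for the term with [dom]. *)
apply: (@le_trans _ _ (\int[iid (rho t) n]_ys ((2 * eta)%:E * (\sum_(i < n) `|score t (tnth ys i) a b|%:E) + 5%:E))%E).
  apply: ge0_le_integral => //.
  - by apply: emeasurable_funD => //; apply: measurable_funeM; exact: emeasurable_sum.
  move=> ys _; rewrite sumEFin -EFinM -EFinD lee_fin /Delta.
  have mb := mu_bound k mest estb a b ys.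
  have h1 := om_mul_bound eta0 (th t a b) mb.
  have h2 := dom_mul_bound eta0 (th t a b) mb.
  have /andP[w0 w1] := om_bounds eta0 (th t a b).
  have h3 : `|om eta (th t a b) * (mu k est a b ys - th t a b) * (\sum_(i < n) score t (tnth ys i) a b)|
      <= 2 * eta * \sum_(i < n) `|score t (tnth ys i) a b|.
    by rewrite normrM; apply: ler_pM => //; exact: ler_norm_sum.
  apply: le_trans (ler_normD _ _) _; have := ler_normB (om eta (th t a b) * (mu k est a b ys - th t a b) * (\sum_(i < n) score t (tnth ys i) a b)) (om eta (th t a b)).
  rewrite (ger0_norm w0); lra.
rewrite ge0_integralD //; first last.
- by apply: measurable_funeM; exact: emeasurable_sum.
- move=> ys _; rewrite mule_ge0 //; first by rewrite lee_fin mulr_ge0 // ltW.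
  by apply: sume_ge0.
rewrite integral_probability_cst ge0_integralZl; first last.
- by rewrite lee_fin mulr_ge0 // ltW.
- by move=> ys _; apply: sume_ge0.
- exact: emeasurable_sum.
- exact: measurableT.
rewrite ge0_integral_sum // [in leRHS]EFinD; apply: leeD => //.
have -> : 12 * eta * n%:R = (2 * eta) * (\sum_(i < n) 6) by rewrite sumr_const card_ord -mulr_natr; ring.
rewrite [in leRHS]EFinM; apply: lee_wpmul2l; first by rewrite lee_fin mulr_ge0 // ltW.
rewrite -sumEFin; apply: lee_sum => i _.
rewrite (ge0_integral_iid_tnth (rho t) i (f := fun y => `|score t y a b|%:E)); first exact: rho_abs_score.
  by apply/measurable_EFinP; apply: measurableT_comp => //; exact: (@measurable_score _ _ _ _ _ (cst t) id).
by move=> y; rewrite lee_fin.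
Qed.

Lemma th_tset a b (t : Th) (x : MR) a' b' :
  th (tset (mxvec_index a b) t x) a' b' =
  if (a' == a) && (b' == b) then x else th t a' b'.
Proof.
rewrite /th tnth_tset; congr (if _ then _ else _).
apply/idP/idP => [/eqP/cast_ord_inj/enum_rank_inj [-> ->]|/andP[/eqP -> /eqP ->]//].
by rewrite !eqxx.
Qed.

Lemma reg_tset a b (t : Th) (x : MR) u a' :
  reg (tset (mxvec_index a b) t x) u a' =
  reg (tset (mxvec_index a b) t 0) u a' + (if a' == a then x * tnth u b else 0).
Proof.
rewrite /reg (bigD1 b) //= [in RHS](bigD1 b) //= !th_tset eqxx andbT.
have -> : \sum_(i < p | i != b) th (tset (mxvec_index a b) t x) a' i * tnth u i =
   \sum_(i < p | i != b) th (tset (mxvec_index a b) t 0) a' i * tnth u i.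
  by apply: eq_bigr => i ib; rewrite !th_tset (negbTE ib) andbF.
by case: (a' == a); rewrite ?mul0r ?add0r ?addr0 // addrC.
Qed.

(** The log-likelihood is exactly quadratic in each entry of B, the form assumed for the integration
    by parts; its coefficients depend on the data and on the other entries. *)
Lemma ell_tset a b (t : Th) (x : MR) (y : Y) :
  ell (tset (mxvec_index a b) t x) y =
  ell (tset (mxvec_index a b) t 0) y + score (tset (mxvec_index a b) t 0) y a b * x
  - tnth y.1 b ^+ 2 * x ^+ 2 / 2.
Proof.
rewrite /ell (bigD1 a) //= [in RHS](bigD1 a) //=.
have -> : \sum_(i < q | i != a) (tnth y.2 i * reg (tset (mxvec_index a b) t x) y.1 i -
      reg (tset (mxvec_index a b) t x) y.1 i ^+ 2 / 2) =
    \sum_(i < q | i != a) (tnth y.2 i * reg (tset (mxvec_index a b) t 0) y.1 i -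
      reg (tset (mxvec_index a b) t 0) y.1 i ^+ 2 / 2).
  by apply: eq_bigr => i ia; rewrite reg_tset (negbTE ia) addr0.
by rewrite reg_tset eqxx /score; field.
Qed.

Lemma score_tset a b (t : Th) (x : MR) (y : Y) :
  score (tset (mxvec_index a b) t x) y a b =
  score (tset (mxvec_index a b) t 0) y a b - tnth y.1 b ^+ 2 * x.
Proof. by rewrite /score reg_tset eqxx; ring. Qed.

Let mDL a b : measurable_fun setT
  (fun w : Th * n.-tuple Y => (Delta a b w.1 w.2 * expR (Lam w.1 w.2))%:E).
Proof.
apply/measurable_EFinP; apply: measurable_funM; first exact: measurable_Delta.
by apply: measurableT_comp => //; exact: measurable_Lam.
Qed.

(* For fixed data, Delta * exp Lam is the derivative in the (a, b) entry of
   om (th) * (mu - th) * exp Lam, which vanishes at both ends of the window. *)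
Lemma Delta_fiber_zero a b (t : Th) ys :
  (\int[uniform_prob (itv_gt eta0)]_x
    (Delta a b (tset (mxvec_index a b) t x) ys * expR (Lam (tset (mxvec_index a b) t x) ys))%:E = 0)%E.
Proof.
pose t0 := tset (mxvec_index a b) t 0.
pose s0 := \sum_(i < n) score t0 (tnth ys i) a b.
pose uu := \sum_(i < n) tnth (tnth ys i).1 b ^+ 2.
apply: (integral_uniform_zero eta0 _ _ (@ibp_integrable R eta (mu k est a b ys) (Lam t0 ys) s0 uu eta0) (@ibp_zero R eta (mu k est a b ys) (Lam t0 ys) s0 uu eta0)).
  apply/measurable_EFinP.
  have mpair : measurable_fun setT (fun x : MR => (tset (mxvec_index a b) t x, ys)).
    by apply/measurable_fun_pairP; split; [exact: measurable_tsetr|exact: measurable_cst].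
  exact: (measurableT_comp (mDL a b) mpair).
move=> x xe.
have -> : Lam (tset (mxvec_index a b) t x) ys = Lam t0 ys + s0 * x - uu * x ^+ 2 / 2.
  rewrite /Lam /s0 /uu !mulr_suml -big_split /= -sumrB; apply: eq_bigr => i _.
  by rewrite ell_tset.
have sE : \sum_(i < n) score (tset (mxvec_index a b) t x) (tnth ys i) a b = s0 - uu * x.
  by rewrite /s0 /uu mulr_suml -sumrB; apply: eq_bigr => i _; rewrite score_tset.
congr (_ * _); rewrite /Delta sE th_tset !eqxx /= /om /dom indic_itvE xe !mul1r.
by [].
Qed.

Definition prior : probability Th R := iid (uniform_prob (itv_gt eta0)) (q * p)%N.

Lemma Delta_integrable a b (Q : probability Th R) :
  (Q \x iid (@gY R p q) n)%E.-integrable setT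
    (fun w : Th * n.-tuple Y => (Delta a b w.1 w.2 * expR (Lam w.1 w.2))%:E).
Proof.
apply/integrable12ltyP; first exact: mDL.
apply: (@le_lt_trans _ _ (12 * eta * n%:R + 5)%:E); last exact: ltry.
rewrite -[leRHS](integral_probability_cst Q); apply: ge0_le_integral => //.
- by move=> t _; exact: integral_ge0.
- apply: (measurable_fun_fubini_tonelli_F (fun w : Th * n.-tuple Y => `|(Delta a b w.1 w.2 * expR (Lam w.1 w.2))%:E|%E)) => //.
  by apply: measurableT_comp => //; exact: mDL.
- by move=> t _; exact: Delta_abs_bound.
Qed.

(** One entry of B is redrawn from its uniform law and then integrated innermost, with the data and
    the other entries fixed, where [Delta_fiber_zero] applies. The exchange rests on [gY] being free
    of B and on the bound [Delta_abs_bound], uniform in [t]. *)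
Lemma Delta_zero a b :
  (\int[prior]_t \int[iid (@gY R p q) n]_ys (Delta a b t ys * expR (Lam t ys))%:E = 0)%E.
Proof.
have ih := integrable_fubini_F (Delta_integrable a b prior).
rewrite (iid_resample (mxvec_index a b) ih).
rewrite -[RHS](integral_probability_cst prior); apply: eq_integral => t _.
pose F (w : MR * n.-tuple Y) := (Delta a b (tset (mxvec_index a b) t w.1) w.2 *
   expR (Lam (tset (mxvec_index a b) t w.1) w.2))%:E : \bar R.
have mF : measurable_fun setT F.
  have mpair : measurable_fun setT (fun w : MR * n.-tuple Y => (tset (mxvec_index a b) t w.1, w.2)).
    apply/measurable_fun_pairP; split; last exact: measurable_snd.
    exact: (measurableT_comp (measurable_tsetr (mxvec_index a b) t) measurable_fst).
  exact: (measurableT_comp (mDL a b) mpair).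
have iF : (uniform_prob (itv_gt eta0) \x iid (@gY R p q) n)%E.-integrable setT F.
  apply/integrable12ltyP => //.
  apply: (@le_lt_trans _ _ (12 * eta * n%:R + 5)%:E); last exact: ltry.
  rewrite -[leRHS](integral_probability_cst (uniform_prob (itv_gt eta0))); apply: ge0_le_integral => //.
  - by move=> x _; exact: integral_ge0.
  - apply: (measurable_fun_fubini_tonelli_F (fun w => `|F w|%E)) => //.
    exact: measurableT_comp.
  - by move=> x _; exact: (Delta_abs_bound a b (tset (mxvec_index a b) t x)).
apply: (etrans (Fubini iF)).
rewrite -[RHS](integral_probability_cst (iid (@gY R p q) n)); apply: eq_integral => ys _.
exact: (Delta_fiber_zero a b t ys).
Qed.

End lower.

Section fingerprint.
Context (R : realType) (p q n : nat) dZ (Z : measurableType dZ).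
Local Notation MR := (measurableTypeR R).
Local Notation Y := (p.-tuple MR * q.-tuple MR)%type.
Local Notation Th := ((q * p)%N.-tuple MR).
Variables (k : n.-tuple Y -> probability Z R) (est : Z -> 'I_q -> 'I_p -> R).
Variables (eta e delta : R).
Hypothesis eta0 : 0 < eta.
Hypothesis mk : forall g : Z -> \bar R, measurable_fun setT g -> (forall z, (0 <= g z)%E) ->
  measurable_fun setT (fun ys => \int[k ys]_z g z)%E.
Hypothesis mest : forall a b, measurable_fun setT (fun z => est z a b : MR).
Hypothesis estb : forall z a b, `|est z a b| <= eta.
Hypotheses (e1 : 1 <= e) (delta0 : 0 <= delta).
Hypothesis dp : forall ys i y A, measurable A ->
  (k (tset i ys y) A <= e%:E * k ys A + delta%:E)%E /\
  (k ys A <= e%:E * k (tset i ys y) A + delta%:E)%E.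

Local Notation rer := (rerr k est).
Local Notation Del := (Delta k est eta).
Local Notation gn := (iid (@gY R p q) n).

Lemma measurable_rerr dT (T : measurableType dT) (ft : T -> Th) (fx : T -> n.-tuple Y) :
  measurable_fun setT ft -> measurable_fun setT fx ->
  measurable_fun setT (fun x => rer (ft x) (fx x) : MR).
Proof.
move=> mt mx; apply: measurable_sum => a; apply: measurable_sum => b.
have mth : measurable_fun setT (fun x => th (ft x) a b : MR) by exact: measurable_fun_tnth.
have mm := measurableT_comp (measurable_mu mk mest estb a b) mx.
have mm2 := measurableT_comp (measurable_m2 mk mest a b) mx.
apply: measurable_funD; last exact: measurable_funX.
apply: measurable_funB => //; apply: measurable_funM => //; exact: measurable_funM.
Qed.

Definition Err (t : Th) : \bar R := (\int[gn]_ys (rer t ys * expR (Lam t ys))%:E)%E.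

Lemma measurable_Err : measurable_fun setT Err.
Proof.
apply: (measurable_fun_fubini_tonelli_F (fun w : Th * n.-tuple Y => (rer w.1 w.2 * expR (Lam w.1 w.2))%:E)).
  apply/measurable_EFinP; apply: measurable_funM; first exact: measurable_rerr.
  by apply: measurableT_comp => //; exact: measurable_Lam.
by move=> w; rewrite lee_fin mulr_ge0 ?expR_ge0 //; exact: (rerr_ge0 k eta0 mest estb).
Qed.

Lemma Err_ge0 t : (0 <= Err t)%E.
Proof.
by apply: integral_ge0 => ys _; rewrite lee_fin mulr_ge0 ?expR_ge0 //; exact: (rerr_ge0 k eta0 mest estb).
Qed.

Let mrer t : measurable_fun setT (rer t : _ -> MR).
Proof. exact: (@measurable_rerr _ _ (cst t) id). Qed.

Let mDel a b t : measurable_fun setT (Del a b t : _ -> MR).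
Proof. exact: (@measurable_Delta _ _ _ _ _ _ _ _ _ mk mest estb a b _ _ (cst t) id). Qed.

Let iDel a b t : (iid (rho t) n).-integrable setT (fun ys => (Del a b t ys)%:E).
Proof.
apply/integrableP; split; first by apply/measurable_EFinP; exact: mDel.
apply: le_lt_trans (ltry (12 * eta * n%:R + 5)).
apply: le_trans (Delta_abs_bound eta0 mk mest estb a b t).
have mA : measurable_fun setT (fun ys => `|(Del a b t ys)%:E|%E).
  by apply: measurableT_comp => //; apply/measurable_EFinP; exact: mDel.
rewrite (ge0_integral_iid_rho t mA) // le_eqVlt; apply/orP; left; apply/eqP.
by apply: eq_integral => ys _; rewrite !abse_EFin -EFinM normrM (ger0_norm (expR_ge0 _)).
Qed.

Let S (t : Th) : R := \sum_a \sum_b om eta (th t a b).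

(** The term with [dom] has no sign: AM-GM turns it into 1/6 per entry plus the squared error of the
    mean estimate, which Jensen bounds by [rerr]. *)
Lemma sum_Delta_le t ys :
  \sum_a \sum_b Del a b t ys <=
  \sum_(i < n) Tstat k est eta t ys (tnth ys i) + ((q * p)%:R / 6 - S t) + 6 / eta ^+ 2 * rer t ys.
Proof.
have -> : \sum_(i < n) Tstat k est eta t ys (tnth ys i) = \sum_a \sum_b om eta (th t a b) * (mu k est a b ys - th t a b) * (\sum_(i < n) score t (tnth ys i) a b).
  rewrite exchange_big /=; apply: eq_bigr => a _; rewrite exchange_big /=.
  by apply: eq_bigr => b _; rewrite mulr_sumr.
have -> : (q * p)%:R / 6 = \sum_(a < q) \sum_(b < p) (1 / 6) :> R.
  under eq_bigr do rewrite sumr_const card_ord.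
  by rewrite sumr_const card_ord -mulrnA mulnC -[RHS]mulr_natr mul1r mulrC.
rewrite /S -sumrB mulr_sumr -!big_split /=; apply: ler_sum => a _.
rewrite -sumrB mulr_sumr -!big_split /=; apply: ler_sum => b _.
rewrite /Delta; have h1 := dom_amgm eta0 (mu k est a b ys) (th t a b).
have h2 := mu_jensen k eta0 mest estb a b ys (th t a b).
have h3 : 0 <= 6 / eta ^+ 2 by rewrite divr_ge0 // sqr_ge0.
have h4 := ler_wpM2l h3 h2; lra.
Qed.

Lemma integral_Delta_le t beta : 0 < beta ->
  (\sum_a \sum_b \int[gn]_ys (Del a b t ys * expR (Lam t ys))%:E <=
   (n%:R * (3 * (e - 1) * beta + 24 * delta * eta * (q * p)%:R) + (q * p)%:R / 6 - S t)%:E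
   + (n%:R * (3 * (e - 1) / beta) + 6 / eta ^+ 2)%:E * Err t)%E.
Proof.
move=> beta0.
pose Q := iid (rho t) n.
have ir := integrable_rerr eta0 mk mest estb t Q.
pose r : R := (\int[Q]_ys rer t ys)%R.
have rE : (\int[Q]_ys (rer t ys)%:E = r%:E)%E by exact: integral_Rintegral.
have ErrE : Err t = r%:E by rewrite -rE /Q (integral_iid_rho t (mrer t)).
rewrite ErrE.
have -> : (\sum_a \sum_b \int[gn]_ys (Del a b t ys * expR (Lam t ys))%:E =
    \int[Q]_ys (\sum_a \sum_b Del a b t ys)%:E)%E.
  under [in RHS]eq_integral do rewrite -sumEFin.
  rewrite integral_sum //; last first.
    by move=> a; under eq_fun do rewrite -sumEFin; apply: integrable_sum => // b _; exact: iDel.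
  apply: eq_bigr => a _; under [in RHS]eq_integral do rewrite -sumEFin.
  rewrite integral_sum //; last by move=> b; exact: iDel.
  by apply: eq_bigr => b _; rewrite /Q (integral_iid_rho t (mDel a b t)).
pose c := (q * p)%:R / 6 - S t.
have iT i := integrable_Tstat eta0 mk mest estb t i.
have iT' : Q.-integrable setT (fun ys => \sum_(i < n) (Tstat k est eta t ys (tnth ys i))%:E)%E.
  by apply: integrable_sum => // i _; exact: iT.
have i2 := integrable_cst_probability Q c.
have i3 := integrableZl measurableT (6 / eta ^+ 2) ir.
have iS : Q.-integrable setT (fun ys => (\sum_a \sum_b Del a b t ys)%:E).
  under eq_fun do rewrite -sumEFin; apply: integrable_sum => // a _.
  by under eq_fun do rewrite -sumEFin; apply: integrable_sum => // b _; exact: iDel.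
apply: (@le_trans _ _ (\int[Q]_ys (\sum_(i < n) (Tstat k est eta t ys (tnth ys i))%:E + (c%:E + (6 / eta ^+ 2)%:E * (rer t ys)%:E)))%E).
  apply: (le_integral measurableT iS).
    exact: (integrableD measurableT iT' (integrableD measurableT i2 i3)).
  by move=> ys _; rewrite sumEFin -EFinM -!EFinD lee_fin addrA; exact: sum_Delta_le.
rewrite (integralD measurableT iT' (integrableD measurableT i2 i3)).
rewrite (integralD measurableT i2 i3) integral_probability_cst (integralZl measurableT ir) rE.
rewrite (integral_sum measurableT iT).
pose c2 := (e - 1) * (3 / beta * r + 3 * beta) + 24 * delta * eta * (q * p)%:R.
have Tb i : (\int[Q]_ys (Tstat k est eta t ys (tnth ys i))%:E <= c2%:E)%E.
  apply: le_trans (Tstat_upper eta0 mk mest estb e1 delta0 dp t i beta0) _.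
  rewrite le_eqVlt; apply/orP; left; apply/eqP.
  transitivity (\int[Q]_ys (((e - 1) * (3 / beta))%:E * (rer t ys)%:E +
      ((e - 1) * (3 * beta) + 24 * delta * eta * (q * p)%:R)%:E))%E.
    by apply: eq_integral => ys _; rewrite -EFinM -EFinD; congr (_%:E); ring.
  rewrite (integralD measurableT (integrableZl measurableT _ ir) (integrable_cst_probability Q _)).
  rewrite (integralZl measurableT ir) rE integral_probability_cst -EFinM -EFinD.
  by congr (_%:E); rewrite /c2; ring.
apply: (@le_trans _ _ ((\sum_(i < n) c2%:E) + (c%:E + (6 / eta ^+ 2)%:E * r%:E))%E).
  by apply: leeD => //; apply: lee_sum => i _; exact: Tb.
rewrite sumEFin sumr_const card_ord -!EFinM -!EFinD lee_fin /c2 /c -[X in X + _ <= _]mulr_natl.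
by rewrite le_eqVlt; apply/orP; left; apply/eqP; field; rewrite !gt_eqF.
Qed.

Lemma prior_om a b : (\int[prior p q eta0]_t (om eta (th t a b))%:E = (2 / 3)%:E)%E.
Proof.
rewrite -(integral_uniform_om eta0).
rewrite (ge0_integral_iid_tnth (uniform_prob (itv_gt eta0)) (mxvec_index a b) (f := fun x : MR => (om eta x)%:E)) //.
- by apply/measurable_EFinP; exact: measurable_om.
- by move=> x; rewrite lee_fin; have /andP[] := om_bounds eta0 x.
Qed.

(** Averaged over the prior, the sum of the [Delta] vanishes. The window has mean 2/3 and AM-GM
    costs 1/6 per entry, which leaves q p / 2. As the error is at most beta^2, its coefficient 3 (e
    - 1) / beta combines with 3 (e - 1) beta into 6 (e - 1) beta. *)
Lemma fingerprint beta : 0 < beta ->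
  (\int[prior p q eta0]_t Err t <= (beta ^+ 2)%:E)%E ->
  (q * p)%:R / 2 - 6 / eta ^+ 2 * beta ^+ 2 <=
  n%:R * (6 * (e - 1) * beta + 24 * delta * eta * (q * p)%:R).
Proof.
move=> beta0 hErr; pose P := prior p q eta0.
pose D (t : Th) : \bar R := (\sum_a \sum_b \int[gn]_ys (Del a b t ys * expR (Lam t ys))%:E)%E.
have iD1 a b : P.-integrable setT (fun t => \int[gn]_ys (Del a b t ys * expR (Lam t ys))%:E)%E.
  exact: (integrable_fubini_F (Delta_integrable eta0 mk mest estb a b P)).
have D0 : (\int[P]_t D t = 0)%E.
  rewrite /D integral_sum //; last by move=> a; apply: integrable_sum => // b _; exact: iD1.
  rewrite big1 // => a _; rewrite integral_sum // big1 // => b _.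
  exact: (Delta_zero eta0 mk mest estb).
have iD : P.-integrable setT D.
  by apply: integrable_sum => // a _; apply: integrable_sum => // b _; exact: iD1.
have iErr : P.-integrable setT Err.
  apply/integrableP; split; first exact: measurable_Err.
  apply: le_lt_trans (ltry (beta ^+ 2)); apply: le_trans hErr.
  rewrite le_eqVlt; apply/orP; left; apply/eqP; apply: eq_integral => t _.
  by rewrite gee0_abs //; exact: Err_ge0.
pose c0 := n%:R * (3 * (e - 1) * beta + 24 * delta * eta * (q * p)%:R) + (q * p)%:R / 6.
pose c1 := n%:R * (3 * (e - 1) / beta) + 6 / eta ^+ 2.
have c10 : 0 <= c1.
  apply: addr_ge0; last by rewrite divr_ge0 // sqr_ge0.
  apply: mulr_ge0 => //; apply: divr_ge0; last exact: ltW.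
  by apply: mulr_ge0 => //; rewrite subr_ge0.
have iom a b : P.-integrable setT (fun t => (om eta (th t a b))%:E).
  apply: (@bounded_integrable _ _ _ P (fun t : Th => om eta (th t a b)) 1).
    by apply: (measurableT_comp (measurable_om eta)); exact: measurable_fun_tnth.
  by move=> t; have /andP[w0 w1] := om_bounds eta0 (th t a b); rewrite ger0_norm.
have iS : P.-integrable setT (fun t => \sum_a \sum_b (om eta (th t a b))%:E)%E.
  by apply: integrable_sum => // a _; apply: integrable_sum => // b _; exact: iom.
have SE : (\int[P]_t (\sum_a \sum_b (om eta (th t a b))%:E) = ((q * p)%:R * (2 / 3))%:E)%E.
  rewrite integral_sum //; last by move=> a; apply: integrable_sum => // b _; exact: iom.
  transitivity (\sum_(a < q) ((2 / 3 : R) *+ p)%:E)%E.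
    apply: eq_bigr => a _; rewrite integral_sum //.
    under eq_bigr do rewrite prior_om.
    by rewrite sumEFin sumr_const card_ord.
  rewrite (sumEFin (index_enum _) xpredT (fun=> (2 / 3 : R) *+ p)) sumr_const card_ord.
  by congr (_%:E); rewrite -mulrnA [RHS]mulr_natl mulnC.
have iS' := integrableZl measurableT (- 1) iS.
have iE' := integrableZl measurableT c1 iErr.
have ic := integrable_cst_probability P c0.
have : (0 <= \int[P]_t (c0%:E + ((- 1)%:E * (\sum_a \sum_b (om eta (th t a b))%:E) + c1%:E * Err t)))%E.
  apply: (@le_trans _ _ (\int[P]_t D t)%E); first by rewrite D0.
  apply: (le_integral measurableT iD).
    exact: (integrableD measurableT ic (integrableD measurableT iS' iE')).
  move=> t _; apply: le_trans (integral_Delta_le t beta0) _.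
  rewrite addeA; apply: leeD => //.
  under [in leRHS]eq_bigr do rewrite sumEFin.
  by rewrite sumEFin -EFinM -EFinD lee_fin mulN1r.
rewrite (integralD measurableT ic (integrableD measurableT iS' iE')).
rewrite (integralD measurableT iS' iE') integral_probability_cst.
rewrite (integralZl measurableT iS) SE (integralZl measurableT iErr).
have hc : (c1%:E * \int[P]_t Err t <= (c1 * beta ^+ 2)%:E)%E.
  by rewrite EFinM; apply: lee_wpmul2l => //; rewrite lee_fin.
move=> /le_trans /(_ (leeD (lexx _) (leeD (lexx _) hc))).
rewrite -EFinM -!EFinD lee_fin /c0 /c1.
have -> : (n%:R * (3 * (e - 1) / beta) + 6 / eta ^+ 2) * beta ^+ 2 =
   n%:R * (3 * (e - 1) * beta) + 6 / eta ^+ 2 * beta ^+ 2 by field; rewrite !gt_eqF.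
by move=> h; lra.
Qed.

End fingerprint.

(** * From covariance estimation to the regression model *)

Section kernel_probability.
Context d d' (X : measurableType d) (Y : measurableType d') (R : realType).
Variable k : R.-pker X ~> Y.

(** Repackages the laws of a kernel as values of type [probability], the form in which the
    fingerprinting argument takes a mechanism. *)
Definition pker_measure (x : X) : set Y -> \bar R := k x.

HB.instance Definition _ x := Measure.copy (pker_measure x) (k x).

HB.instance Definition _ x :=
  Measure_isProbability.Build _ _ _ (pker_measure x) (prob_kernel x).

Definition pker_prob (x : X) : probability Y R := pker_measure x.

Lemma measurable_integral_pker (g : Y -> \bar R) : measurable_fun setT g ->
  (forall y, (0 <= g y)%E) -> measurable_fun setT (fun x => \int[pker_prob x]_y g y)%E.
Proof.
by move=> mg g0; apply: (@measurable_fun_integral_kernel _ _ _ _ _ pker_prob) => // U mU; exact: measurable_kernel.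
Qed.

End kernel_probability.

Section box.
Context (R : realType) (p q : nat) (eta : R).
Hypothesis eta0 : 0 < eta.
Local Notation MR := (measurableTypeR R).
Local Notation Th := ((q * p)%N.-tuple MR).

Definition box : set Th := [set t | forall a b, `|th t a b| <= eta].

Lemma measurable_ball_compl : measurable ([set x | ~ `|x| <= eta] : set MR).
Proof.
rewrite (_ : [set x | _] = ~` `[- eta, eta]%classic).
  by apply: measurableC; exact: measurable_itv.
by apply/seteqP; split => x /=; rewrite in_itv /= ler_norml.
Qed.

Lemma prior_box : {ae prior p q eta0, forall t, box t}.
Proof.
apply: filter_forall => a; apply: filter_forall => b.
pose C : set MR := [set x | ~ `|x| <= eta].
have mC : measurable C := measurable_ball_compl.
have mt : measurable_fun setT (fun t : Th => th t a b : MR) by exact: measurable_fun_tnth.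
have mCC : measurable [set t : Th | C (th t a b)].
  by have := mt measurableT _ mC; rewrite setTI.
exists [set t : Th | C (th t a b)]; split => //.
transitivity (\int[prior p q eta0]_t (\1_C (th t a b))%:E)%E.
  have := @integral_indic _ _ _ (prior p q eta0) setT measurableT _ mCC.
  by rewrite setIT => <-.
transitivity (\int[uniform_prob (itv_gt eta0)]_x (\1_C x)%:E)%E.
  apply: (ge0_integral_iid_tnth (uniform_prob (itv_gt eta0)) (mxvec_index a b) (f := fun x : MR => (\1_C x)%:E)) => //.
  by apply/measurable_EFinP; exact: measurable_indic.
rewrite integral_uniform //; last by apply/measurable_EFinP; exact: measurable_indic.
rewrite integral0_eq ?mule0 // => x /=; rewrite in_itv /= -ler_norml => xe.
by rewrite indicE memNset // /C /= => /(_ xe).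
Qed.

End box.

Section model_bound.
Context (R : realType) (d p q : nat) (eta : R).
Local Notation MR := (measurableTypeR R).
Local Notation Y := (p.-tuple MR * q.-tuple MR)%type.
Local Notation Th := ((q * p)%N.-tuple MR).
Variables (Sig : Th -> 'M[R]_d) (psi : Y -> 'rV[R]_d) (est : 'M[R]_d -> 'I_q -> 'I_p -> R).
Hypothesis eta0 : 0 < eta.
Hypothesis d0 : (0 < d)%N.
Hypothesis mSig : measurable_fun setT Sig.
Hypothesis mpsi : measurable_fun setT psi.
Hypothesis mest : forall a b, measurable_fun setT (fun A => est A a b : MR).
Hypothesis estb : forall A a b, `|est A a b| <= eta.
Hypothesis Sig_loewner : forall t, box eta t ->
  loewner_le 1%:M (Sig t) /\ loewner_le (Sig t) 2%:M.
Hypothesis Sig_law : forall t, box eta t -> forall f : 'rV[R]_d -> \bar R,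
  measurable_fun setT f -> (forall x, (0 <= f x)%E) ->
  (\int[mvnormal (Sig t)]_x f x = \int[rho t]_y f (psi y))%E.
Hypothesis Sig_error : forall t, box eta t -> forall A,
  \sum_a \sum_b (est A a b - th t a b) ^+ 2 <= 16 * d%:R * cov_error (Sig t) A.
Hypothesis est_Sig : forall t, box eta t -> forall a b, est (Sig t) a b = th t a b.

(** Decodes the parameter from a covariance with the estimator also applied to the output of the
    mechanism. Since [est] takes values in [-eta, eta], [tau S] lies in the box for every [S]. *)
Definition tau (S : 'M[R]_d) : Th := [tuple mxvec (\matrix_(a, b) est S a b) 0 j | j < q * p].

Lemma th_tau S a b : th (tau S) a b = est S a b.
Proof. by rewrite /th tnth_mktuple mxvecE mxE. Qed.

Lemma tau_box S : box eta (tau S).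
Proof. by move=> a b; rewrite th_tau; exact: estb. Qed.

Lemma tauK t : box eta t -> tau (Sig t) = t.
Proof.
move=> bt; apply: eq_from_tnth => j; case/mxvec_indexP: j => a b.
by have := th_tau (Sig t) a b; rewrite est_Sig.
Qed.

Lemma measurable_tau : measurable_fun setT tau.
Proof.
apply/measurable_fun_tnthP => j; rewrite /comp; case/mxvec_indexP: j => a b.
by under eq_fun do rewrite -/(th _ a b) th_tau; exact: mest.
Qed.

(** This is the image of the box under [Sig], written as an equation between measurable functions so
    that its measurability is clear. *)
Let V : set 'M[R]_d := [set S | Sig (tau S) = S].

Let mV : measurable V.
Proof.
pose g (S : 'M[R]_d) : MR := \sum_i \sum_j (Sig (tau S) i j - S i j) ^+ 2.
have mg : measurable_fun setT g.
  apply: measurable_sum => i; apply: measurable_sum => j; apply: measurable_funX.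
  apply: measurable_funB.
    exact: ((measurable_fun_matrixP _).1 (measurableT_comp mSig measurable_tau) i j).
  exact: ((measurable_fun_matrixP _).1 (@measurable_id _ _ setT) i j).
rewrite (_ : V = g @^-1` [set 0]).
  by have := mg measurableT _ (measurable_set1 (0 : MR)); rewrite setTI.
apply/seteqP; split=> S /=; rewrite /V /= /g.
  by move=> ->; rewrite big1 // => i _; rewrite big1 // => j _; rewrite subrr expr0n.
have s0 i : 0 <= \sum_j (Sig (tau S) i j - S i j) ^+ 2 by apply: sumr_ge0 => j _; exact: sqr_ge0.
move=> /eqP; rewrite psumr_eq0 // => /allP h; apply/matrixP => i j.
have := h i (mem_index_enum i); rewrite psumr_eq0; last by move=> k _; exact: sqr_ge0.
by move=> /allP /(_ j (mem_index_enum j)); rewrite sqrf_eq0 subr_eq0 => /eqP.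
Qed.

Definition SigM : {mfun Th >-> 'M[R]_d} := mfun_Sub (mem_set mSig).

Definition cov_prior : probability 'M[R]_d R := distribution (prior p q eta0) SigM.

Let boxV t : box eta t -> V (Sig t).
Proof. by move=> bt; rewrite /V /= tauK. Qed.

(** The exceptional set is enclosed in the complement of [V], which is measurable and has mass 0
    because the prior lives on the box. *)
Lemma cov_prior_loewner : {ae cov_prior, forall S, loewner_le 1%:M S /\ loewner_le S 2%:M}.
Proof.
exists (~` V); split; first exact: measurableC.
  have mp : measurable (Sig @^-1` (~` V)) by have := mSig measurableT (measurableC mV); rewrite setTI.
  apply: (measure_negligible (mu := prior p q eta0) mp).
  apply: negligibleS (prior_box p q eta0) => t /= nV bt; exact: (nV (boxV bt)).
by move=> S /=; apply: contra_not => VS; rewrite -VS; apply: Sig_loewner; exact: tau_box.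
Qed.

Section mechanism_bound.
Variables (n : nat) (M : R.-pker (n.-tuple 'rV[R]_d) ~> 'M[R]_d).

Definition kM (ys : n.-tuple Y) : probability 'M[R]_d R := pker_prob M (map_tuple psi ys).

Lemma measurable_kM (g : 'M[R]_d -> \bar R) : measurable_fun setT g ->
  (forall z, (0 <= g z)%E) -> measurable_fun setT (fun ys => \int[kM ys]_z g z)%E.
Proof.
move=> mg g0; apply: (measurableT_comp (measurable_integral_pker M mg g0)).
exact: measurable_map_tuple.
Qed.

Let c : R := (16 * d%:R)^-1.

Let d16 : 0 < 16 * d%:R :> R.
Proof. by rewrite mulr_gt0 // ltr0n. Qed.

Let c0 : 0 <= c.
Proof. by rewrite invr_ge0 ltW. Qed.

(** The error is bounded below pointwise by a measurable function of the output, and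
    [ge0_le_integral_sup] carries this through both integrals. *)
Lemma cov_error_Err t : box eta t ->
  (c%:E * Err kM est t <=
   \int[iid (mvnormal (Sig t)) n]_x \int[M x]_A (cov_error (Sig t) A)%:E)%E.
Proof.
move=> bt.
pose e A : \bar R := (\sum_a \sum_b (est A a b - th t a b) ^+ 2)%:E.
have e0 A : (0 <= e A)%E.
  by rewrite lee_fin; apply: sumr_ge0 => a _; apply: sumr_ge0 => b _; exact: sqr_ge0.
have me : measurable_fun setT e.
  apply/measurable_EFinP; apply: measurable_sum => a; apply: measurable_sum => b.
  by apply: measurable_funX; apply: measurable_funB => //; exact: mest.
pose G x := (\int[pker_prob M x]_A e A)%E.
have G0 x : (0 <= G x)%E by exact: integral_ge0.
have mG : measurable_fun setT G by exact: measurable_integral_pker.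
have -> : (Err kM est t = \int[iid (mvnormal (Sig t)) n]_x G x)%E.
  apply/esym; apply: (etrans (@ge0_integral_iid_density _ _ _ _ _ (mvnormal (Sig t)) (@gY R p q) psi (ell t) mpsi _ _ n G mG G0)).
  - exact: (@measurable_ell _ _ _ _ _ (cst t) id).
  - move=> f mf f0; rewrite (Sig_law bt mf f0).
    apply: (@rho_density _ _ _ t (fun y => f (psi y))) => //.
    exact: (measurableT_comp mf mpsi).
  apply: eq_integral => ys _; rewrite EFinM; congr (_ * _)%E.
  exact: (rerrE kM eta0 mest estb t ys).
rewrite -ge0_integralZl_EFin //.
apply: ge0_le_integral_sup => x; first by rewrite mule_ge0.
rewrite /G -ge0_integralZl_EFin //.
apply: ge0_le_integral_sup => A; first by rewrite mule_ge0.
rewrite /e -EFinM lee_fin /c mulrC ler_pdivrMr // mulrC; exact: Sig_error.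
Qed.

Lemma integral_prior_Err :
  (c%:E * \int[prior p q eta0]_t Err kM est t <= expected_cov_error cov_prior M)%E.
Proof.
have mE := measurable_Err eta0 measurable_kM mest estb.
have E0 := Err_ge0 kM eta0 mest estb.
(* On [V] this lies below the inner integrals of [expected_cov_error], elsewhere it is 0; being
   measurable, it can be pulled back to the prior. *)
pose h (S : 'M[R]_d) : \bar R := ((\1_V S)%:E * (c%:E * Err kM est (tau S)))%E.
have h0 S : (0 <= h S)%E by rewrite !mule_ge0.
have mEt := measurableT_comp mE measurable_tau.
have mh : measurable_fun setT h.
  apply: emeasurable_funM; first by apply/measurable_EFinP; exact: measurable_indic.
  exact: (emeasurable_funM (measurable_cst c%:E) mEt).
apply: (@le_trans _ _ (\int[cov_prior]_S h S)%E); last first.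
  apply: ge0_le_integral_sup => // S; rewrite /h indicE; case: (boolP (S \in V)) => [|_]; last first.
    rewrite mul0e; apply: integral_ge0 => x _; apply: integral_ge0 => A _.
    by rewrite lee_fin sqr_ge0.
  by rewrite inE /V /= mul1e => VS; have := cov_error_Err (tau_box S); rewrite VS.
have hd : (\int[cov_prior]_S h S = \int[prior p q eta0]_t h (Sig t))%E :=
  ge0_integral_distribution SigM mh h0.
have hz := ge0_integralZl_EFin (prior p q eta0) measurableT (fun t _ => E0 t) mE c0.
have hae : (\int[prior p q eta0]_t (c%:E * Err kM est t) = \int[prior p q eta0]_t h (Sig t))%E.
  apply: (@ae_eq_integral _ _ _ (prior p q eta0) setT (fun t => h (Sig t))
    (fun t => c%:E * Err kM est t)%E measurableT
    (emeasurable_funM (measurable_cst c%:E) mE) (measurableT_comp mh mSig)).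
  apply: filterS (prior_box p q eta0) => t bt _.
  by rewrite /h /= tauK // indicE mem_set ?mul1e //; exact: boxV.
have E3 := etrans (esym hz) (etrans hae (esym hd)).
exact: (eq_ind _ (fun z => (_ <= z)%E) (lexx _) _ E3).
Qed.

Lemma mechanism_bound (alpha eps delta : R) : 0 < alpha -> 0 <= eps -> 0 <= delta ->
  diff_private eps delta M ->
  (expected_cov_error cov_prior M <= (alpha ^+ 2)%:E)%E ->
  (q * p)%:R / 2 - 6 / eta ^+ 2 * (16 * d%:R * alpha ^+ 2) <=
  n%:R * (6 * (expR eps - 1) * (4 * Num.sqrt d%:R * alpha) + 24 * delta * eta * (q * p)%:R).
Proof.
move=> a0 eps0 delta0 hdp herr.
have e1 : 1 <= expR eps by rewrite -[leLHS]expR0 ler_expR.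
have b2 : (4 * Num.sqrt d%:R * alpha) ^+ 2 = 16 * d%:R * alpha ^+ 2.
  rewrite !exprMn sqr_sqrtr //; ring.
rewrite -b2; apply: (fingerprint (k := kM) (eta0 := eta0) measurable_kM mest estb e1 delta0).
- move=> ys i y A mA; set x := map_tuple psi ys.
  have xE : map_tuple psi (tset i ys y) = tset i x (psi y).
    by apply: eq_from_tnth => j; rewrite tnth_map !tnth_tset tnth_map; case: ifP.
  (* [neighbors] asks for a true difference. When the fresh observation equals the old one the two
     datasets coincide, and the inequality holds because exp eps >= 1 and delta >= 0. *)
  have [E|NE] := pselect (tnth x i = psi y).
    have -> : kM (tset i ys y) = kM ys.
      rewrite /kM xE; congr pker_prob; apply: eq_from_tnth => j.
      by rewrite tnth_tset; case: eqP => // ->.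
    have : (kM ys A <= (expR eps)%:E * kM ys A + delta%:E)%E.
      rewrite -[leLHS]adde0 -[X in (X + _)%E]mul1e; apply: leeD => //.
      by apply: lee_wpmul2r.
    by [].
  have n1 : neighbors x (tset i x (psi y)).
    exists i; split; first by rewrite tnth_tset eqxx.
    by move=> j ji; rewrite tnth_tset (negbTE ji).
  have n2 : neighbors (tset i x (psi y)) x.
    exists i; split; first by rewrite tnth_tset eqxx => /esym.
    by move=> j ji; rewrite tnth_tset (negbTE ji).
  by rewrite /kM xE; split; [exact: (hdp _ _ n2 A mA)|exact: (hdp _ _ n1 A mA)].
- by rewrite !mulr_gt0 // sqrtr_gt0 ltr0n.
- have := le_trans integral_prior_Err herr; rewrite b2.
  rewrite muleC -lee_pdivlMr ?invr_gt0 // => /le_trans; apply.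
  by rewrite /c invrK -EFinM lee_fin mulrC.
Qed.

End mechanism_bound.
End model_bound.

(** * The covariance models *)

Section clip.
Context (R : realType) (eta : R).
Hypothesis eta0 : 0 < eta.
Local Notation MR := (measurableTypeR R).

Definition clip (x : R) : R := Num.max (- eta) (Num.min x eta).

Lemma clip_bound x : `|clip x| <= eta.
Proof.
rewrite ler_norml /clip le_max lexx /= ge_max ge_min lexx orbT andbT.
by have := eta0; lra.
Qed.

Lemma clip_id x : `|x| <= eta -> clip x = x.
Proof. by rewrite ler_norml => /andP[h1 h2]; rewrite /clip min_l // max_r. Qed.

Lemma clip_dist x y : `|y| <= eta -> (clip x - y) ^+ 2 <= (x - y) ^+ 2.
Proof.
rewrite ler_norml => /andP[h1 h2]; rewrite /clip.
case: (leP x eta) => xe.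
  case: (leP (- eta) x) => // h.
  have : 0 <= (- x - eta) * (y + eta + (y - x)) by apply: mulr_ge0; lra.
  by lra.
rewrite max_r; last by have := eta0; lra.
have : 0 <= (x - eta) * (x - y + (eta - y)) by apply: mulr_ge0; lra.
by lra.
Qed.

Lemma measurable_clip dT (T : measurableType dT) (f : T -> MR) :
  measurable_fun setT f -> measurable_fun setT (fun x => clip (f x) : MR).
Proof. by move=> mf; apply: measurable_maxr => //; apply: measurable_minr. Qed.

End clip.

Section gaussian_models.
Context (R : realType).
Local Notation MR := (measurableTypeR R).
Local Notation gam := (normal_prob (0 : R) 1).

Lemma posform_near d (N : 'M[R]_d) (s : R) : 0 < s ->
  (forall i j, `|N i j| <= 1 / 2 / d%:R) -> posform (s *: (1%:M + N)).
Proof.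
move=> s0 Nb v v0; rewrite -scalemxAr -scalemxAl mxE mulr_gt0 // mulmxDr mulmxDl mulmx1 mxE.
have h0 : (0 : R) <= 1 / 2 by lra.
have := quad_entry_bound v^T h0 Nb; rewrite trmxK => h.
have : 0 < sqc v^T.
  rewrite lt_neqAle sqc_ge0 andbT eq_sym; apply: contraNneq v0 => /sqc_eq0 /(congr1 trmx).
  by rewrite trmxK trmx0 => ->.
have := ler_norm (- (v *m N *m v^T) 0 0); rewrite normrN.
by rewrite sqcE trmxK in h *; lra.
Qed.

Lemma ge0_integral_mvnormal d (S : 'M[R]_d) (f : 'rV[R]_d -> \bar R) :
  measurable_fun setT f -> (forall x, (0 <= f x)%E) ->
  (\int[mvnormal S]_x f x = \int[iid gam d]_g f (rowt g *m sqrtmx S))%E.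
Proof. by move=> mf f0; exact: (ge0_integral_distribution (normal_map S) mf f0). Qed.

Lemma mvnormal_factor d (S A : 'M[R]_d) (f : 'rV[R]_d -> \bar R) :
  psd (sqrtmx S) -> sqrtmx S *m sqrtmx S = S -> posform (sqrtmx S) ->
  posform A -> A^T *m A = S ->
  measurable_fun setT f -> (forall x, (0 <= f x)%E) ->
  (\int[mvnormal S]_x f x = \int[iid gam d]_g f (rowt g *m A))%E.
Proof.
move=> [sB _] BB pB pA AA mf f0; rewrite ge0_integral_mvnormal //.
by apply: gauss_law => //; rewrite sB BB AA.
Qed.

Lemma rowt_cat p q (u : p.-tuple MR) (v : q.-tuple MR) :
  rowt (cat_tuple u v) = row_mx (rowt u) (rowt v).
Proof.
apply/rowP => i; case: (split_ordP i) => j ->; rewrite mxE.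
  by rewrite tnth_lshift row_mxEl mxE.
by rewrite tnth_rshift row_mxEr mxE.
Qed.

Section regression.
Context (p q : nat).
Local Notation Y := (p.-tuple MR * q.-tuple MR)%type.
Local Notation Th := ((q * p)%N.-tuple MR).

Definition regmx (t : Th) : 'M[R]_(q, p) := \matrix_(a, b) th t a b.

Lemma rowt_shear (t : Th) (y : Y) :
  rowt (shear t y).2 = rowt y.2 + rowt y.1 *m (regmx t)^T.
Proof.
apply/rowP => a; rewrite !mxE tnth_mktuple; congr (_ + _).
by apply: eq_bigr => b _; rewrite !mxE mulrC.
Qed.

Lemma measurable_regmx dT (T : measurableType dT) (f : T -> Th) a b :
  measurable_fun setT f -> measurable_fun setT (fun x => regmx (f x) a b : MR).
Proof. by move=> mf; under eq_fun do rewrite mxE; exact: measurable_fun_tnth. Qed.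

End regression.

End gaussian_models.

(** * The block model in dimension at least 2 *)

Section split_model.
Context (R : realType) (p q : nat).
Hypothesis p0 : (0 < p)%N.
Local Notation MR := (measurableTypeR R).
Local Notation gam := (normal_prob (0 : R) 1).
Local Notation Y := (p.-tuple MR * q.-tuple MR)%type.
Local Notation Th := ((q * p)%N.-tuple MR).
Local Notation d := (p + q)%N.
Let eta : R := (8 * d%:R)^-1.

(** A row (u, w) times this factor is (u, w + u B^T), the regression model with noise w. The scale
    (6/5)^2 = 36/25 used next lies in [4/3, 8/5], as the near-identity bounds require. *)
Definition split_factor (t : Th) : 'M[R]_d := block_mx 1%:M (regmx t)^T 0 1%:M.
Definition split_cov (t : Th) : 'M[R]_d := (6 / 5) ^+ 2 *: ((split_factor t)^T *m split_factor t).
Definition split_obs (y : Y) : 'rV[R]_d := (6 / 5) *: row_mx (rowt y.1) (rowt y.2).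
Definition split_est (A : 'M[R]_d) (a : 'I_q) (b : 'I_p) : R :=
  clip ((8 * d%:R)^-1) (A (rshift p a) (lshift q b) / (6 / 5) ^+ 2).

Let d0 : 0 < d%:R :> R. Proof. by rewrite ltr0n addn_gt0 p0. Qed.
Let eta0 : 0 < eta. Proof. by rewrite invr_gt0 mulr_gt0. Qed.

Let N (t : Th) : 'M[R]_d := block_mx 0 (regmx t)^T 0 0.
Let E (t : Th) : 'M[R]_d := 1%:M - (split_factor t)^T *m split_factor t.

Let factorE t : split_factor t = 1%:M + N t.
Proof. by rewrite (scalar_mx_block p q 1) /N add_block_mx !addr0 !add0r. Qed.

Let gramE t : (split_factor t)^T *m split_factor t =
  block_mx 1%:M (regmx t)^T (regmx t) (regmx t *m (regmx t)^T + 1%:M).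
Proof.
rewrite /split_factor tr_block_mx !trmx1 trmx0 trmxK mulmx_block.
by rewrite !(mulmx1, mul1mx, mulmx0, mul0mx, addr0).
Qed.

Let EE t : E t = block_mx 0 (- (regmx t)^T) (- regmx t) (- (regmx t *m (regmx t)^T)).
Proof.
rewrite /E gramE (scalar_mx_block p q 1) opp_block_mx add_block_mx subrr !add0r.
by rewrite opprD addrCA subrr addr0.
Qed.

Let covE t : split_cov t = (6 / 5) ^+ 2 *: (1%:M - E t).
Proof. by rewrite /E opprB addrC subrK. Qed.

Let etaE : eta = 1 / 8 / d%:R.
Proof. by rewrite /eta invfM mul1r. Qed.

Let dV0 : 0 <= d%:R^-1 :> R. Proof. by rewrite invr_ge0 ltW. Qed.

Let Eb t : box eta t -> forall i j, `|E t i j| <= 1 / 4 / d%:R.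
Proof.
move=> bt; have e4 : eta <= 1 / 4 / d%:R by rewrite etaE ler_wpM2r //; lra.
have z4 : `|0 : R| <= 1 / 4 / d%:R by rewrite normr0 mulr_ge0 //; lra.
move=> i j; rewrite EE.
case: (split_ordP i) => i' ->; case: (split_ordP j) => j' ->.
- by rewrite block_mxEul mxE.
- by rewrite block_mxEur !mxE normrN; apply: le_trans e4; exact: bt.
- by rewrite block_mxEdl !mxE normrN; apply: le_trans e4; exact: bt.
rewrite block_mxEdr !mxE normrN; apply: le_trans (ler_norm_sum _ _ _) _.
(* Entries of B B^T are sums of p products of size at most eta^2; as p eta <= 1/8, they are at most
   eta. *)
apply: (@le_trans _ _ (\sum_(b < p) eta * eta)).
  by apply: ler_sum => b _; rewrite !mxE normrM; apply: ler_pM => //; exact: bt.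
have -> : \sum_(b < p) eta * eta = eta * (eta * p%:R).
  by rewrite sumr_const card_ord mulrA mulr_natr.
apply: le_trans e4; rewrite -[leRHS]mulr1 ler_pM2l // etaE mulrAC ler_pdivrMr // mul1r.
have : p%:R <= d%:R :> R by rewrite ler_nat leq_addr.
have : 0 <= p%:R :> R by []; lra.
Qed.

Let sE t : (E t)^T = E t.
Proof. by rewrite /E linearB /= trmx1 trmx_mul trmxK. Qed.

Let c1 : 4 / 3 <= (6 / 5) ^+ 2 :> R. Proof. by lra. Qed.
Let c2 : (6 / 5) ^+ 2 <= 8 / 5 :> R. Proof. by lra. Qed.

Lemma measurable_split_cov : measurable_fun setT split_cov.
Proof.
have mf i j : measurable_fun setT (fun t => split_factor t i j : MR).
  case: (split_ordP i) => i' ->; case: (split_ordP j) => j' ->.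
  - by under eq_fun do rewrite /split_factor block_mxEul; exact: measurable_cst.
  - by under eq_fun do rewrite /split_factor block_mxEur mxE; exact: measurable_regmx.
  - by under eq_fun do rewrite /split_factor block_mxEdl; exact: measurable_cst.
  - by under eq_fun do rewrite /split_factor block_mxEdr; exact: measurable_cst.
apply/measurable_fun_matrixP => i j; under eq_fun do rewrite !mxE.
apply: measurable_funM => //; apply: measurable_sum => k; apply: measurable_funM; last exact: mf.
by under eq_fun do rewrite mxE; exact: mf.
Qed.

Lemma measurable_split_obs : measurable_fun setT split_obs.
Proof.
apply/measurable_fun_matrixP => i j; under eq_fun do rewrite !mxE.
apply: measurable_funM => //; case: (fintype.split j) => k; under eq_fun do rewrite mxE.
  by apply: measurable_fun_tnth; exact: measurable_fst.
by apply: measurable_fun_tnth; exact: measurable_snd.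
Qed.

Lemma measurable_split_est a b : measurable_fun setT (fun A => split_est A a b : MR).
Proof. by apply: measurable_clip; apply: measurable_funM => //; exact: measurable_coord. Qed.

Lemma split_est_bound A a b : `|split_est A a b| <= eta.
Proof. exact: clip_bound. Qed.

Lemma split_loewner t : box eta t -> loewner_le 1%:M (split_cov t) /\ loewner_le (split_cov t) 2%:M.
Proof. by move=> bt; rewrite covE; exact: (near_loewner (sE t) (Eb bt)). Qed.

Lemma split_entry t a b : split_cov t (rshift p a) (lshift q b) = (6 / 5) ^+ 2 * th t a b.
Proof. by rewrite /split_cov gramE mxE block_mxEdl mxE. Qed.

Lemma split_est_cov t : box eta t -> forall a b, split_est (split_cov t) a b = th t a b.
Proof.
move=> bt a b; rewrite /split_est split_entry.
have -> : (6 / 5) ^+ 2 * th t a b / (6 / 5) ^+ 2 = th t a b by field.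
by apply: clip_id; exact: bt.
Qed.

(** The lower left block, equal to (6/5)^2 B, carries only part of the squared Frobenius error;
    dividing by its scale and clipping to the box decrease the error further. *)
Lemma split_error t : box eta t -> forall A,
  \sum_a \sum_b (split_est A a b - th t a b) ^+ 2 <= 16 * d%:R * cov_error (split_cov t) A.
Proof.
move=> bt A.
have [pS SS fS] := near_sqrtmx (sE t) (Eb bt) c1 c2; rewrite -covE in pS SS fS.
have q2 v : (v^T *m split_cov t *m v) 0 0 <= 2 * sqc v.
  by rewrite covE; have [] := near_quad (Eb bt) c1 c2 v.
have := cov_error_frobenius A pS SS fS q2.
rewrite big_split_ord /= => hF.
have g0 i j : 0 <= (A i j - split_cov t i j) ^+ 2 by exact: sqr_ge0.
have : \sum_a \sum_b (split_est A a b - th t a b) ^+ 2 <=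
    \sum_(a < q) \sum_j (A (rshift p a) j - split_cov t (rshift p a) j) ^+ 2.
  apply: ler_sum => a _; rewrite big_split_ord /= -[leLHS]addr0; apply: lerD; last exact: sumr_ge0.
  apply: ler_sum => b _; apply: le_trans (clip_dist eta0 _ (bt a b)) _.
  rewrite split_entry.
  set x := A _ _; set y := th t a b.
  have -> : x / (6 / 5) ^+ 2 - y = (x - (6 / 5) ^+ 2 * y) / (6 / 5) ^+ 2 by field.
  by have := sqr_ge0 (x - (6 / 5) ^+ 2 * y); rewrite expr_div_n; lra.
have : 0 <= \sum_(i < p) \sum_j (A (lshift q i) j - split_cov t (lshift q i) j) ^+ 2.
  by apply: sumr_ge0 => i _; exact: sumr_ge0.
have : 0 <= d%:R * cov_error (split_cov t) A by rewrite mulr_ge0 // sqr_ge0.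
rewrite -!mulrA in hF *; lra.
Qed.

Lemma split_law t : box eta t -> forall f : 'rV[R]_d -> \bar R,
  measurable_fun setT f -> (forall x, (0 <= f x)%E) ->
  (\int[mvnormal (split_cov t)]_x f x = \int[rho t]_y f (split_obs y))%E.
Proof.
move=> bt f mf f0.
have [pS SS fS] := near_sqrtmx (sE t) (Eb bt) c1 c2; rewrite -covE in pS SS fS.
have pA : posform ((6 / 5) *: split_factor t).
  rewrite factorE; apply: posform_near; first by lra.
  have z2 : `|0 : R| <= 1 / 2 / d%:R by rewrite normr0 mulr_ge0 //; lra.
  move=> i j; rewrite /N; case: (split_ordP i) => i' ->; case: (split_ordP j) => j' ->.
  - by rewrite block_mxEul mxE.
  - rewrite block_mxEur !mxE; apply: le_trans (bt _ _) _; rewrite etaE ler_wpM2r //; lra.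
  - by rewrite block_mxEdl mxE.
  - by rewrite block_mxEdr mxE.
have AA : ((6 / 5) *: split_factor t)^T *m ((6 / 5) *: split_factor t) = split_cov t.
  have -> : ((6 / 5) *: split_factor t)^T = (6 / 5) *: (split_factor t)^T by rewrite linearZ.
  by rewrite -scalemxAl -scalemxAr scalerA -expr2.
apply: (etrans (mvnormal_factor pS SS fS pA AA mf f0)).
have mfo := measurableT_comp mf measurable_split_obs.
apply: (etrans (@ge0_integral_iid_cat _ _ _ gam p q (fun g => f (rowt g *m ((6 / 5) *: split_factor t))) _ _)).
- by apply: (measurableT_comp mf); apply: measurable_mulmxr; exact: measurable_rowt.
- by [].
apply/esym; apply: (etrans (ge0_integral_rho t mfo (fun y => f0 _))).
apply: (etrans (ge0_integral_gY (measurableT_comp mfo (@measurable_shear _ _ _ t)) (fun y => f0 _))).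
apply: eq_integral => u _; apply: eq_integral => v _; rewrite /= /split_obs rowt_shear /=.
rewrite rowt_cat -scalemxAr mul_row_block !mulmx1 mulmx0 addr0; congr (f (_ *: row_mx _ _)).
by rewrite addrC.
Qed.

End split_model.

(** An antisymmetric matrix has zero quadratic form, so only c |v|^2 remains. *)
Lemma posform_rotation (R : realType) d (K : 'M[R]_d) (c : R) : 0 < c -> K^T = - K ->
  posform (c%:M + K).
Proof.
move=> c0 sK v v0; rewrite mulmxDr mulmxDl mul_mx_scalar -scalemxAl mxE [X in X + _]mxE.
have -> : (v *m K *m v^T) 0 0 = 0.
  have : (v *m K *m v^T) 0 0 = - (v *m K *m v^T) 0 0.
    have -> : - (v *m K *m v^T) 0 0 = (v *m K *m v^T)^T 0 0.
      by rewrite !trmx_mul trmxK sK mulNmx mulmxN mulmxA [RHS]mxE.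
    by rewrite [RHS]mxE.
  by lra.
have : 0 < sqc v^T.
  rewrite lt_neqAle sqc_ge0 andbT eq_sym; apply: contraNneq v0 => /sqc_eq0 /(congr1 trmx).
  by rewrite trmxK trmx0 => ->.
by rewrite sqcE trmxK addr0 => ?; exact: mulr_gt0.
Qed.

(** Factor z^2 - C^2 = (z - C)(z + C) with z + C >= 7/8. For negative x the root is 0 by convention,
    and C^2 >= 49/64 suffices. *)
Lemma sqrtr_dist (R : realType) (x C : R) : 7 / 8 <= C ->
  (Num.sqrt x - C) ^+ 2 <= 64 / 49 * (x - C ^+ 2) ^+ 2.
Proof.
move=> C7; have C2 : 49 / 64 <= C ^+ 2 by nra.
have [x0|x0] := leP 0 x.
  have z0 := sqrtr_ge0 x; rewrite -[in leRHS](sqr_sqrtr x0); set z := Num.sqrt x in z0 *.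
  have h1 : 49 / 64 <= (z + C) ^+ 2 by nra.
  have h2 := sqr_ge0 (z - C).
  have -> : (z ^+ 2 - C ^+ 2) ^+ 2 = (z - C) ^+ 2 * (z + C) ^+ 2 by ring.
  have := ler_wpM2l h2 h1; lra.
rewrite ler0_sqrtr; last exact: ltW.
set y := C ^+ 2 in C2 *; rewrite sub0r sqrrN -/y.
have h1 : 0 <= (- x) * (y - x + y) by apply: mulr_ge0; lra.
have h2 : 0 <= (y - 49 / 64) * y by apply: mulr_ge0; lra.
by lra.
Qed.

(** * The scalar model in dimension 1 *)

Section line_model.
Context (R : realType).
Local Notation MR := (measurableTypeR R).
Local Notation gam := (normal_prob (0 : R) 1).
Local Notation Y := (1.-tuple MR * 1.-tuple MR)%type.
Local Notation Th := ((1 * 1)%N.-tuple MR).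
Let eta : R := (8 * 1%:R)^-1.

(** A 1 x 1 covariance has no off-diagonal block, so the parameter is hidden in the variance of 5/6
    (u + v), where u + v = (1 + th) u + noise. It equals 25/18 (1 - E) with 25/18 in [4/3, 8/5]. *)
Definition line_cov (t : Th) : 'M[R]_1 := (25 / 36 * (1 + (1 + th t 0 0) ^+ 2))%:M.
Definition line_obs (y : Y) : 'rV[R]_1 := (5 / 6) *: (rowt y.1 + rowt y.2).
Definition line_est (A : 'M[R]_1) (a b : 'I_1) : R :=
  clip ((8 * 1%:R)^-1) (Num.sqrt (A 0 0 * (36 / 25) - 1) - 1).

Let E (t : Th) : 'M[R]_1 := (- (th t 0 0 + th t 0 0 ^+ 2 / 2))%:M.

Let etaE : eta = 1 / 8.
Proof. by rewrite /eta mulr1 mul1r. Qed.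

Let eta0 : 0 < eta.
Proof. by rewrite etaE; lra. Qed.

Let covE t : line_cov t = (25 / 18) *: (1%:M - E t).
Proof.
rewrite /line_cov /E -raddfB /= scale_scalar_mx; congr (_%:M).
by set b := th t 0 0; field.
Qed.

Let boxE (t : Th) : box eta t -> - (1 / 8) <= th t 0 0 <= 1 / 8.
Proof. by move=> /(_ 0 0); rewrite etaE ler_norml. Qed.

Let Eb (t : Th) : box eta t -> forall i j, `|E t i j| <= 1 / 4 / 1%:R.
Proof.
move=> /boxE /andP[b1 b2] i j; rewrite !ord1 mxE eqxx mulr1n normrN divr1 ler_norml.
set b := th t 0 0 in b1 b2 *.
have : 0 <= (1 / 8 - b) * (b + 1 / 8) by apply: mulr_ge0; lra.
by have := sqr_ge0 b; move=> h1 h2; apply/andP; split; lra.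
Qed.

Let sE t : (E t)^T = E t.
Proof. by rewrite tr_scalar_mx. Qed.

Let c1 : 4 / 3 <= 25 / 18 :> R. Proof. by lra. Qed.
Let c2 : 25 / 18 <= 8 / 5 :> R. Proof. by lra. Qed.

Lemma measurable_line_cov : measurable_fun setT line_cov.
Proof.
apply/measurable_fun_matrixP => i j; rewrite !ord1.
under eq_fun do rewrite mxE eqxx mulr1n.
apply: measurable_funM => //; apply: measurable_funD => //; apply: measurable_funX.
by apply: measurable_funD => //; exact: measurable_fun_tnth.
Qed.

Lemma measurable_line_obs : measurable_fun setT line_obs.
Proof.
apply/measurable_fun_matrixP => i j; under eq_fun do rewrite !mxE.
apply: measurable_funM => //; apply: measurable_funD; apply: measurable_fun_tnth.
  exact: measurable_fst.
exact: measurable_snd.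
Qed.

Lemma measurable_line_est a b : measurable_fun setT (fun A => line_est A a b : MR).
Proof.
apply: measurable_clip; apply: measurable_funB => //.
apply: (measurableT_comp (continuous_measurable_fun (@sqrt_continuous R))).
apply: measurable_funB => //; apply: measurable_funM => //; exact: measurable_coord.
Qed.

Lemma line_est_bound A a b : `|line_est A a b| <= eta.
Proof. exact: clip_bound. Qed.

Lemma line_loewner (t : Th) : box eta t -> loewner_le 1%:M (line_cov t) /\ loewner_le (line_cov t) 2%:M.
Proof. by move=> bt; rewrite covE; exact: (near_loewner (sE t) (Eb bt)). Qed.

Lemma line_est_cov (t : Th) : box eta t -> forall a b, line_est (line_cov t) a b = th t a b.
Proof.
move=> bt a b; rewrite !ord1 /line_est mxE eqxx mulr1n; have /andP[b1 b2] := boxE bt.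
set x := th t 0 0 in b1 b2 *.
have -> : 25 / 36 * (1 + (1 + x) ^+ 2) * (36 / 25) - 1 = (1 + x) ^+ 2 by field.
rewrite sqrtr_sqr ger0_norm; last by lra.
by rewrite addrAC subrr add0r; apply: clip_id; exact: bt.
Qed.

Lemma line_error (t : Th) : box eta t -> forall A,
  \sum_a \sum_b (line_est A a b - th t a b) ^+ 2 <= 16 * 1%:R * cov_error (line_cov t) A.
Proof.
move=> bt A.
have [pS SS fS] := near_sqrtmx (sE t) (Eb bt) c1 c2; rewrite -covE in pS SS fS.
have q2 v : (v^T *m line_cov t *m v) 0 0 <= 2 * sqc v.
  by rewrite covE; have [] := near_quad (Eb bt) c1 c2 v.
have := cov_error_frobenius A pS SS fS q2.
rewrite !big_ord1 [line_cov t _ _]mxE eqxx mulr1n => hF.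
apply: le_trans (clip_dist eta0 _ (bt 0 0)) _.
have /andP[b1 b2] := boxE bt.
set b := th t 0 0 in b1 b2 hF *; set x := A 0 0 in hF *.
have C7 : 7 / 8 <= 1 + b by lra.
have := sqrtr_dist (x * (36 / 25) - 1) C7.
have -> : x * (36 / 25) - 1 - (1 + b) ^+ 2 = 36 / 25 * (x - 25 / 36 * (1 + (1 + b) ^+ 2)) by field.
(* 64/49 (36/25)^2 is below 3, which multiplied by the 4 of [cov_error_frobenius] stays below 16. *)
rewrite opprD addrA exprMn; have := sqr_ge0 (x - 25 / 36 * (1 + (1 + b) ^+ 2)).
by move: hF; rewrite !mulr1; lra.
Qed.

(** The first coordinate of (u, w)(C + K), with K the quarter turn, is C u + w. Since (C + K)^T (C +
    K) = (C^2 + 1) 1 = r^2 1, that pair has the law of r (u, w): a sum of two independent normals is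
    reduced to a single one by rotation invariance. *)
Lemma line_law (t : Th) : box eta t -> forall f : 'rV[R]_1 -> \bar R,
  measurable_fun setT f -> (forall x, (0 <= f x)%E) ->
  (\int[mvnormal (line_cov t)]_x f x = \int[rho t]_y f (line_obs y))%E.
Proof.
move=> bt f mf f0.
have [_ SS fS] := near_sqrtmx (sE t) (Eb bt) c1 c2; rewrite -covE in SS fS.
have /andP[b1 b2] := boxE bt.
pose C := 1 + th t 0 0; have C0 : 0 < C by rewrite /C; lra.
pose r := Num.sqrt (C ^+ 2 + 1).
have r2 : r ^+ 2 = C ^+ 2 + 1 by rewrite sqr_sqrtr // addr_ge0 ?sqr_ge0.
have r0 : 0 < r by rewrite sqrtr_gt0 ltr_wpDl ?sqr_ge0.
pose K : 'M[R]_(1 + 1) := block_mx 0 (- 1%:M) 1%:M 0.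
have sK : K^T = - K.
  by rewrite tr_block_mx opp_block_mx !trmx0 trmx1 linearN /= trmx1 oppr0 opprK.
have KK : K *m K = - 1%:M.
  rewrite mulmx_block !(mulmx0, mul0mx, addr0, add0r, mulmx1, mul1mx).
  by rewrite (scalar_mx_block 1 1 1) opp_block_mx oppr0.
have pA : posform (C%:M + K) by exact: posform_rotation.
have pr : posform (r%:M + 0 : 'M[R]_(1 + 1)) by apply: posform_rotation; rewrite ?trmx0 ?oppr0.
have AA : (C%:M + K)^T *m (C%:M + K) = (r%:M + 0)^T *m (r%:M + 0).
  have -> : (C%:M + K)^T = C%:M - K by rewrite -sK -[in RHS](tr_scalar_mx _ C) -linearD.
  have rr : r * r = C * C + 1 by rewrite -!expr2.
  rewrite addr0 tr_scalar_mx mulmxBl !mulmxDr -!scalar_mxM KK rr.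
  rewrite (scalar_mxC C K) opprB addrA addrAC addrK.
  by apply/matrixP => i j; rewrite !mxE mulrnDl.
have sig : sqrtmx (line_cov t) = (5 / 6 * r)%:M.
  rewrite [LHS]mx11_scalar; congr (_%:M); set g := sqrtmx _ 0 0.
  have g0 : 0 < g.
    have := fS 1%:M; rewrite mul1mx trmx1 mulmx1; apply.
    by apply/eqP => /matrixP /(_ 0 0) /eqP; rewrite !mxE eqxx oner_eq0.
  have g2 : g ^+ 2 = (5 / 6 * r) ^+ 2.
    rewrite exprMn r2 /C; move/matrixP: SS => /(_ 0 0); rewrite !mxE big_ord1 eqxx mulr1n -expr2 -/g => ->.
    by set b := th t 0 0; field.
  have rr : 0 <= 5 / 6 * r by rewrite mulr_ge0 ?ltW //; lra.
  by rewrite -(ger0_norm (ltW g0)) -[RHS](ger0_norm rr) -!sqrtr_sqr g2.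
pose F (x : 'rV[MR]_(1 + 1)) : \bar R := f ((5 / 6) *: lsubmx x).
have mF : measurable_fun setT F.
  apply: (measurableT_comp mf); apply/measurable_fun_matrixP => i j.
  under eq_fun do rewrite !mxE; apply: measurable_funM => //; exact: measurable_coord.
have F0 x : (0 <= F x)%E by exact: f0.
have mFA (A : 'M[R]_(1 + 1)) : measurable_fun setT (fun g : (1 + 1).-tuple MR => F (rowt g *m A)).
  by apply: (measurableT_comp mF); apply: measurable_mulmxr; exact: measurable_rowt.
have mfo := measurableT_comp mf measurable_line_obs.
apply/esym; apply: (etrans (ge0_integral_rho t mfo (fun y => f0 _))).
apply: (etrans (ge0_integral_gY (measurableT_comp mfo (@measurable_shear _ _ _ t)) (fun y => f0 _))).
transitivity (\int[iid gam (1 + 1)]_g F (rowt g *m (C%:M + K)))%E.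
  apply/esym; apply: (etrans (@ge0_integral_iid_cat _ _ _ gam 1 1 (fun g => F (rowt g *m (C%:M + K))) (mFA _) (fun=> F0 _))).
  apply: eq_integral => u _; apply: eq_integral => v _.
  rewrite /= /F /line_obs rowt_shear rowt_cat; congr (f (_ *: _)).
  rewrite (scalar_mx_block 1 1 C) add_block_mx mul_row_block row_mxKl addr0 add0r mulmx1.
  rewrite mul_mx_scalar /C scalerDl scale1r -addrA; congr (_ + _); rewrite addrC; congr (_ + _).
  by rewrite [regmx t]mx11_scalar tr_scalar_mx mul_mx_scalar mxE.
apply: (etrans (gauss_law pA pr AA mF F0)).
apply: (etrans (@ge0_integral_iid_cat _ _ _ gam 1 1 (fun g => F (rowt g *m (r%:M + 0))) (mFA _) (fun=> F0 _))).
apply/esym; apply: (etrans (ge0_integral_mvnormal (line_cov t) mf f0)).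
apply: eq_integral => u _; rewrite sig mul_mx_scalar.
transitivity (\int[iid gam 1]_v f ((5 / 6 * r) *: rowt u))%E.
  by rewrite integral_probability_cst.
apply: eq_integral => v _; rewrite /F rowt_cat addr0 mul_mx_scalar.
by rewrite scale_row_mx row_mxKl scalerA.
Qed.

End line_model.

(** * Assembling the models and balancing the constants *)

Lemma private_covariance_tradeoff (R : realType) (d : nat) : (0 < d)%N ->
  exists (D : probability 'M[R]_d R) (k : nat), [/\ (d ^ 2 <= 6 * k)%N,
    {ae D, forall S : 'M[R]_d, loewner_le 1%:M S /\ loewner_le S 2%:M} &
    forall (n : nat) (M : R.-pker (n.-tuple 'rV[R]_d) ~> 'M[R]_d) (alpha eps delta : R),
      0 < alpha -> 0 <= eps -> 0 <= delta -> diff_private eps delta M ->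
      (expected_cov_error D M <= (alpha ^+ 2)%:E)%E ->
      k%:R / 2 - 6 / ((8 * d%:R)^-1) ^+ 2 * (16 * d%:R * alpha ^+ 2) <=
      n%:R * (6 * (expR eps - 1) * (4 * Num.sqrt d%:R * alpha) +
              24 * delta * (8 * d%:R)^-1 * k%:R)].
Proof.
move=> d0; have [d1|d1] := leqP d 1.
  have dE : d = 1%N by apply/eqP; rewrite eqn_leq d1 d0.
  subst d; have e0 : 0 < (8 * 1%:R)^-1 :> R by rewrite invr_gt0 mulr1.
  exists (cov_prior e0 (@measurable_line_cov R)), (1 * 1)%N; split => //.
    apply: (@cov_prior_loewner _ _ _ _ _ _ _ e0 _ (@measurable_line_est R)).
    - exact: line_est_bound.
    - exact: line_loewner.
    - exact: line_est_cov.
  move=> n M alpha eps delta; apply: (mechanism_bound d0 (@measurable_line_obs R) (@measurable_line_est R)).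
  - exact: line_est_bound.
  - exact: line_law.
  - exact: line_error.
  - exact: line_est_cov.
have [p [q [dE p0 h]]] : exists p q, [/\ d = (p + q)%N, (0 < p)%N & (d ^ 2 <= 6 * (q * p))%N].
  (* d^2 / (q p) is 4 for even d and 4 + 1 / (q p) for odd d, so it is at most 9/2, reached at d =
     3. *)
  exists (d - d %/ 2)%N, (d %/ 2)%N; split; [lia|lia|].
  have : (d = d %/ 2 * 2 + d %% 2)%N by lia.
  have : (d %% 2 < 2)%N by lia.
  move: (d %/ 2)%N (d %% 2)%N => m s hs dE.
  have -> : (d - m = m + s)%N by lia.
  have m0 : (0 < m)%N by lia.
  rewrite dE -mulnn; case: s hs {dE} => [|[|//]] _; nia.
subst d; have e0 : 0 < (8 * (p + q)%:R)^-1 :> R by rewrite invr_gt0 mulr_gt0 // ltr0n.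
exists (cov_prior e0 (@measurable_split_cov R p q)), (q * p)%N; split => //.
  apply: (@cov_prior_loewner _ _ _ _ _ _ _ e0 _ (@measurable_split_est R p q)).
  - exact: split_est_bound.
  - exact: split_loewner.
  - exact: split_est_cov.
move=> n M alpha eps delta; apply: (mechanism_bound d0 (@measurable_split_obs R p q) (@measurable_split_est R p q)).
- exact: split_est_bound.
- exact: split_law.
- exact: split_error.
- exact: split_est_cov.
Qed.

(** Squaring 1 - x/2 <= exp(-x/2) bounds exp x by (1 - x/2)^-2, and (1 - x/2)^2 (1 + 3x) - 1 = x (1
    - x)(8 - 3x) / 4. *)
Lemma expR_sub1_le (R : realType) (x : R) : 0 <= x <= 1 -> expR x - 1 <= 3 * x.
Proof.
move=> /andP[x0 x1].
have h1 : 1 - x / 2 <= expR (- (x / 2)) by have := expR_ge1Dx (- (x / 2)).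
have h2 : expR (- (x / 2)) ^+ 2 * expR x = 1.
  by rewrite expr2 -!expRD (_ : _ + x = 0) ?expR0 //; field.
have h3 : (1 - x / 2) ^+ 2 <= expR (- (x / 2)) ^+ 2 by rewrite ler_sqr ?nnegrE ?expR_ge0 //; lra.
have := ler_wpM2r (expR_ge0 x) h3; rewrite h2 => h4.
have h5 : 1 <= (1 - x / 2) ^+ 2 * (1 + 3 * x).
  have : 0 <= (x * (1 - x)) * (8 - 3 * x) by rewrite !mulr_ge0 //; lra.
  by lra.
have : (1 - x / 2) ^+ 2 * expR x <= (1 - x / 2) ^+ 2 * (1 + 3 * x) by exact: le_trans h5.
by rewrite ler_pM2l ?exprn_gt0 //; lra.
Qed.

(** Of k/2, the delta term takes at most k/8, since delta n <= 1/24. The remaining 3k/8 is at least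
    d^2 / 16, and the error term is at most 6144 / 600^2 d^2 < d^2 / 48, so d^2 / 24 remains. The
    privacy term is at most 72 n alpha eps sqrt d, and 72 * 24 = 12 * 144. *)
Lemma tradeoff_sample_bound (R : realType) (d n k : nat) (alpha eps delta : R) :
  (0 < d)%N -> (0 < n)%N -> (d ^ 2 <= 6 * k)%N ->
  0 < alpha -> alpha <= 1 / 600 / Num.sqrt d%:R -> 0 <= eps <= 1 ->
  0 <= delta -> delta <= 1 / 24 * delta_max d n ->
  k%:R / 2 - 6 / ((8 * d%:R)^-1) ^+ 2 * (16 * d%:R * alpha ^+ 2) <=
    n%:R * (6 * (expR eps - 1) * (4 * Num.sqrt d%:R * alpha) +
            24 * delta * (8 * d%:R)^-1 * k%:R) ->
  d%:R * Num.sqrt d%:R <= 12 * (144 * (n%:R * (alpha * eps))).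
Proof.
move=> d0 n0 dk a0 ha eps01 delta0 hdelta.
have D1 : 1 <= d%:R :> R by rewrite ler1n.
have nR : 0 < n%:R :> R by rewrite ltr0n.
have dn : delta * n%:R <= 1 / 24.
  have : delta_max d n <= n%:R^-1 :> R by rewrite /delta_max; case: ifP => // _; rewrite ge_min lexx.
  rewrite -ler_pdivlMr // => h; apply: le_trans hdelta _; rewrite ler_pM2l //; lra.
have w0 : 0 < Num.sqrt d%:R :> R by rewrite sqrtr_gt0 ltr0n.
have w2 : Num.sqrt d%:R ^+ 2 = d%:R :> R by rewrite sqr_sqrtr.
have kR : d%:R ^+ 2 <= 6 * k%:R :> R by rewrite -natrX -natrM ler_nat.
have k0 : 0 <= k%:R :> R by [].
rewrite ler_pdivlMr // in ha.
have he := expR_sub1_le eps01.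
set w := Num.sqrt d%:R in w0 w2 ha *; set D : R := d%:R in D1 w2 kR *.
set K : R := k%:R in k0 kR *; set N : R := n%:R in nR dn *.
set e := expR eps in he *.
have D0 : 0 < D by lra.
have -> : 6 / ((8 * D)^-1) ^+ 2 * (16 * D * alpha ^+ 2) = 64 * 96 * D ^+ 2 * (alpha * w) ^+ 2.
  by rewrite exprMn w2; field; rewrite gt_eqF.
have -> : N * (6 * (e - 1) * (4 * w * alpha) + 24 * delta * (8 * D)^-1 * K) =
   24 * ((N * (alpha * w)) * (e - 1)) + 3 * (delta * N) * (K / D) by field; rewrite gt_eqF.
have u0 : 0 < alpha * w by exact: mulr_gt0.
have u2 : (alpha * w) ^+ 2 <= 1 / 600 * (1 / 600).
  by rewrite expr2; apply: ler_pM => //; exact: ltW.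
have h1 : D ^+ 2 * (alpha * w) ^+ 2 <= D ^+ 2 * (1 / 600 * (1 / 600)) by rewrite ler_wpM2l // sqr_ge0.
have h2 : (N * (alpha * w)) * (e - 1) <= (N * (alpha * w)) * (3 * eps).
  by rewrite ler_wpM2l // ltW // mulr_gt0.
have KD : K / D <= K by rewrite ler_pdivrMr // ler_peMr.
have KD0 : 0 <= K / D by rewrite divr_ge0 // ltW.
have h3 : delta * N * (K / D) <= 1 / 24 * (K / D) by rewrite ler_wpM2r.
move=> h.
(* Multiplying by w = sqrt d turns the left side into d^2, the unit of the other terms. *)
have : D * w * w <= 12 * (144 * (N * (alpha * eps))) * w.
  have -> : D * w * w = D ^+ 2 by rewrite -mulrA -!expr2 w2 expr2.
  by lra.
by rewrite ler_pM2r.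
Qed.

(* The conclusion is stated in \bar R, where 1 / 0 = +oo: for eps = 0 or
   alpha = 0 it says that no such mechanism exists. *)
Theorem theorem4p11 (R : realType) :
  exists c1 c2 c3 : R, [/\ 0 < c1, 0 < c2 & 0 < c3] /\
  forall d : nat, (0 < d)%N ->
  exists D : probability 'M[R]_d R,
    {ae D, forall S : 'M[R]_d, loewner_le 1%:M S /\ loewner_le S 2%:M} /\
    forall (n : nat) (alpha eps delta : R)
      (M : R.-pker (n.-tuple 'rV[R]_d) ~> 'M[R]_d),
      (0 < n)%N ->
      0 <= alpha -> alpha <= c1 / Num.sqrt d%:R ->
      0 <= eps <= 1 -> 0 <= delta <= 1 ->
      delta <= c2 * delta_max d n ->
      diff_private eps delta M ->
      (expected_cov_error D M <= (alpha ^+ 2)%:E)%E ->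
      ((c3 * d%:R `^ (3 / 2))%:E / (alpha * eps)%:E <= n%:R%:E)%E.
Proof.
exists (1 / 600), (1 / 24), (1 / 12 / 144); split; first by split; lra.
move=> d d0; have [D [k [dk aeD bound]]] := private_covariance_tradeoff R d0.
exists D; split => // n alpha eps delta M n0 a0 ha eps01 /andP[delta0 _] hdelta dpM err.
have /andP[eps0 eps1] := eps01.
(* The error hypothesis weakens as alpha grows, so the sample bound holds at every admissible a >=
   alpha, also when alpha = 0. *)
have key a : 0 < a -> a <= 1 / 600 / Num.sqrt d%:R -> alpha <= a ->
    d%:R * Num.sqrt d%:R <= 12 * (144 * (n%:R * (a * eps))).
  move=> a1 a2 aa; apply: (tradeoff_sample_bound d0 n0 dk a1 a2 eps01 delta0 hdelta).
  apply: (bound n M) => //; apply: le_trans err _.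
  by rewrite lee_fin ler_sqr ?nnegrE // ltW.
have w1 : 1 <= Num.sqrt d%:R :> R by rewrite -[leLHS]sqrtr1 ler_sqrt // ler1n.
have dw : 1 <= d%:R * Num.sqrt d%:R :> R by rewrite mulr_ege1 // ler1n.
have nR : 0 < n%:R :> R by rewrite ltr0n.
have apos : 0 < alpha.
  rewrite lt_neqAle a0 andbT; apply/negP => /eqP az.
  (* The second bound makes 12 * 144 * n a eps at most 1/2, against d sqrt d >= 1. *)
  pose a := Num.min (1 / 600 / Num.sqrt d%:R) (1 / 24 / 144 / n%:R) : R.
  have w0 : 0 < Num.sqrt d%:R :> R by lra.
  have q1 : 0 < 1 / 600 :> R by lra.
  have q2 : 0 < 1 / 24 / 144 :> R by lra.
  have a1 : 0 < a by rewrite lt_min (divr_gt0 q1 w0) (divr_gt0 q2 nR).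
  have := key a a1; rewrite {1}/a ge_min lexx => /(_ erefl); rewrite -az => /(_ (ltW a1)).
  have an : a * n%:R <= 1 / 24 / 144 by rewrite -ler_pdivlMr // /a ge_min lexx orbT.
  have : n%:R * (a * eps) <= a * n%:R.
    by rewrite mulrCA mulrA ler_piMr // mulr_ge0 // ltW.
  by lra.
have hk := key alpha apos ha (lexx _).
have ae0 : 0 < alpha * eps.
  rewrite lt_neqAle mulr_ge0 // andbT; apply/negP => /eqP z.
  by move: hk; rewrite -z !mulr0; lra.
rewrite inver gt_eqF // -EFinM lee_fin ler_pdivrMr //.
have -> : d%:R `^ (3 / 2) = d%:R * Num.sqrt d%:R :> R.
  have -> : (3 / 2 : R) = 1 + 2^-1 by field.
  by rewrite powRD ?powRr1 ?powR12_sqrt // pnatr_eq0 -lt0n d0 implybT.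
by lra.
Qed.
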